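(* Let $G:\mathbb{R}^d\to\mathbb{R}$ (possibly of mixed sign), let $\bm\mu_0\in\mathbb{R}^d$ and let $\bm\Sigma_0$ be a $d\times d$ (symmetric positive definite) covariance matrix, and let $C=\int_{\mathbb{R}^d}G(\bm z)p(\bm z;\bm\mu_0,\bm\Sigma_0)\,d\bm z$. Let $\bm\mu_+,\bm\mu_-\in\mathbb{R}^d$, let $\bm\Sigma_+,\bm\Sigma_-$ be $d\times d$ (symmetric positive definite) covariance matrices, and let $\bm L_\pm$ be $d\times d$ matrices with $\bm L_+\bm L_+^T=\bm\Sigma_+$ and $\bm L_-\bm L_-^T=\bm\Sigma_-$. Fix $\eta>0$ and set $v_+(z)=\frac z2+\sqrt{\eta+z^2/4}$, $v_-(z)=-\frac z2+\sqrt{\eta+z^2/4}$ for $z\in\mathbb{R}$, and $$G_{\mathrm{IS}}^{\pm}(\bm z)=v_\pm\big(G(\bm\mu_\pm+\bm L_\pm\bm z)\big)\,W_\pm(\bm z),$$ $$W_\pm(\bm z)=\frac{\det(\bm\Sigma_\pm)^{1/2}}{\det(\bm\Sigma_0)^{1/2}}\exp\left\{\frac12\bm z^T\bm z-\frac12(\bm\mu_\pm-\bm\mu_0+\bm L_\pm\bm z)^T\bm\Sigma_0^{-1}(\bm\mu_\pm-\bm\mu_0+\bm L_\pm\bm z)\right\}.$$ If, for both $(\bm\mu,\bm L)=(\bm\mu_+,\bm L_+)$ and $(\bm\mu,\bm L)=(\bm\mu_-,\bm L_-)$, all the eigenvalues of $\bm L^T\bm\Sigma_0^{-1}\bm L$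 are not smaller than $1$ and $\tilde G(\bm z)=G(\bm\mu+\bm L\bm z)$ satisfies the ''QMC-friendly'' boundary growth condition, then for arbitrarily small $\epsilon>0$, $$\sqrt{\mathbb{E}\left[(\hat I_N(G_{\mathrm{IS}}^+-G_{\mathrm{IS}}^-)-C)^2\right]}=O(N^{-1+\epsilon}).$$
   Context: $p(\cdot;\bm\mu,\bm\Sigma)$ is the density of the $d$-dimensional normal distribution $N(\bm\mu,\bm\Sigma)$. For $v\subseteq\{1,\dots,d\}$, $D_vG$ denotes the mixed partial derivative of a function $G$ taken once with respect to each $z_j$, $j\in v$, with $D_\emptyset G=G$; integrands are assumed smooth enough that these derivatives exist and are continuous. $\Phi$ is the standard normal CDF and $\Phi^{-1}$ its inverse (applied componentwise to vectors). QMC-friendly boundary growth condition for $G:\mathbb{R}^d\to\mathbb{R}$: for arbitrarily small $B_1,\dots,B_d>0$ there exists a constant $B>0$ (depending on the $B_i$) such that for every $v\subseteq\{1,\dots,d\}$ and all $\bm z\in\mathbb{R}^d$, $$|(D_vG)(\bm z)|\le B\prod_{i=1}^d[1-\Phi(|z_i|)]^{-B_i}.$$ For $H:\mathbb{R}^d\to\mathbb{R}$, $\hat I_N(H)=\frac1N\sum_{i=1}^NH(\Phi^{-1}(\bm u_i))$, where $\bm u_1,\dots,\bm u_N$ are a scrambled $(t,m,d)$-net in base $b\ge2$ with $N=b^m$. Thus $\hat I_N(G_{\mathrm{IS}}^+-G_{\mathrm{IS}}^-)=\hat I_N(G_{\mathrm{IS}}^+)-\hat I_N(G_{\mathrm{IS}}^-)$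 with both parts using the same random points. Nets: an elementary interval in base $b$ is a set $\prod_{j=1}^d[a_jb^{-k_j},(a_j+1)b^{-k_j})$ with integers $k_j\ge0$, $0\le a_j<b^{k_j}$. A collection of $b^m$ points of $[0,1)^d$ is a $(t,m,d)$-net in base $b$ (integers $0\le t\le m$) if every elementary interval in base $b$ of volume $b^{t-m}$ contains exactly $b^t$ of the points. Scrambled net (Owen's nested uniform scrambling): given a (deterministic) $(t,m,d)$-net $\bm a_1,\dots,\bm a_N$ with base-$b$ digits $a_i^j=\sum_{k\ge1}a_{ijk}b^{-k}$ of the $j$-th coordinate of $\bm a_i$, the scrambled points $\bm u_i$ have coordinates $u_i^j=\sum_{k\ge1}u_{ijk}b^{-k}$ with $u_{ij1}=\pi_j(a_{ij1})$ and $u_{ijk}=\pi_{j;a_{ij1},\dots,a_{ij,k-1}}(a_{ijk})$ for $k\ge2$, where all the permutations $\pi_\cdot$ are mutually independent and uniformly distributed over the permutations of $\{0,\dots,b-1\}$. The $O(\cdot)$ statement is as $N=b^m\to\infty$ with $t,b,d$ fixed; its implied constant may depend on $\epsilon$. *)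

(* Defs.v *)
From HB Require Import structures.
From mathcomp Require Import all_boot all_order all_algebra perm.
From mathcomp Require Import all_classical all_reals all_analysis.

Set Implicit Arguments.
Unset Strict Implicit.
Unset Printing Implicit Defensive.

Import Order.TTheory GRing.Theory Num.Theory.
Import numFieldNormedType.Exports.

Local Open Scope classical_set_scope.
Local Open Scope ring_scope.

Section lebesgue_tuple.
Context {R : realType}.
Local Open Scope ereal_scope.

Local Notation mR := (measurableTypeR R).

Definition cons_pair n (p : mR * n.-tuple mR) : n.+1.-tuple mR :=
  [tuple of p.1 :: p.2].

Section lebesgue_cons.
Variables (n : nat) (mu : {sigma_finite_measure set (n.-tuple mR) -> \bar R}).

Let prod : {measure set (mR * n.-tuple mR)%type -> \bar R} :=
  lebesgue_measure \x mu.

Definition lebesgue_cons : set (n.+1.-tuple mR) -> \bar R :=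
  pushforward (lebesgue_measure \x mu) (@cons_pair n).

Let uncons (t : n.+1.-tuple mR) : mR * n.-tuple mR :=
  (thead t, [tuple of behead t]).

Let cons_pairK : cancel (@cons_pair n) uncons.
Proof. by case=> x t; congr (_, _); apply: val_inj. Qed.

Let measurable_cons_pair : measurable_fun [set: _] (@cons_pair n).
Proof. exact: measurable_cons. Qed.

Let measurable_uncons : measurable_fun [set: _] uncons.
Proof.
apply/measurable_fun_pairP; split.
- exact: measurable_tnth.
- exact: measurable_behead.
Qed.

Let lebesgue_cons0 : lebesgue_cons set0 = 0.
Proof. by rewrite /lebesgue_cons /pushforward preimage_set0 measure0. Qed.

Let lebesgue_cons_ge0 A : 0 <= lebesgue_cons A.
Proof. exact: measure_ge0. Qed.

Let lebesgue_cons_sigma_additive : semi_sigma_additive lebesgue_cons.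
Proof.
exact: (@measure_semi_sigma_additive _ _ _
  (measure_function_pushforward__canonical__measure_function_Measure
     prod measurable_cons_pair)).
Qed.

HB.instance Definition _ := isMeasure.Build _ _ _ lebesgue_cons
  lebesgue_cons0 lebesgue_cons_ge0 lebesgue_cons_sigma_additive.

Let lebesgue_cons_sigma_finite : sigma_finite setT lebesgue_cons.
Proof.
pose lam : {sigma_finite_measure set mR -> \bar R} := lebesgue_measure.
have /sigma_finiteP[F [TF ndF Foo]] := sigma_finiteT lam.
have /sigma_finiteP[G [TG ndG Goo]] := sigma_finiteT mu.
exists (fun k => uncons @^-1` (F k `*` G k)).
  rewrite -preimage_bigcup; apply/esym; rewrite -subTset => t _ /=.
  have : setT (uncons t).1 by [].
  have : setT (uncons t).2 by [].
  rewrite TF TG => -[k _ Gk] [i _ Fi]; exists (maxn i k) => //; split.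
    by move: Fi; exact/subsetPset/ndF/leq_maxl.
  by move: Gk; exact/subsetPset/ndG/leq_maxr.
move=> k; have [mF Fk] := Foo k; have [mG Gk] := Goo k.
split; first by rewrite -[X in measurable X]setTI;
  apply: measurable_uncons => //; exact: measurableX.
rewrite /lebesgue_cons /pushforward -comp_preimage.
rewrite (_ : uncons \o _ = idfun); last first.
  by apply/funext => p; exact: cons_pairK.
rewrite preimage_id product_measure1E //.
by apply: lte_mul_pinfty => //; rewrite ge0_fin_numE.
Qed.

HB.instance Definition _ := Measure_isSigmaFinite.Build _ _ _ lebesgue_cons
  lebesgue_cons_sigma_finite.

End lebesgue_cons.

(* Lebesgue measure on R^n: the n-fold product of the one on R *)
Fixpoint lebesgue_tuple (n : nat) :
    {sigma_finite_measure set (n.-tuple mR) -> \bar R} :=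
  match n with
  | 0 => \d_([tuple] : 0.-tuple mR)
  | k.+1 => lebesgue_cons (lebesgue_tuple k)
  end.

Lemma lebesgue_tuple_box n (A : 'I_n -> set mR) :
  (forall i, measurable (A i)) ->
  lebesgue_tuple n [set t | forall i, A i (tnth t i)] =
  \prod_(i < n) lebesgue_measure (A i).
Proof.
elim: n => [|n IHn] in A * => mA.
  rewrite big_ord0 /= diracE mem_set // => -[] //.
rewrite big_ord_recl -IHn // /= /lebesgue_cons /pushforward.
rewrite -product_measure1E //.
  congr (_ _); apply/seteqP; split => [[x t] h|[x t] [/= Ax At] i] /=.
    split; first exact: (h ord0).
    by move=> i /=; have := h (lift ord0 i); rewrite /= tnthS.
  by case: (unliftP ord0 i) => [j|] -> //; rewrite tnthS; exact: At.
rewrite (_ : mkset _ = \bigcap_(i in [set: 'I_n])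
    ((@tnth _ mR ^~ i) @^-1` A (lift ord0 i))); last first.
  by apply/seteqP; split=> [t h i _|t h i]; [exact: h|exact: h].
apply: fin_bigcap_measurable => [|i _]; first exact: finite_finset.
by rewrite -[X in measurable X]setTI; exact: measurable_tnth.
Qed.

End lebesgue_tuple.

(* R^d is 'cV[R]_d in formulas and d.-tuple R in integrals. *)
Definition integral_Rd (R : realType) (d : nat) (f : 'cV[R]_d -> R) : R :=
  \int[lebesgue_tuple d]_x f (\col_i tnth x i).

Definition posdef (R : realType) (d : nat) (S : 'M[R]_d) : Prop :=
  S^T = S /\ forall x : 'cV[R]_d, x != 0 -> 0 < (x^T *m S *m x) 0 0.

Definition normal_density (R : realType) (d : nat) (mu : 'cV[R]_d)
    (S : 'M[R]_d) (z : 'cV[R]_d) : R :=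
  (Num.sqrt ((2 * pi) ^+ d * \det S))^-1 *
  expR (- (2^-1 * ((z - mu)^T *m invmx S *m (z - mu)) 0 0)).

Definition Phi (R : realType) (x : R) : R :=
  fine (normal_prob (0 : R) 1 `]-oo, x]).

(* Phi is injective with range ]0, 1[; outside this range the value is 0, which
   concerns an event of probability zero for scrambled points. *)
Definition Phi_inv (R : realType) (u : R) : R := xget 0 [set x | Phi x = u].

(* Partial derivatives in each coordinate of s, the head of s being applied
   last. *)
Definition partials (R : realType) (d : nat) (s : seq 'I_d)
    (G : 'cV[R]_d -> R) : 'cV[R]_d -> R :=
  foldr (fun j F z => 'D_(delta_mx j 0) F z) G s.

(* All derivatives taken at most once in each coordinate exist and are
   continuous, whatever the order of differentiation; that order is then
   irrelevant, and [Dmix] fixes the one of [enum v]. *)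
Definition mixed_smooth (R : realType) (d : nat) (G : 'cV[R]_d -> R) : Prop :=
  forall s : seq 'I_d, uniq s ->
    continuous (partials s G) /\
    forall (j : 'I_d) (z : 'cV[R]_d), j \notin s ->
      derivable (partials s G) z (delta_mx j 0).

Definition Dmix (R : realType) (d : nat) (v : {set 'I_d}) (G : 'cV[R]_d -> R) :
  'cV[R]_d -> R := partials (enum v) G.

(* As 1 - Phi |z_i| <= 1, the bound gets weaker when B i increases, so that "for
   arbitrarily small B i > 0" amounts to "for all B i > 0". *)
Definition qmc_friendly (R : realType) (d : nat) (G : 'cV[R]_d -> R) : Prop :=
  mixed_smooth G /\
  forall B : 'I_d -> R, (forall i, 0 < B i) ->
    exists2 B0 : R, 0 < B0 & forall (v : {set 'I_d}) (z : 'cV[R]_d),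
      `|Dmix v G z| <= B0 * \prod_(i < d) (1 - Phi `|z i 0|) `^ (- B i).

Definition v_plus (R : realType) (eta z : R) : R :=
  z / 2 + Num.sqrt (eta + z ^+ 2 / 4).

Definition v_minus (R : realType) (eta z : R) : R :=
  - (z / 2) + Num.sqrt (eta + z ^+ 2 / 4).

Definition IS_weight (R : realType) (d : nat) (mu0 : 'cV[R]_d) (S0 : 'M[R]_d)
    (mu : 'cV[R]_d) (S L : 'M[R]_d) (z : 'cV[R]_d) : R :=
  let x := mu - mu0 + L *m z in
  Num.sqrt (\det S) / Num.sqrt (\det S0) *
  expR (2^-1 * (z^T *m z) 0 0 - 2^-1 * (x^T *m invmx S0 *m x) 0 0).

Definition G_IS (R : realType) (d : nat) (v : R -> R) (G : 'cV[R]_d -> R)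
    (mu0 : 'cV[R]_d) (S0 : 'M[R]_d) (mu : 'cV[R]_d) (S L : 'M[R]_d)
    (z : 'cV[R]_d) : R :=
  v (G (mu + L *m z)) * IS_weight mu0 S0 mu S L z.

Definition I_hat (R : realType) (d N : nat) (u : 'I_N -> 'cV[R]_d)
    (H : 'cV[R]_d -> R) : R :=
  N%:R^-1 * \sum_(i < N) H (map_mx (@Phi_inv R) (u i)).

(* Elementary interval \prod_j [a_j b^-k_j, (a_j + 1) b^-k_j[ *)
Definition in_elementary (R : realType) (d b : nat) (k a : 'I_d -> nat)
    (x : 'cV[R]_d) : bool :=
  [forall j, (a j)%:R / b%:R ^+ k j <= x j 0 < (a j).+1%:R / b%:R ^+ k j].

Definition is_net (R : realType) (b t m d : nat)
    (x : 'I_(b ^ m) -> 'cV[R]_d) : Prop :=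
  [/\ (t <= m)%N,
      forall i j, 0 <= x i j 0 < 1
    & forall k a : 'I_d -> nat, (forall j, (a j < b ^ k j)%N) ->
        \prod_(j < d) (b%:R ^+ k j)^-1 = b%:R ^+ t / b%:R ^+ m :> R ->
        #|[pred i | in_elementary b k a (x i)]| = (b ^ t)%N].
Arguments is_net {R} b t m {d} x.

(* Digits are numbered from 0: [digit _ x k] is the coefficient of b^-(k+1) in
   the terminating-when-possible base-b expansion of x in [0, 1[. *)
Definition digit (R : realType) (b : nat) (b_gt1 : (1 < b)%N) (x : R)
    (k : nat) : 'I_b :=
  Ordinal (ltn_pmod (Num.truncn (x * b%:R ^+ k.+1)) (ltnW b_gt1)).

(* [perms j p] is the permutation applied to the j-th coordinate's digit
   following the digits p. *)
Definition scramble (R : realType) (d b : nat) (b_gt1 : (1 < b)%N)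
    (perms : 'I_d -> seq 'I_b -> {perm 'I_b}) (x : 'cV[R]_d) : 'cV[R]_d :=
  \col_j limn (series (fun k : nat =>
    (perms j [seq digit b_gt1 (x j 0) l | l <- iota 0 k]
       (digit b_gt1 (x j 0) k))%:R / b%:R ^+ k.+1 : R)).

Definition uniform_independent_perms (R : realType) (disp : measure_display)
    (Omega : measurableType disp) (P : probability Omega R) (d b : nat)
    (perms : Omega -> 'I_d -> seq 'I_b -> {perm 'I_b}) : Prop :=
  [/\ forall j p s, measurable [set w | perms w j p = s],
      forall j p s,
        P [set w | perms w j p = s] = (#|{perm 'I_b}|%:R^-1)%:E
    & forall (I : seq ('I_d * seq 'I_b))
        (A : 'I_d * seq 'I_b -> {set {perm 'I_b}}), uniq I ->
        P [set w | forall i, i \in I -> perms w i.1 i.2 \in A i] =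
        (\prod_(i <- I) P [set w | perms w i.1 i.2 \in A i])%E].

(* Main.v *)
(* Truncate all digit expansions at a level M >= m and expand the integrand, sampled
   at the cell midpoints, as the sum over k in {0..M}^d of its components Delta_k
   with respect to the nested digit kernels. Components with |k| <= m - t are
   integrated exactly by a (t, m, d)-net; for the others, nested scrambling makes
   distant points uncorrelated, and each contributes at most N b^(t+d) |Delta_k|^2.
   Coordinatewise, the growth condition bounds an increment of the integrand by one
   of psi(u) = (1 - u)^-B - u^-B, which is Hoelder with an integrable constant; hence
   |Delta_k|^2 decays like b^(-2 theta |k|) for every theta < 1, uniformly in M. This
   gives E(I_M - mean_M)^2 <= K N^(-2 + 2 eps), and Fatou's lemma as M goes to infinity
   transfers it to the scrambled net. The midpoint means converge to the Gaussian
   integral by dominated convergence.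
   The integrand satisfies the growth condition because v_+ and v_- are smooth with
   bounded derivatives and because, the eigenvalues of L^T Sigma_0^-1 L being at
   least 1, the exponent of the weight W is at most affine. Its Gaussian integral is C
   by an affine change of variables and v_+ - v_- = id. *)
Require Import Defs.
From HB Require Import structures.
From mathcomp Require Import all_boot all_order all_algebra perm.
From mathcomp Require Import all_classical all_reals all_analysis.
From mathcomp Require Import measurable_realfun ring lra zify.

Set Implicit Arguments.
Unset Strict Implicit.
Unset Printing Implicit Defensive.

Import Order.TTheory GRing.Theory Num.Theory.
Import numFieldNormedType.Exports.

Local Open Scope classical_set_scope.
Local Open Scope ring_scope.

(** * Digit kernels and the tensor decomposition *)

(** The obstacle is that the integrand is unbounded near the faces of the cube, so its size is
    measured in mean square, component by component. At resolution b^-M, nested scrambling is the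
    uniform law on a finite family of permutations indexed by the nodes of a tree: uniformity and
    decorrelation become counting arguments. Midpoints keep the integrand finite, with a growth
    comparable to that at any point of the cell. The exponents are tight. An increment of psi over a
    distance h costs h^theta times min(u, 1 - u)^-(B + theta), whose square is integrable only if B
    + theta < 1/2. So the mean square of Delta_k decays like b^(-2 theta |k|) with 2 theta just
    below 1; beyond |k| = m - t this is almost 1/N, and decorrelation provides the other factor 1/N.
    The kernels are tensor products, so mixed derivatives are consumed one coordinate at a time,
    each one-dimensional estimate using a function and its first derivative. Since v_+ and v_- are
    nonnegative, changes of variables are made by Tonelli on each part before the two parts are
    subtracted. *)

Section digit_kernels.
Variables (R : realFieldType) (b M : nat).
Hypothesis b_gt0 : (0 < b)%N.
Local Notation X := {ffun 'I_M -> 'I_b}.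
Implicit Types (x y : X) (k : nat).

Definition agree k x y := [forall i : 'I_M, (i < k)%N ==> (x i == y i)].

Lemma agreeP k x y :
  reflect (forall i : 'I_M, (i < k)%N -> x i = y i) (agree k x y).
Proof.
apply: (iffP forallP) => h i; first by move=> ik; apply/eqP/(implyP (h i)).
by apply/implyP => ik; apply/eqP/h.
Qed.

Lemma agree_refl k x : agree k x x.
Proof. exact/agreeP. Qed.

Lemma agree_sym k x y : agree k x y = agree k y x.
Proof. by apply/agreeP/agreeP => h i ik; rewrite h. Qed.

Lemma agree_trans k x y z : agree k x y -> agree k y z -> agree k x z.
Proof.
by move=> /agreeP xy /agreeP yz; apply/agreeP => i ik; rewrite xy ?yz.
Qed.

Lemma agree_le k k' x y : (k' <= k)%N -> agree k x y -> agree k' x y.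
Proof.
by move=> kk' /agreeP h; apply/agreeP => i ik; rewrite h// (leq_trans ik).
Qed.

Lemma agreeM x y : agree M x y = (x == y).
Proof.
apply/agreeP/eqP => [h|-> //]; apply/ffunP => i; exact: h.
Qed.

Lemma agree0 x y : agree 0 x y.
Proof. exact/agreeP. Qed.

Lemma agreeS (k : 'I_M) x y : agree k.+1 x y = agree k x y && (x k == y k).
Proof.
apply/agreeP/andP => [h|[/agreeP h /eqP e] i]; last first.
  by rewrite ltnS leq_eqVlt => /predU1P[/val_inj -> //|]; exact: h.
split; first by apply/agreeP => i ik; rewrite h// ltnW.
by apply/eqP/h.
Qed.

Definition set_digit (k : 'I_M) (s : 'I_b) x : X :=
  [ffun i => if i == k then s else x i].

Lemma agree_set_digit k (i : 'I_M) s x y :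
  (k <= i)%N -> agree k (set_digit i s x) y = agree k x y.
Proof.
move=> ki; apply/agreeP/agreeP => h j jk; rewrite -h// ffunE ifN//;
  by apply: contraTneq jk => ->; rewrite -leqNgt.
Qed.

Lemma card_agree k x : (k <= M)%N -> #|[pred y | agree k x y]| = (b ^ (M - k))%N.
Proof.
move=> kM.
have -> : #|[pred y | agree k x y]| =
    #|family (fun i : 'I_M => [pred s : 'I_b | (i < k)%N ==> (x i == s)])|.
  apply: eq_card => y; rewrite [LHS]inE.
  by apply/forallP/familyP => /= h i; have := h i; rewrite !inE.
rewrite card_family.
rewrite foldrE big_map big_enum /=.
rewrite (bigID (fun i : 'I_M => (i < k)%N)) /=.
rewrite big1 ?mul1n; last first.
  move=> i ik; rewrite (eq_card (B := pred1 (x i))) ?card1// => s.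
  by rewrite !inE ik /= eq_sym.
rewrite (eq_bigr (fun=> b)); last first.
  move=> i ik; rewrite -[RHS]card_ord; apply: eq_card => s.
  by rewrite !inE (negbTE ik).
rewrite prod_nat_const; congr (_ ^ _)%N.
rewrite -sum1_card.
transitivity (\sum_(i < M | ~~ (i < k)%N) 1)%N => //.
have := sum1_card (predT : pred 'I_M); rewrite card_ord.
rewrite (bigID (fun i : 'I_M => (i < k)%N)) /=.
have -> : (\sum_(i < M | (i < k)%N) 1 = k)%N.
  by rewrite -(big_ord_widen _ (fun=> 1%N)) // sum1_card card_ord.
by move=> e; apply/eqP; rewrite -(eqn_add2l k) subnKC// e.
Qed.

(** Kernel of the conditional expectation given the first k digits: it is uniform on the b^(M-k)
    points sharing them with x. *)
Definition ker k x y : R := (agree k x y)%:R / (b ^ (M - k))%:R.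

Lemma ker_ge0 k x y : 0 <= ker k x y.
Proof. by rewrite divr_ge0 ?ler0n. Qed.

Lemma ker_sym k x y : ker k x y = ker k y x.
Proof. by rewrite /ker agree_sym. Qed.

Let bX_neq0 n : (b ^ n)%:R != 0 :> R.
Proof. by rewrite pnatr_eq0 -lt0n expn_gt0 b_gt0. Qed.

Lemma sum_ker k x : (k <= M)%N -> \sum_y ker k x y = 1.
Proof.
move=> kM; rewrite -mulr_suml -natr_sum.
have -> : (\sum_y agree k x y)%N = #|[pred y | agree k x y]|.
  rewrite -sum1_card [RHS]big_mkcond /=; apply: eq_bigr => y _.
  by rewrite inE; case: (agree _ _ _).
by rewrite card_agree// divff.
Qed.

Lemma kerME x y : ker M x y = (x == y)%:R.
Proof. by rewrite /ker agreeM subnn expn0 divr1. Qed.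

(* Kernel of the projection onto the functions of the first k digits whose mean over
   the k-th digit vanishes. *)
Definition dker k x y : R :=
  ker k x y - (if k is k'.+1 then ker k' x y else 0).

Lemma sum_dker x y : \sum_(k < M.+1) dker k x y = (x == y)%:R.
Proof.
rewrite -kerME.
suff H n : \sum_(k < n.+1) dker k x y = ker n x y by exact: H.
elim: n => [|n IHn].
  by rewrite big_ord_recr big_ord0 /= /dker subr0 add0r.
by rewrite big_ord_recr IHn /= /dker addrC subrK.
Qed.

(** Digits are numbered from 0, so level k.+1 is the one that reads digit k. Of the b values of this
    digit only one agrees with y, and its weight is b times that of the coarser kernel, which is
    blind to the digit and is counted b times. *)
Lemma sum_dker_set_digit (k : 'I_M) x y :
  \sum_s dker k.+1 (set_digit k s x) y = 0.
Proof.
rewrite sumrB /=.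
under [X in _ - X]eq_bigr do rewrite /ker agree_set_digit//.
rewrite sumr_const card_ord.
under eq_bigr do rewrite /ker agreeS agree_set_digit// ffunE eqxx mulrb.
rewrite (bigD1 (y k))//= big1 ?addr0; last first.
  by move=> s /negbTE ->; rewrite andbF mul0r.
rewrite eqxx andbT /ker.
have -> : (M - k = (M - k.+1).+1)%N by rewrite subnSK.
rewrite expnS natrM; case: agree; rewrite /= ?mul0r ?mul0rn ?subrr//.
rewrite -[X in _ - X]mulr_natr; apply/eqP; rewrite subr_eq0; apply/eqP.
by field; rewrite bX_neq0 pnatr_eq0 -lt0n b_gt0.
Qed.

End digit_kernels.

Lemma prod_nat_forall (I : finType) (P : pred I) :
  (\prod_i P i = [forall i, P i])%N.
Proof.
case: forallP => [h|/forallP]; first by rewrite big1// => i _; rewrite h.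
by rewrite negb_forall => /existsP[i /negbTE Pi]; rewrite (bigD1 i)//= Pi.
Qed.

Section tensor_kernels.
Variables (R : realFieldType) (b M d : nat).
Hypothesis b_gt0 : (0 < b)%N.
Local Notation X := {ffun 'I_M -> 'I_b}.
Local Notation D := {ffun 'I_d -> X}.
Local Notation K := {ffun 'I_d -> 'I_M.+1}.
Implicit Types (x y : D) (k : K) (F : D -> R).

Definition Delta k F x : R := \sum_(y : D) (\prod_l dker R (k l) (x l) (y l)) * F y.

Lemma sum_Delta F x : \sum_k Delta k F x = F x.
Proof.
rewrite /Delta exchange_big /=.
under eq_bigr => y _.
  rewrite -mulr_suml.
  rewrite -(bigA_distr_bigA (fun l (k : 'I_M.+1) => dker R k (x l) (y l))).
  under eq_bigr do rewrite sum_dker.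
  over.
rewrite (bigD1 x)//= [X in _ + X]big1 ?addr0; last first.
  move=> y yx; have [l xy] : exists l, x l != y l.
    apply/existsP; rewrite -negb_forall; apply: contra yx => /forallP h.
    by apply/eqP/ffunP => l; apply/esym/eqP.
  by rewrite (bigD1 l)//= (negbTE xy) !mul0r.
by rewrite big1 ?mul1r// => l _; rewrite eqxx.
Qed.

Definition set_digit_at (l : 'I_d) (i : 'I_M) (s : 'I_b) x : D :=
  [ffun l' => if l' == l then set_digit i s (x l') else x l'].

Lemma sum_Delta_set_digit (l : 'I_d) (i : 'I_M) k F x :
  k l = i.+1 :> nat -> \sum_s Delta k F (set_digit_at l i s x) = 0.
Proof.
move=> kl; rewrite /Delta exchange_big /=; apply: big1 => y _.
rewrite -mulr_suml.
under eq_bigr.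
  move=> s _; rewrite (bigD1 l)//= ffunE eqxx kl.
  under [X in _ * X]eq_bigr => j jl do rewrite ffunE (negbTE jl).
  over.
by rewrite -mulr_suml sum_dker_set_digit// !mul0r.
Qed.

Definition agree_all (k : 'I_d -> nat) x y := [forall l, agree (k l) (x l) (y l)].

Lemma agree_all_le (k k' : 'I_d -> nat) x y : (forall l, (k' l <= k l)%N) ->
  agree_all k x y -> agree_all k' x y.
Proof.
by move=> kk' /forallP h; apply/forallP => l; exact: agree_le (kk' l) (h l).
Qed.

Let bX_neq0 n : (b ^ n)%:R != 0 :> R.
Proof. by rewrite pnatr_eq0 -lt0n expn_gt0 b_gt0. Qed.

Lemma card_digits : #|{: D}| = (b ^ (M * d))%N.
Proof. by rewrite !card_ffun !card_ord expnM. Qed.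

(* A (t, m, d)-net at resolution b^-M; [r] plays the role of m - t. *)
Definition equidistributed m r N (c : 'I_N -> D) := forall (k : 'I_d -> nat) y,
  (forall l, (k l <= M)%N) -> (\sum_l k l <= r)%N ->
  #|[pred i | agree_all k (c i) y]| = (b ^ (m - \sum_l k l))%N.

(** The box of y holds b^(m-|k|) of the points and the kernels divide by b^(Md-|k|): the depth |k|
    cancels. *)
Lemma sum_ker_equidistributed m r N (c : 'I_N -> D) (k : 'I_d -> nat) y :
  equidistributed m r c ->
  (forall l, (k l <= M)%N) -> (\sum_l k l <= r)%N -> (r <= m)%N ->
  \sum_i \prod_l ker R (k l) (c i l) (y l) = (b ^ m)%:R / #|{: D}|%:R.
Proof.
move=> cP kM kr rm.
have skM : (\sum_l k l <= M * d)%N.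
  rewrite mulnC -[d in (d * _)%N](card_ord d) -sum_nat_const.
  exact: leq_sum.
transitivity (\sum_i (agree_all k (c i) y)%:R / (b ^ (M * d - \sum_l k l))%:R : R).
  apply: eq_bigr => i _; rewrite /ker big_split /= prodfV -natr_prod.
  congr (_ / _); last first.
    rewrite -natr_prod -expn_sum; congr ((_ ^ _)%:R).
    rewrite sumnB//; congr (_ - _)%N.
    by rewrite sum_nat_const card_ord mulnC.
  by rewrite prod_nat_forall.
rewrite -mulr_suml -natr_sum.
have -> : (\sum_i agree_all k (c i) y)%N = #|[pred i | agree_all k (c i) y]|.
  rewrite -sum1_card [RHS]big_mkcond /=; apply: eq_bigr => i _.
  by rewrite inE; case: agree_all.
rewrite cP// card_digits.
rewrite -{2}(subnKC skM) -{2}(subnKC (leq_trans kr rm)) !expnD !natrM.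
by field; rewrite !bX_neq0.
Qed.

(** The product of differences of kernels expands into products of kernels of total depth at most r,
    whose sums over the net all coincide; what remains is the product of the one-dimensional sums of
    signs. *)
Lemma sum_Delta_equidistributed m r N (c : 'I_N -> D) k F :
  equidistributed m r c ->
  (\sum_l k l <= r)%N -> (r <= m)%N ->
  \sum_i Delta k F (c i) = [forall l, k l == ord0]%:R *
    ((b ^ m)%:R / #|{: D}|%:R * \sum_y F y).
Proof.
move=> cP kr rm; rewrite /Delta exchange_big /=.
under eq_bigr do rewrite -mulr_suml.
rewrite mulrA mulr_sumr; apply: eq_bigr => y _; congr (_ * _).
(* The boolean selects the second kernel of [dker]; the factor [0 < k l] removes this choice at
   level 0, where there is no second kernel. *)
pose G i l (e : bool) : R := (if e then - (0 < k l)%:R else 1) *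
  ker R (k l - e)%N (c i l) (y l).
have GE i : \prod_l dker R (k l) (c i l) (y l) =
    \sum_(f : {ffun 'I_d -> bool}) \prod_l G i l (f l).
  rewrite -bigA_distr_bigA; apply: eq_bigr => l _.
  rewrite big_bool /G subn0 subn1 /= mul1r addrC /dker.
  by case: (nat_of_ord (k l)) => [|n] /=; rewrite ?oppr0 ?mul0r// mulN1r.
under eq_bigr do rewrite GE.
rewrite exchange_big /=.
under eq_bigr.
  move=> f _; under eq_bigr do rewrite big_split /=.
  rewrite -mulr_sumr (sum_ker_equidistributed (m := m) (r := r))//; last 2 first.
    move=> l; rewrite (leq_trans (leq_subr _ _))//.
    by rewrite -ltnS.
  - by rewrite (leq_trans _ kr)//; apply: leq_sum => l _; exact: leq_subr.
  over.
rewrite -mulr_suml; congr (_ * _).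
rewrite -(bigA_distr_bigA (fun l (e : bool) => if e then - (0 < k l)%:R else 1)).
under eq_bigr do rewrite big_bool /= addrC.
rewrite -prod_nat_forall natr_prod; apply: eq_bigr => l _.
have -> : (k l == ord0) = ~~ (0 < k l)%N by rewrite lt0n negbK.
by case: (0 < k l)%N; rewrite /= ?subrr ?subr0.
Qed.

End tensor_kernels.

(** Used to coarsen a box that is too deep for the net property to one of the largest depth where
    points can be counted. *)
Lemma exists_sum_eq (d n : nat) (k : 'I_d -> nat) : (n <= \sum_l k l)%N ->
  exists2 k' : 'I_d -> nat, (forall l, k' l <= k l)%N & (\sum_l k' l = n)%N.
Proof.
elim: n => [|n IHn] nk.
  by exists (fun=> 0%N); rewrite // big1.
have [k' k'k k'n] := IHn (ltnW nk).
have [l lk] : exists l, (k' l < k l)%N.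
  apply/existsP; apply: contraLR nk; rewrite negb_exists => /forallP h.
  by rewrite -leqNgt -k'n; apply: leq_sum => l _; rewrite leqNgt h.
exists (fun i => if i == l then (k' l).+1 else k' i).
  by move=> i; case: eqP => // ->.
rewrite (bigD1 l)//= eqxx -k'n [in RHS](bigD1 l)//= addSn; congr (_ + _).+1.
by apply: eq_bigr => i /negbTE ->.
Qed.

(** Lagrange's identity: twice the difference of the two sides is the double sum of (w_i u_j - w_j
    u_i)^2 / (w_i w_j). *)
Lemma sqr_sum_le_weighted (R : realFieldType) (I : finType) (P : pred I)
    (w u : I -> R) : (forall i, 0 < w i) ->
  (\sum_(i | P i) u i) ^+ 2 <=
  (\sum_(i | P i) w i) * \sum_(i | P i) u i ^+ 2 / w i.
Proof.
move=> w0; rewrite -subr_ge0 expr2 !big_distrlr /=.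
rewrite -sumrB.
under eq_bigr do rewrite -sumrB.
suff : 0 <= 2 * \sum_(i | P i) \sum_(j | P j)
     (w i * (u j ^+ 2 / w j) - u i * u j) by rewrite pmulr_rge0.
rewrite mulr2n mulrDl !mul1r [X in _ + X]exchange_big -big_split /=.
apply: sumr_ge0 => i _; rewrite -big_split /=; apply: sumr_ge0 => j _.
have -> : w i * (u j ^+ 2 / w j) - u i * u j +
    (w j * (u i ^+ 2 / w i) - u j * u i) =
    (w i * u j - w j * u i) ^+ 2 / (w i * w j).
  by field; rewrite !gt_eqF.
by rewrite divr_ge0 ?sqr_ge0// mulr_ge0// ltW.
Qed.

(* [cU] and [cO] are all that is used of the scrambling: every scrambled point is
   uniform, and two points are uncorrelated along a function whose mean over the
   digit [p] of the coordinate [l] vanishes as soon as their deterministic sources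
   differ before that digit. *)
Section scrambled_variance.
Variables (R : realFieldType) (b M d m r N : nat) (T : finType).
Hypotheses (b_gt0 : (0 < b)%N) (rm : (r <= m)%N) (mM : (m <= M)%N).
Hypothesis NE : N = (b ^ m)%N.
Local Notation X := {ffun 'I_M -> 'I_b}.
Local Notation D := {ffun 'I_d -> X}.
Local Notation K := {ffun 'I_d -> 'I_M.+1}.
Variables (a : 'I_N -> D) (c : T -> 'I_N -> D).
Hypothesis cU : forall i (h : D -> R),
  \sum_x h (c x i) = #|T|%:R / #|{: D}|%:R * \sum_y h y.
Hypothesis cO : forall (l : 'I_d) (p : 'I_M) i j (g h : D -> R),
  ~~ agree p (a i l) (a j l) ->
  (forall y, \sum_s h (set_digit_at l p s y) = 0) ->
  \sum_x g (c x i) * h (c x j) = 0.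
Hypothesis aE : equidistributed m r a.
Hypothesis cE : forall x, equidistributed m r (c x).

(** Level k l concerns digit k l - 1, so a pair can be correlated only if its sources share k l - 1
    digits in every coordinate with k l > 0. This box has depth at least |k| - d; if its depth
    exceeds r, it lies in a box of depth exactly r. *)
Lemma card_close (k : K) i : (r < \sum_l k l)%N ->
  (#|[pred j | agree_all (fun l => (k l).-1) (a j) (a i)]| <= b ^ (m - r + d))%N.
Proof.
move=> rk; set k' := fun l => (k l).-1.
have k'M l : (k' l <= M)%N.
  by rewrite /k' -ltnS (leq_ltn_trans (leq_pred _))// ltn_ord.
have [k'r|k'r] := leqP (\sum_l k' l) r.
  rewrite aE// leq_pexp2l//.
  suff : (\sum_l k l <= \sum_l k' l + d)%N by lia.
  rewrite -[X in (_ + X)%N](card_ord d) -sum1_card -big_split /=.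
  by apply: leq_sum => l _; rewrite /k'; lia.
have [k'' k''k' k''r] := exists_sum_eq (ltnW k'r).
have le1 : (#|[pred j | agree_all k' (a j) (a i)]| <=
    #|[pred j | agree_all k'' (a j) (a i)]|)%N.
  apply/subset_leq_card/fintype.subsetP => j; rewrite !inE.
  exact: agree_all_le.
rewrite (leq_trans le1)// aE ?k''r//.
  by rewrite leq_pexp2l// leq_addr.
by move=> l; exact: leq_trans (k''k' l) _.
Qed.

Lemma sum_sqr_Delta (k : K) (F : D -> R) : (r < \sum_l k l)%N ->
  \sum_x (\sum_i Delta k F (c x i)) ^+ 2 <=
  N%:R * (b ^ (m - r + d))%:R *
  (#|T|%:R / #|{: D}|%:R * \sum_y Delta k F y ^+ 2).
Proof.
move=> rk; set G := (X in _ * X).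
have G0 : 0 <= G.
  by rewrite mulr_ge0 ?divr_ge0//; apply: sumr_ge0 => y _; exact: sqr_ge0.
under eq_bigr do rewrite expr2 big_distrlr /=.
rewrite exchange_big /=.
have -> : N%:R * (b ^ (m - r + d))%:R * G =
    \sum_(i < N) (b ^ (m - r + d))%:R * G.
  by rewrite sumr_const card_ord -[RHS]mulr_natl mulrA.
apply: ler_sum => i _; rewrite exchange_big /=.
rewrite (bigID (fun j => agree_all (fun l => (k l).-1) (a j) (a i))) /=.
rewrite [X in _ + X]big1 ?addr0; last first.
  move=> j; rewrite negb_forall => /existsP[l aij].
  have kl : (0 < k l)%N by apply: contraNT aij; case: (nat_of_ord (k l)) => //; rewrite agree0.
  have kM : ((k l).-1 < M)%N by rewrite prednK// -ltnS.
  apply: (cO (l := l) (p := Ordinal kM)) => [|y]; first by rewrite agree_sym.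
  by apply: sum_Delta_set_digit => //=; rewrite prednK.
(* AM-GM separates the two points, and each of them is uniform. *)
have pairs j : \sum_x Delta k F (c x i) * Delta k F (c x j) <= G.
  apply: (@le_trans _ _ (\sum_x (Delta k F (c x i) ^+ 2 / 2 + Delta k F (c x j) ^+ 2 / 2))).
    apply: ler_sum => x _; rewrite -subr_ge0.
    set u := Delta k F (c x i); set v := Delta k F (c x j).
    suff -> : u ^+ 2 / 2 + v ^+ 2 / 2 - u * v = (u - v) ^+ 2 / 2.
      by rewrite divr_ge0 ?sqr_ge0.
    by field.
  rewrite big_split /= -!mulr_suml (cU i (fun y => Delta k F y ^+ 2)).
  rewrite (cU j (fun y => Delta k F y ^+ 2)) -/G.
  by have -> : G / 2 + G / 2 = G by field.
apply: (@le_trans _ _ (\sum_(j | agree_all (fun l => (k l).-1) (a j) (a i)) G)).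
  exact: ler_sum.
rewrite sumr_const -[leLHS]mulr_natl ler_wpM2r// ler_nat.
exact: card_close.
Qed.

(* The net integrates exactly all components with |k| <= r; the other ones are
   summed by the Cauchy-Schwarz inequality with the weights p^|k|. *)
Lemma scrambled_variance (F : D -> R) (A p s : R) :
  0 <= A -> 0 < p < 1 -> 0 < s <= 1 -> (0 < #|T|)%N ->
  (forall k : K, (#|{: D}|%:R)^-1 * \sum_y Delta k F y ^+ 2 <=
     A * (p ^+ 2 * s) ^+ (\sum_l k l)) ->
  (#|T|%:R)^-1 * \sum_x (\sum_i F (c x i) - N%:R / #|{: D}|%:R * \sum_y F y) ^+ 2
  <= N%:R * (b ^ (m - r + d))%:R * A * ((1 - p)^-1 ^+ d) ^+ 2 * s ^+ r.
Proof.
move=> A0 /andP[p0 p1] /andP[s0 s1] T0 FA.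
pose P (k : K) := (r < \sum_l k l)%N.
pose w (k : K) := p ^+ (\sum_l k l).
have w0 k : 0 < w k by rewrite exprn_gt0.
have sw : \sum_k w k <= (1 - p)^-1 ^+ d.
  rewrite /w; under eq_bigr do rewrite expr_sum.
  rewrite -(bigA_distr_bigA (fun _ (k : 'I_M.+1) => p ^+ k)) prodr_const card_ord.
  rewrite lerXn2r ?nnegrE//.
  - by apply: sumr_ge0 => i _; rewrite exprn_ge0 ?ltW.
  - by rewrite invr_ge0 subr_ge0 ltW.
  rewrite -[leRHS]mul1r ler_pdivlMr ?subr_gt0// -opprB mulrN mulrC -subrX1.
  by rewrite opprB gerBl exprn_ge0// ltW.
have ET x : \sum_i F (c x i) - N%:R / #|{: D}|%:R * \sum_y F y =
    \sum_(k | P k) \sum_i Delta k F (c x i).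
  under eq_bigr do rewrite -(sum_Delta F).
  rewrite exchange_big /= (bigID P) /= -[RHS]addr0 -addrA; congr (_ + _).
  apply/eqP; rewrite subr_eq0; apply/eqP.
  under eq_bigr.
    move=> k; rewrite -leqNgt => kr.
    rewrite (sum_Delta_equidistributed b_gt0 F (cE x) kr rm).
    over.
  rewrite -mulr_suml -NE (bigD1 [ffun=> ord0])/=; last first.
    by rewrite /P -leqNgt big1// => l _; rewrite ffunE.
  rewrite big1 ?addr0.
    by rewrite (_ : [forall _, _] = true) ?mul1r//; apply/forallP => l; rewrite ffunE.
  move=> k /andP[_]; case: forallP => // h /eqP[].
  by apply/ffunP => l; rewrite ffunE; apply/eqP.
under eq_bigr do rewrite ET.
apply: (@le_trans _ _ ((#|T|%:R)^-1 * \sum_x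
    ((1 - p)^-1 ^+ d * \sum_(k | P k) (\sum_i Delta k F (c x i)) ^+ 2 / w k))).
  rewrite ler_wpM2l ?invr_ge0//; apply: ler_sum => x _.
  apply: le_trans (sqr_sum_le_weighted _ _ w0) _.
  rewrite ler_wpM2r//.
    by apply: sumr_ge0 => k _; rewrite divr_ge0 ?sqr_ge0 ?ltW.
  apply: le_trans sw; rewrite [leRHS](bigID P) /= lerDl.
  by apply: sumr_ge0 => k _; rewrite ltW.
rewrite -mulr_sumr exchange_big /= mulrCA.
under eq_bigr do rewrite -mulr_suml.
(* Of the decay (p^2 s)^|k|, one factor p^|k| pays for the division by [w k], the other is summed
   over k a second time, and s^|k| <= s^r because |k| > r and s <= 1. *)
have -> : N%:R * (b ^ (m - r + d))%:R * A * ((1 - p)^-1 ^+ d) ^+ 2 * s ^+ r =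
    (1 - p)^-1 ^+ d * (N%:R * (b ^ (m - r + d))%:R * A * s ^+ r * (1 - p)^-1 ^+ d).
  by ring.
have Np0 : 0 <= (1 - p)^-1 by rewrite invr_ge0 subr_ge0 ltW.
rewrite ler_wpM2l ?exprn_ge0//.
apply: le_trans (ler_wpM2l _ sw); last first.
  by rewrite !mulr_ge0 ?exprn_ge0 ?(ltW s0).
rewrite !mulr_sumr [leRHS](bigID P) /= -[leLHS]addr0 lerD//; last first.
  apply: sumr_ge0 => k _.
  by rewrite !mulr_ge0 ?exprn_ge0 ?(ltW s0) ?(ltW p0).
apply: ler_sum => k kr; rewrite mulrA ler_pdivrMr//.
rewrite mulrC ler_pdivrMr ?ltr0n//.
apply: le_trans (sum_sqr_Delta F kr) _.
rewrite -!mulrA ler_wpM2l// ler_wpM2l// [leLHS]mulrC.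
have -> : A * (s ^+ r * (w k * (w k * #|T|%:R))) =
  A * (w k ^+ 2 * s ^+ r) * #|T|%:R by ring.
rewrite ler_wpM2r// (le_trans (FA k))// ler_wpM2l// exprMn exprAC.
by rewrite ler_wpM2l ?sqr_ge0// ler_wiXn2l ?(ltW s0)// ltnW.
Qed.

End scrambled_variance.

(** * Nested scrambling at finite resolution *)

Section finite_scrambling.
Variables (R : realFieldType) (b M d : nat).
Hypothesis b_gt0 : (0 < b)%N.
Local Notation X := {ffun 'I_M -> 'I_b}.
Local Notation D := {ffun 'I_d -> X}.
Local Notation node := ('I_d * {bseq M of 'I_b})%type.
Local Notation T := {ffun node -> {perm 'I_b}}.

(** Sequences of bounded length make the set of nodes finite, so that the permutations form a finite
    type [T] over which one can sum. *)
Definition digit_prefix (k : nat) (y : X) : {bseq M of 'I_b} :=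
  insub_bseq M [seq y i | i <- take k (enum 'I_M)].

Lemma val_digit_prefix k y :
  digit_prefix k y = [seq y i | i <- take k (enum 'I_M)] :> seq 'I_b.
Proof.
rewrite /digit_prefix /insub_bseq val_insubd size_map size_take size_enum_ord.
by case: ltnP => h; rewrite ?leqnn// ltnW.
Qed.

(** A node remembers its level and the digits leading to it; this is how two permutations are
    recognised as different coordinates of [T]. *)
Lemma digit_prefix_eq k k' y y' : (k <= M)%N -> (k' <= M)%N ->
  digit_prefix k y = digit_prefix k' y' -> k = k' /\ agree k y y'.
Proof.
move=> kM k'M /(congr1 val) /=; rewrite !val_digit_prefix => e.
have kk' : k = k'.
  have := congr1 size e; rewrite !size_map !size_takel ?size_enum_ord//.
split => //; subst k'; apply/agreeP => i ik.
have := congr1 (fun s => nth (y i) s i) e.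
rewrite !(nth_map i) ?size_takel ?size_enum_ord// nth_take//.
by rewrite nth_ord_enum.
Qed.

Lemma agree_digit_prefix k y y' : agree k y y' -> digit_prefix k y = digit_prefix k y'.
Proof.
move=> /agreeP h; apply: val_inj; rewrite /= !val_digit_prefix.
apply/eq_in_map => i ii; apply: h.
have : val i \in take k (iota 0 M).
  by rewrite -val_enum_ord -map_take; apply: map_f.
by rewrite take_iota mem_iota add0n => /andP[_] /leq_trans; apply; exact: geq_minl.
Qed.

Definition finite_scramble (x : T) (y : D) : D :=
  [ffun l => [ffun k : 'I_M => x (l, digit_prefix k (y l)) (y l k)]].

(** Scrambling is an isometry of the digit tree: as long as the digits agree, the same permutation
    acts on the next one. *)
Lemma agree_finite_scramble (x : T) l k (y y' : D) : (k <= M)%N ->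
  agree k (finite_scramble x y l) (finite_scramble x y' l) = agree k (y l) (y' l).
Proof.
elim: k => [|k IHk] kM; first by rewrite !agree0.
rewrite -[k]/(nat_of_ord (Ordinal kM)) !agreeS /= IHk 1?ltnW// !ffunE.
have [/agree_digit_prefix -> /=|//] := boolP (agree k _ _).
by rewrite (inj_eq perm_inj).
Qed.

Lemma finite_scramble_inj (x : T) : injective (finite_scramble x).
Proof.
move=> y y' e; apply/ffunP => l; apply/eqP.
by rewrite -agreeM -(agree_finite_scramble x)// e agree_refl.
Qed.

(** A scrambled point lies in the box of y exactly when its source lies in the box of the same shape
    around the preimage of y. *)
Lemma equidistributed_scramble m r N (a : 'I_N -> D) (x : T) :
  equidistributed m r a -> equidistributed m r (fun i => finite_scramble x (a i)).
Proof.
move=> aE k y kM kr; rewrite -(aE k (invF (@finite_scramble_inj x) y) kM kr).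
apply: eq_card => i; rewrite !inE.
rewrite -{1}[y](f_invF (@finite_scramble_inj x)).
by apply: eq_forallb => l; rewrite agree_finite_scramble.
Qed.

(* Precomposing one permutation with a transposition preserves the uniform law
   on [T]. *)
Lemma sum_resample (nd : node) (d0 : 'I_b) (Xi : T -> 'I_b -> R) :
  (forall x x' : T, (forall n, n != nd -> x n = x' n) -> Xi x =1 Xi x') ->
  (forall x, \sum_s Xi x s = 0) ->
  \sum_x Xi x (x nd d0) = 0.
Proof.
move=> XiE Xi0.
have swapE s : \sum_x Xi x (x nd d0) = \sum_x Xi x (x nd s).
  pose h (x : T) : T := [ffun n => if n == nd then (tperm d0 s * x n)%g else x n].
  have hK : involutive h.
    move=> x; apply/ffunP => n; rewrite !ffunE; case: eqP => // _.
    by rewrite mulgA tperm2 mul1g.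
  rewrite (reindex_inj (inv_inj hK)) /=; apply: eq_bigr => x _.
  rewrite /h ffunE eqxx permM tpermL; apply: XiE => n /negbTE nnd.
  by rewrite ffunE nnd.
apply: (@mulfI _ b%:R); first by rewrite pnatr_eq0 -lt0n.
rewrite mulr0 mulr_natl.
transitivity (\sum_(s < b) \sum_x Xi x (x nd d0)).
  by rewrite sumr_const card_ord.
under eq_bigr => s _ do rewrite (swapE s).
rewrite exchange_big /=; apply: big1 => x _; rewrite -[RHS](Xi0 x).
by rewrite [RHS](reindex_inj (@perm_inj _ (x nd))).
Qed.

(** Permutations are indexed by unscrambled prefixes. Hence the one at [nd] determines the digit p
    of the image of y' and no other digit of it, and it does not act on y, whose prefix differs.
    With all the others fixed, this digit is uniform and the mean of h over it vanishes. *)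
Lemma finite_scramble_orthogonal (l : 'I_d) (p : 'I_M) (y y' : D) (g h : D -> R) :
  ~~ agree p (y l) (y' l) ->
  (forall z, \sum_s h (set_digit_at l p s z) = 0) ->
  \sum_x g (finite_scramble x y) * h (finite_scramble x y') = 0.
Proof.
move=> yy' h0; pose nd := (l, digit_prefix p (y' l)).
pose Xi x s :=
  g (finite_scramble x y) * h (set_digit_at l p s (finite_scramble x y')).
transitivity (\sum_x Xi x (x nd (y' l p))).
  apply: eq_bigr => x _; congr (_ * h _); apply/ffunP => l'; apply/ffunP => k.
  by rewrite !ffunE; case: eqP => [->|_]; rewrite !ffunE//; case: eqP => [->|].
apply: sum_resample => [x x' xx' s|x]; last by rewrite -mulr_sumr h0 mulr0.
rewrite /Xi; congr (g _ * h _); apply/ffunP => l'; apply/ffunP => k.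
  rewrite !ffunE xx'//; apply: contra yy' => /eqP[-> e].
  have [//||kp] := digit_prefix_eq _ _ e; rewrite 1?ltnW//.
  by rewrite kp.
rewrite !ffunE; case: eqP => [->|l'l]; rewrite !ffunE.
  case: eqP => // kp; rewrite xx'//; apply/eqP => -[e].
  have [//||k_p _] := digit_prefix_eq _ _ e; rewrite 1?ltnW//.
  exact/kp/val_inj.
by rewrite xx'//; apply/eqP => -[e]; case: l'l.
Qed.

Lemma finite_scramble_uniform (y : D) (h : D -> R) :
  \sum_x h (finite_scramble x y) = #|{: T}|%:R / #|{: D}|%:R * \sum_z h z.
Proof.
pose n z := #|[pred x | finite_scramble x y == z]|.
have nE z z' : n z = n z'.
  (* Composing every permutation of level k in coordinate l with the transposition of z l k and z' l
     k is an involution exchanging the fibres over z and z', so all fibres have the same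
     cardinality. *)
  pose sw (x : T) : T := [ffun nd : node =>
    if insub (size nd.2) is Some k
    then (x nd * tperm (z nd.1 k) (z' nd.1 k))%g else x nd].
  have swK : involutive sw.
    move=> x; apply/ffunP => nd; rewrite !ffunE; case: insubP => // k _ _.
    by rewrite -mulgA tperm2 mulg1.
  rewrite /n -(fintype.card_image (inv_inj swK)); apply: eq_card => x.
  rewrite -[x]swK fintype.mem_image ?inE; last exact: inv_inj.
  set x0 := sw x.
  have swE l k : finite_scramble (sw x0) y l k =
      tperm (z l k) (z' l k) (finite_scramble x0 y l k).
    rewrite !ffunE /= val_digit_prefix size_map size_takel ?size_enum_ord 1?ltnW//.
    by rewrite valK permM.
  apply/eqP/eqP => e; apply/ffunP => l; apply/ffunP => k.
    by rewrite swE e tpermL.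
  apply: (@perm_inj _ (tperm (z l k) (z' l k))).
  by rewrite -swE e tpermL.
have sumn z0 : (#|{: T}| = #|{: D}| * n z0)%N.
  rewrite -sum1_card (partition_big (finite_scramble^~ y) predT) //=.
  under eq_bigr => z _ do rewrite sum1_card -/(n z) (nE z z0).
  by rewrite sum_nat_const.
rewrite (partition_big (finite_scramble^~ y) predT) //= mulr_sumr.
apply: eq_bigr => z _.
under eq_bigr => x /eqP -> do [].
rewrite sumr_const -/(n z) (sumn z) natrM -[LHS]mulr_natl; congr (_ * _).
rewrite mulrAC divff ?mul1r// pnatr_eq0 -lt0n.
by apply/card_gt0P; exists z.
Qed.

End finite_scrambling.

(** * Base-b digits and the equidistribution of nets *)

Section digits.
Variables (R : realType) (b : nat).
Hypothesis b_gt1 : (1 < b)%N.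
Let b_gt0 := ltnW b_gt1.

Lemma natrX_gt0 k : 0 < b%:R ^+ k :> R.
Proof. by rewrite exprn_gt0// ltr0n b_gt0. Qed.

Lemma truncn_digit (x : R) k : 0 <= x ->
  Num.truncn (x * b%:R ^+ k.+1) =
  (b * Num.truncn (x * b%:R ^+ k) + digit b_gt1 x k)%N.
Proof.
move=> x0; rewrite /digit /=.
set u := Num.truncn (x * b%:R ^+ k); set v := Num.truncn (x * b%:R ^+ k.+1).
suff -> : u = (v %/ b)%N by rewrite mulnC -divn_eq.
have xk0 n : 0 <= x * b%:R ^+ n by rewrite mulr_ge0// ltW// natrX_gt0.
have /andP[v1 v2] := truncn_itv (xk0 k.+1).
apply/eqP; rewrite -/u /u; apply/eqP/truncn_def/andP; split.
  rewrite -(ler_pM2r (_ : 0 < b%:R)) ?ltr0n// -mulrA -exprSr -natrM.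
  by rewrite (le_trans _ v1)// ler_nat leq_divM.
rewrite -(ltr_pM2r (_ : 0 < b%:R)) ?ltr0n// -mulrA -exprSr -natrM.
by rewrite (lt_le_trans v2)// ler_nat -ltn_divLR.
Qed.

Variable d : nat.

Definition digits M (x : 'cV[R]_d) : {ffun 'I_d -> {ffun 'I_M -> 'I_b}} :=
  [ffun l => [ffun k : 'I_M => digit b_gt1 (x l 0) k]].

Fixpoint digits_val (s : nat -> nat) k : nat :=
  if k is k'.+1 then (b * digits_val s k' + s k')%N else 0%N.

Lemma eq_digits_val s s' k : (forall i, (i < k)%N -> s i = s' i) ->
  digits_val s k = digits_val s' k.
Proof.
elim: k => // k IHk h /=; rewrite IHk ?h// => i ik; exact/h/ltnW.
Qed.

Lemma digits_val_lt (s : nat -> 'I_b) k : (digits_val s k < b ^ k)%N.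
Proof.
elim: k => [|k IHk] //=; rewrite expnS.
have := ltn_ord (s k); nia.
Qed.

Lemma truncn_digits_val (x : R) (s : nat -> 'I_b) k : 0 <= x < 1 ->
  (Num.truncn (x * b%:R ^+ k) == digits_val s k) =
  [forall i : 'I_k, digit b_gt1 x i == s i].
Proof.
move=> /andP[x0 x1]; elim: k => [|k IHk].
  by rewrite expr0 mulr1 /= truncn_eq// x0 x1; apply/esym/forallP; case.
rewrite truncn_digit// -[digits_val s k.+1]/(b * digits_val s k + s k)%N.
transitivity ((Num.truncn (x * b%:R ^+ k) == digits_val s k) &&
   (digit b_gt1 x k == s k)).
  apply/eqP/andP => [e|[/eqP -> /eqP -> //]].
  have e1 : digit b_gt1 x k = s k.
    have := congr1 (modn^~ b) e; rewrite ![(b * _)%N]mulnC !modnMDl !modn_small//.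
    exact: val_inj.
  by move/eqP: e; rewrite e1 eqn_add2r eqn_pmul2l// => ->.
rewrite IHk; apply/andP/forallP => [[/forallP h1 h2] i|h].
  have := ltn_ord i; rewrite ltnS leq_eqVlt => /predU1P[->//|ik].
  exact: (h1 (Ordinal ik)).
split; last exact: (h ord_max).
by apply/forallP => i; exact: (h (widen_ord (leqnSn k) i)).
Qed.

Definition digit_at M (y : {ffun 'I_M -> 'I_b}) (n : nat) : 'I_b :=
  oapp y (Ordinal b_gt0) (insub n).

(** A net prescribes the count only for boxes of volume b^(t-m), that is of depth m - t. A coarser
    box is cut along one coordinate into b boxes one digit deeper, by induction on the missing depth
    n. *)
Lemma net_equidistributed M t m (a : 'I_(b ^ m) -> 'cV[R]_d) :
  is_net b t m a -> (m <= M)%N ->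
  equidistributed m (m - t) (fun i => digits M (a i)).
Proof.
move=> [tm a01 net] mM.
have agreeE k (y : {ffun 'I_d -> {ffun 'I_M -> 'I_b}}) i :
    (forall l, (k l <= M)%N) ->
    agree_all k (digits M (a i)) y =
    in_elementary b k (fun l => digits_val (fun n => digit_at (y l) n) (k l)) (a i).
  move=> kM; rewrite /agree_all /in_elementary; apply: eq_forallb => l.
  set s := digit_at (y l).
  have /andP[x0 x1] := a01 i l.
  have xk0 : 0 <= a i l 0 * b%:R ^+ k l by rewrite mulr_ge0// ltW// natrX_gt0.
  rewrite ler_pdivrMr ?natrX_gt0// ltr_pdivlMr ?natrX_gt0//.
  have -> : (digits_val s (k l))%:R <= a i l 0 * b%:R ^+ k l < (digits_val s (k l)).+1%:R
     = (Num.truncn (a i l 0 * b%:R ^+ k l) == digits_val s (k l)).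
    by rewrite truncn_eq.
  rewrite truncn_digits_val ?x0//.
  apply/agreeP/forallP => [h j|h j jk].
    have jM : (j < M)%N := leq_trans (ltn_ord j) (kM l).
    have := h (Ordinal jM) (ltn_ord j); rewrite !ffunE /= => ->.
    by rewrite /s /digit_at insubT.
  rewrite !ffunE; apply/eqP; have /eqP := h (Ordinal jk); rewrite /= => ->; rewrite /s.
  by rewrite /digit_at valK.
have base k (y : {ffun 'I_d -> {ffun 'I_M -> 'I_b}}) : (forall l, (k l <= M)%N) ->
    (\sum_l k l = m - t)%N ->
    #|[pred i | agree_all k (digits M (a i)) y]| = (b ^ t)%N.
  move=> kM kmt; rewrite -(net k (fun l => digits_val (fun n => digit_at (y l) n) (k l))).
  - by apply: eq_card => i; rewrite !inE agreeE.
  - move=> l; exact: digits_val_lt.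
  - rewrite prodfV -expr_sum kmt.
    by rewrite -[in RHS](subnKC tm) exprD; field; rewrite !gt_eqF ?natrX_gt0.
move=> k y kM kr.
have [n nE] : exists n, (m - t = \sum_l k l + n)%N by exists (m - t - \sum_l k l)%N; lia.
elim: n k y kM kr nE => [|n IHn] k y kM kr nE.
  rewrite addn0 in nE; rewrite base//; congr (_ ^ _)%N; lia.
(* In dimension 0 there is no coordinate to cut, but the only box contains all the points. *)
have [d0|d0] := posnP d.
  rewrite big1 ?subn0; last by move=> [l ?]; exfalso; lia.
  rewrite -[RHS]card_ord; apply: eq_card => i; rewrite inE.
  by apply/forallP => -[l ?]; exfalso; lia.
pose l0 := Ordinal d0.
have kl0 : (k l0 < M)%N.
  by apply: leq_trans mM; move: nE; rewrite (bigD1 l0)//=; lia.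
pose j0 := Ordinal kl0.
pose k' l := if l == l0 then (k l0).+1 else k l.
have k'E : (\sum_l k' l = (\sum_l k l).+1)%N.
  rewrite (bigD1 l0)//= {1}/k' eqxx [in RHS](bigD1 l0)//= addSn; congr (_ + _).+1.
  by apply: eq_bigr => i /negbTE il; rewrite /k' il.
rewrite -sum1_card (partition_big (fun i => digits M (a i) l0 j0) predT) //=.
have IH s : (\sum_(i < b ^ m | (i \in [pred i | agree_all k (digits M (a i)) y]) &&
      (digits M (a i) l0 j0 == s)) 1 = b ^ (m - (\sum_l k l).+1))%N.
  rewrite -k'E -(IHn k' (set_digit_at l0 j0 s y)).
  - rewrite sum1_card; apply: eq_card => i; rewrite !inE unfold_in.
    have E : agree (k l0).+1 (digits M (a i) l0) (set_digit_at l0 j0 s y l0) =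
        agree (k l0) (digits M (a i) l0) (y l0) && (digits M (a i) l0 j0 == s).
      rewrite [set_digit_at _ _ _ _ _]ffunE eqxx.
      rewrite -[k l0]/(nat_of_ord j0) agreeS agree_sym agree_set_digit//.
      by rewrite agree_sym [set_digit _ _ _ _]ffunE eqxx.
    apply/andP/forallP => [[/forallP h1 h2] l|h].
      rewrite /k'; case: eqP => [->|/eqP/negbTE ll]; first by rewrite E h1.
      by rewrite [set_digit_at _ _ _ _ _]ffunE ll.
    have := h l0; rewrite /k' eqxx E => /andP[h0 ->]; split => //.
    apply/forallP => l; have [->//|/negbTE ll] := eqVneq l l0.
    by have := h l; rewrite /k' ll [set_digit_at _ _ _ _ _]ffunE ll.
  - by move=> l; rewrite /k'; case: eqP => // _.
  - lia.
  - lia.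
under eq_bigr do rewrite IH.
rewrite sum_nat_const card_ord -expnS; congr (_ ^ _)%N.
by rewrite subnSK//; apply: leq_trans (leq_subr t m); rewrite nE addnS ltnS leq_addr.
Qed.

End digits.

(** * The normal distribution function *)

Section normal_cdf.
Variable R : realType.
Implicit Types x y u : R.
Local Notation phi := (normal_pdf (0 : R) 1).
Local Notation Phi := (@Phi R).
Local Notation Phi_inv := (@Phi_inv R).
Local Notation mu := (@lebesgue_measure R).

Lemma normal_pdf01E x : phi x = (Num.sqrt (2 * pi))^-1 * expR (- (2^-1 * x ^+ 2)).
Proof.
rewrite normal_pdfE ?oner_eq0// /normal_peak /normal_fun.
rewrite expr1n mul1r mulr_natl subr0; congr (_ * expR _).
by rewrite mulNr mulrC.
Qed.

Lemma normal_pdf01_gt0 x : 0 < phi x.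
Proof.
rewrite normal_pdf01E mulr_gt0 ?expR_gt0// invr_gt0 sqrtr_gt0.
by rewrite mulr_gt0// pi_gt0.
Qed.

Lemma is_derive_Phi x : is_derive x 1 Phi (phi x).
Proof.
have xx1 : x < x + 1 by rewrite ltrDl.
have [] := @continuous_FTC1 R phi -oo%O x (x + 1) xx1.
- apply: integrableS (integrable_normal_pdf 0 1) => //.
- by rewrite /= ltNyr.
- by apply: continuous_normal_pdf; exact: oner_neq0.
- move=> d1 d2; apply: DeriveDef => //.
  by rewrite -d2 derive1E.
Qed.

Lemma Phi_continuous : continuous Phi.
Proof.
move=> x; apply: differentiable_continuous; apply/derivable1_diffP.
by have [] := is_derive_Phi x.
Qed.

Lemma Phi_lt : {homo Phi : x y / x < y}.
Proof.
move=> x y xy.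
have [|c _ e] := MVT xy (fun z _ => is_derive_Phi z).
  by apply: continuous_subspaceT; exact: Phi_continuous.
by rewrite -subr_gt0 e mulr_gt0 ?subr_gt0// normal_pdf01_gt0.
Qed.

Lemma Phi_ltE : {mono Phi : x y / x < y}.
Proof. exact/leW_mono/le_mono/Phi_lt. Qed.

Lemma Phi_leE : {mono Phi : x y / x <= y}.
Proof. exact/le_mono/Phi_lt. Qed.

Lemma Phi_itv x : 0 < Phi x < 1.
Proof.
have Pfin z : normal_prob (0 : R) 1 `]-oo, z] \is a fin_num.
  by rewrite fin_num_measure.
apply/andP; split.
  apply: le_lt_trans (Phi_lt (_ : x - 1 < x)); last by rewrite ltrBlDr ltrDl.
  by rewrite fine_ge0// measure_ge0.
apply: lt_le_trans (Phi_lt (_ : x < x + 1)) _; first by rewrite ltrDl.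
by rewrite -lee_fin fineK// probability_le1.
Qed.

Lemma Phi_gt0 x : 0 < Phi x. Proof. by have /andP[] := Phi_itv x. Qed.
Lemma Phi_lt1 x : Phi x < 1. Proof. by have /andP[] := Phi_itv x. Qed.

Let idR : measurableTypeR R -> R := idfun.
#[local] HB.instance Definition _ :=
  @isMeasurableFun.Build _ _ _ _ idR (@measurable_id _ _ setT).

Let cdf_Phi x : cdf (idR : {RV (normal_prob (0 : R) 1) >-> R}) x = (Phi x)%:E.
Proof.
rewrite /cdf /distribution /pushforward /Phi fineK ?fin_num_measure//.
Qed.

Lemma cvg_Phi_y : Phi x @[x --> +oo] --> (1 : R).
Proof.
have := cvg_cdfy1 (idR : {RV (normal_prob (0 : R) 1) >-> R}).
rewrite (_ : cdf _ = EFin \o Phi); last by apply/funext => x; rewrite cdf_Phi.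
by move/fine_cvgP => [].
Qed.

Lemma cvg_Phi_Ny : Phi x @[x --> -oo] --> (0 : R).
Proof.
have := cvg_cdfNy0 (idR : {RV (normal_prob (0 : R) 1) >-> R}).
rewrite (_ : cdf _ = EFin \o Phi); last by apply/funext => x; rewrite cdf_Phi.
by move/fine_cvgP => [].
Qed.

Lemma normal_pdf01N x : phi (- x) = phi x.
Proof. by rewrite !normal_pdf01E sqrrN. Qed.

(** The derivative of Phi y + Phi (- y) vanishes, and its limit at +oo is 1. *)
Lemma PhiN x : Phi (- x) = 1 - Phi x.
Proof.
pose g y := Phi y + Phi (- y).
have dg y : is_derive y 1 g 0.
  have d1 := is_derive_Phi y; have d2 := is_derive_Phi (- y).
  have d3 : is_derive y 1 (Phi \o -%R) (- phi y).
    by apply: is_derive_eq; rewrite normal_pdf01N mulrN1.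
  have := is_deriveD d1 d3; rewrite subrr; exact.
have gc y z : g y = g z by apply: is_derive_0_is_cst.
have g1 : g y @[y --> +oo] --> (1 + 0 : R).
  apply: cvgD; first exact: cvg_Phi_y.
  exact: ((cvgNy_compNP Phi _).1 cvg_Phi_Ny).
have : g y @[y --> +oo] --> g x.
  rewrite (_ : g = cst (g x)); first exact: cvg_cst.
  by apply/funext => y; exact: gc.
move/(cvg_unique _ g1) => /(_ (@Rhausdorff R)).
by rewrite /g addr0 => ->; rewrite addrC addKr.
Qed.

Definition tail x : R := 1 - Phi `|x|.

Lemma tailE x : tail x = Num.min (Phi x) (1 - Phi x).
Proof.
rewrite /tail; have [x0|x0] := leP 0 x.
  have := PhiN x; have : Phi (- x) <= Phi x by rewrite Phi_leE; lra.
  by rewrite ger0_norm// => h e; rewrite min_r// -e.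
have : Phi x <= Phi (- x) by rewrite Phi_leE; lra.
by rewrite ltr0_norm// PhiN => h; rewrite subKr min_l.
Qed.

Lemma tail_gt0 x : 0 < tail x.
Proof. by rewrite /tail subr_gt0 Phi_lt1. Qed.

Lemma tail_lt1 x : tail x < 1.
Proof. by rewrite /tail gtrBl Phi_gt0. Qed.

Lemma Phi_surj u : 0 < u < 1 -> exists x, Phi x = u.
Proof.
move=> /andP[u0 u1].
have [a au] : exists a, Phi a < u.
  have : \forall x \near -oo, Phi x < u by exact: (cvgr_lt 0 cvg_Phi_Ny).
  by move/filter_ex => [a]; exists a.
have [c uc] : exists c, u < Phi c.
  have : \forall x \near +oo, u < Phi x by exact: (cvgr_gt 1 cvg_Phi_y).
  by move/filter_ex => [c]; exists c.
have ac : a <= c by rewrite -Phi_leE ltW// (lt_trans au).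
have [||x _ <-] := @IVT R Phi a c u ac; last by exists x.
  by apply: continuous_subspaceT; exact: Phi_continuous.
by rewrite min_l ?max_r ?Phi_leE// !ltW.
Qed.

Lemma PhiK : cancel Phi Phi_inv.
Proof.
move=> x; rewrite /Phi_inv; case: xgetP => [y _ /= yx|/(_ x)/=]; last by [].
by apply: (inc_inj Phi_leE).
Qed.

Lemma Phi_invK u : 0 < u < 1 -> Phi (Phi_inv u) = u.
Proof. by move=> /Phi_surj[x <-]; rewrite PhiK. Qed.

Lemma Phi_inv_out u : ~~ (0 < u < 1) -> Phi_inv u = 0.
Proof.
move=> u01; rewrite /Phi_inv; case: xgetP => // y _ /= yu.
by move: u01; rewrite -yu Phi_itv.
Qed.

Lemma Phi_inv_continuous u : 0 < u < 1 -> {for u, continuous Phi_inv}.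
Proof.
move=> u01; apply/cvgrPdist_lt => e e0.
have [h1 h2] : Phi (Phi_inv u - e) < u /\ u < Phi (Phi_inv u + e).
  by rewrite -{2 3}(Phi_invK u01) !Phi_ltE ltrDl gtrBl.
near=> v.
have v1 : Phi (Phi_inv u - e) < v by near: v; exact: lt_nbhsr.
have v2 : v < Phi (Phi_inv u + e) by near: v; exact: lt_nbhsl.
have v01 : 0 < v < 1.
  by rewrite (lt_trans _ v1) ?Phi_gt0// (lt_trans v2)// Phi_lt1.
move: v1 v2; rewrite -{1 2}(Phi_invK v01) !Phi_ltE ltr_distlC; lra.
Unshelve. all: by end_near. Qed.

(** A Mills ratio bound. On [0, 1] the density is at least phi 1. For x > 1, phi + Phi is
    nonincreasing on [x, +oo[ since its derivative is (1 - y) phi y, and it dominates Phi, which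
    tends to 1. *)
Lemma tail_le : exists2 C, 0 < C & forall x, tail x <= C * phi x.
Proof.
have p1 := normal_pdf01_gt0 1.
exists (1 + (phi 1)^-1); first by rewrite addr_gt0// invr_gt0.
have pos x : 0 <= x -> 1 - Phi x <= (1 + (phi 1)^-1) * phi x.
  move=> x0; have px := normal_pdf01_gt0 x.
  have [x1|x1] := leP x 1.
    have le1 : phi 1 <= phi x.
      rewrite !normal_pdf01E ler_wpM2l ?invr_ge0 ?sqrtr_ge0// ler_expR.
      by rewrite lerN2 ler_wpM2l// ler_sqr// nnegrE.
    have : 1 <= (phi 1)^-1 * phi x by rewrite ler_pdivlMl// mulr1.
    by have := Phi_gt0 x; rewrite mulrDl mul1r; lra.
  suff : 1 - Phi x <= phi x.
    move/le_trans; apply; rewrite mulrDl mul1r lerDl.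
    by rewrite mulr_ge0// ?invr_ge0 ltW.
  pose h y := phi y + Phi y.
  have dh y : is_derive y 1 h ((1 - y) * phi y).
    have d1 := is_derive_Phi y.
    have d2 : is_derive y 1 phi (- y * phi y).
      rewrite (_ : normal_pdf 0 1 =
        fun z => (Num.sqrt (2 * pi))^-1 * expR (- (2^-1 * z ^+ 2))); last first.
        by apply/funext => z; rewrite normal_pdf01E.
      apply: is_derive_eq; rewrite /GRing.scale /=; field.
      by rewrite sqrtr_eq0 -ltNge mulr_gt0 ?pi_gt0.
    have := is_deriveD d2 d1; congr (is_derive _ _ _ _).
    by ring.
  have hnincr y : x <= y -> h y <= h x.
    rewrite le_eqVlt => /predU1P[->//|xy].
    have [|c] := MVT xy (fun z _ => dh z).
      apply: continuous_subspaceT => z; apply: differentiable_continuous.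
      by apply/derivable1_diffP; have [] := dh z.
    rewrite in_itv/= => /andP[xc cy] e.
    rewrite -subr_le0 e -mulrA mulr_le0_ge0//; first by lra.
    by rewrite mulr_ge0 ?subr_ge0 ?(ltW xy)// ltW// normal_pdf01_gt0.
  suff : 1 <= h x by rewrite /h; lra.
  have : \forall y \near +oo, Phi y <= h x.
    near=> y; apply: (le_trans _ (hnincr y _)).
      by rewrite /h lerDr ltW// normal_pdf01_gt0.
    by near: y; apply: nbhs_pinfty_ge; exact: num_real.
  exact: cvgr_to_le cvg_Phi_y.
move=> x; apply: le_trans (pos _ (normr_ge0 x)) _.
by have [x0|x0] := leP 0 x; [rewrite ger0_norm|rewrite ltr0_norm// normal_pdf01N].
Unshelve. all: by end_near. Qed.

End normal_cdf.

(** * Integrals of powers of the tail; uniformity of Phi under the normal law *)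

Section tail_integrals.
Variable R : realType.
Implicit Types x y u : R.
Local Notation phi := (normal_pdf (0 : R) 1).
Local Notation Phi := (@Phi R).
Local Notation Phi_inv := (@Phi_inv R).
Local Notation mu := (@lebesgue_measure R).

Lemma tail_continuous : continuous (@tail R).
Proof.
move=> x; apply: cvgB; first exact: cvg_cst.
apply: (@continuous_comp _ _ _ (fun y : R => `|y|) Phi).
  exact: norm_continuous.
exact: Phi_continuous.
Qed.

(** The integrand is even, and on [0, +oo[ it is the derivative of - (1 - Phi)^(1-g) / (1 - g),
    which tends to 0 because g < 1. *)
Lemma integral_tail_powR (g : R) : 0 < g < 1 ->
  (\int[mu]_x (tail x `^ (- g) * phi x)%:E < +oo)%E.
Proof.
move=> /andP[g0 g1].
have cf : continuous (fun x => tail x `^ (- g) * phi x).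
  move=> x; apply: cvgM; last by apply: continuous_normal_pdf; exact: oner_neq0.
  have : {for x, continuous ((fun y : R => y `^ (- g)) \o @tail R)}; last exact.
  apply: continuous_comp; first exact: tail_continuous.
  apply: differentiable_continuous; apply/derivable1_diffP.
  by have [] := is_derive1_powR (- g) (tail_gt0 x).
rewrite ge0_symfun_integralT//; first last.
- by move=> x /=; rewrite /tail normrN normal_pdf01N.
- by move=> x; rewrite mulr_ge0 ?powR_ge0// normal_pdf_ge0.
rewrite -set_itvcy.
pose F x := - ((1 - g)^-1 * (1 - Phi x) `^ (1 - g)).
have q0 x : 0 < 1 - Phi x by rewrite subr_gt0 Phi_lt1.
have dF x : is_derive x 1 F ((1 - Phi x) `^ (- g) * phi x).
  have d1 := is_derive_Phi x.
  have d2 : is_derive x 1 (fun y => 1 - Phi y) (- phi x).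
    by have := is_deriveB (is_derive_cst (1 : R) x 1) d1; rewrite sub0r.
  have d3 := is_derive1_powR (1 - g) (q0 x).
  have d4 := @is_derive1_comp R (fun y => y `^ (1 - g)) (fun y => 1 - Phi y) _ _ _ d3 d2.
  have := is_deriveN (is_deriveZ (1 - g)^-1 d4); rewrite /GRing.scale /=.
  congr (is_derive _ _ _ _).
  have -> : 1 - g - 1 = - g by lra.
  by field; lra.
rewrite (@ge0_continuous_FTC2y R _ F 0 0) => [||||x x0||].
- by rewrite -EFinB -EFinM ltry.
- by move=> x _; rewrite mulr_ge0 ?powR_ge0// normal_pdf_ge0.
- exact: continuous_subspaceT.
- rewrite -[X in _ --> X]oppr0 -[X in _ --> - X](mulr0 (1 - g)^-1).
  apply: cvgN; apply: cvgM; first exact: cvg_cst.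
  have -> : (fun x => (1 - Phi x) `^ (1 - g)) @ +oo =
    (fun y : R => y `^ (1 - g)) @ ((fun x => 1 - Phi x) @ +oo) by [].
  apply: cvg_trans (powR_cvg0 (_ : 0 < 1 - g)); last by rewrite subr_gt0.
  move=> A /= [e e0 eA].
  have : \forall x \near +oo, 1 - e < Phi x.
    by apply: (cvgr_gt 1 (@cvg_Phi_y R)); rewrite ltrBlDr ltrDl.
  apply: filterS => x xe; apply: eA => //=.
  by rewrite sub0r normrN gtr0_norm//; lra.
- by have [] := dF x.
- apply: cvg_at_right_filter; apply: differentiable_continuous.
  by apply/derivable1_diffP; have [] := dF 0.
- move=> x; rewrite in_itv/= andbT => x0; rewrite derive1E.
  by have [_ ->] := dF x; rewrite /tail gtr0_norm.
Qed.

Lemma normal_prob_Phi_lt q : 0 <= q <= 1 ->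
  normal_prob (0 : R) 1 [set z | Phi z < q] = q%:E.
Proof.
move=> /andP[]; rewrite le_eqVlt => /predU1P[<- _|q0].
  rewrite (_ : mkset _ = set0) ?measure0//.
  by apply/seteqP; split=> // z /=; rewrite ltNge ltW// Phi_gt0.
rewrite le_eqVlt => /predU1P[->|q1].
  rewrite (_ : mkset _ = setT) ?probability_setT//.
  by apply/seteqP; split=> // z /= _; exact: Phi_lt1.
have q01 : 0 < q < 1 by rewrite q0.
rewrite -{1}(Phi_invK q01).
rewrite (_ : mkset _ = `]-oo, Phi_inv q[%classic); last first.
  by apply/seteqP; split=> z /=; rewrite in_itv/= Phi_ltE.
rewrite /normal_prob integral_itv_bndo_bndc; last first.
  by apply/measurable_EFinP/measurable_funTS; exact: measurable_normal_pdf.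
rewrite -[RHS](congr1 EFin (Phi_invK q01)) /Defs.Phi fineK//.
exact: (fin_num_measure (normal_prob (0 : R) 1)).
Qed.

Lemma measurable_Phi_lt q : measurable [set z | Phi z < q].
Proof.
rewrite -[X in measurable X]setTI.
rewrite (_ : mkset _ = Phi @^-1` `]-oo, q[); last first.
  by apply/seteqP; split=> z /=; rewrite in_itv/=.
by apply: (continuous_measurable_fun (@Phi_continuous R)) => //; exact: measurable_itv.
Qed.

Lemma measurable_Phi_itv p q : measurable [set z | p <= Phi z < q].
Proof.
rewrite (_ : mkset _ = [set z | Phi z < q] `\` [set z | Phi z < p]).
  by apply: measurableD; exact: measurable_Phi_lt.
apply/seteqP; split=> z /=.
  by move=> /andP[pz zq]; split => //; apply/negP; rewrite -leNgt.
by move=> [-> /negP]; rewrite -leNgt => ->.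
Qed.

Lemma normal_prob_Phi_itv p q : 0 <= p -> p <= q -> q <= 1 ->
  normal_prob (0 : R) 1 [set z | p <= Phi z < q] = (q - p)%:E.
Proof.
move=> p0 pq q1.
rewrite (_ : mkset _ = [set z | Phi z < q] `\` [set z | Phi z < p]); last first.
  apply/seteqP; split=> z /=.
    by move=> /andP[pz zq]; split => //; apply/negP; rewrite -leNgt.
  by move=> [-> /negP]; rewrite -leNgt => ->.
rewrite measureD /=.
- rewrite (_ : _ `&` _ = [set z | Phi z < p]); last first.
    by apply/seteqP; split=> z /= => [[]//|zp]; split => //; exact: lt_le_trans pq.
  by rewrite !normal_prob_Phi_lt ?p0 ?(le_trans pq)// (le_trans p0).
- exact: measurable_Phi_lt.
- exact: measurable_Phi_lt.
- by rewrite normal_prob_Phi_lt ?ltry// q1 (le_trans p0).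
Qed.

End tail_integrals.

(** Derivability of f is assumed in the direction v only, so the chain rule is applied on the line t
    |-> t v + z. *)
Lemma is_derive_comp1 (R : realType) (V : normedModType R) (f : V -> R)
    (g : R -> R) (z v : V) (dg : R) :
  is_derive (f z) 1 g dg -> derivable f z v ->
  is_derive z v (fun y => g (f y)) (dg * 'D_v f z).
Proof.
move=> dgz dfz.
pose h t : R := f (t *: v + z).
have dh : is_derive (0 : R) 1 h ('D_v f z).
  have [dh0 <-] : derivable h 0 1 /\ 'D_1 h 0 = 'D_v f z.
    split; first exact: (derivable1P f z v).1 dfz.
    rewrite /derive (_ : (fun t : R => _) =
      (fun t => t^-1 *: ((f \o shift z) (t *: v) - f z)))//.
    by apply/funext => t /=; rewrite /h addr0 scale0r add0r [_%:A]mulr1.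
  exact/derivableP.
have h0 : h 0 = f z by rewrite /h scale0r add0r.
rewrite -h0 in dgz.
have [d1 e1] := is_derive1_comp dgz dh.
apply: DeriveDef; first exact: (derivable1P (fun y => g (f y)) z v).2 d1.
rewrite -e1 /derive [in RHS](_ : (fun t : R => _) =
  (fun t => t^-1 *: (((fun y => g (f y)) \o shift z) (t *: v) - g (f z))))//.
by apply/funext => t /=; rewrite /h addr0 scale0r add0r [_%:A]mulr1.
Qed.

Lemma prodr_ege1 (R : numDomainType) (I : Type) (r : seq I) (P : pred I)
    (F : I -> R) :
  (forall i, P i -> 1 <= F i) -> 1 <= \prod_(i <- r | P i) F i.
Proof.
move=> h; elim: r => [|i r IHr]; first by rewrite big_nil.
by rewrite big_cons; case: ifP => // /h Fi; exact: mulr_ege1.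
Qed.

(** * The boundary growth condition *)

Section growth.
Variables (R : realType) (d : nat).
Implicit Types (H F : 'cV[R]_d -> R) (s : seq 'I_d) (B K : R) (z : 'cV[R]_d).

Definition tail_weight B z : R := \prod_(l < d) tail (z l 0) `^ (- B).

Lemma tail_powRN_ge1 B (x : R) : 0 <= B -> 1 <= tail x `^ (- B).
Proof.
move=> B0; rewrite powRN invf_ge1 ?powR_gt0 ?tail_gt0//.
have e : 1 = 1 `^ B :> R by rewrite powR1.
rewrite [leRHS]e.
apply: ge0_ler_powR => //; rewrite ?nnegrE//; first exact/ltW/tail_gt0.
exact/ltW/tail_lt1.
Qed.

Lemma tail_powRN_le B B' (x : R) : B <= B' -> tail x `^ (- B) <= tail x `^ (- B').
Proof.
by move=> BB'; apply: ger_powR; rewrite ?lerN2// tail_gt0 ltW// tail_lt1.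
Qed.

Lemma tail_weight_ge1 B z : 0 <= B -> 1 <= tail_weight B z.
Proof.
move=> B0; by apply: prodr_ege1 => l _; exact: tail_powRN_ge1.
Qed.

Lemma tail_weightM B B' z :
  tail_weight B z * tail_weight B' z = tail_weight (B + B') z.
Proof.
rewrite /tail_weight -big_split /=; apply: eq_bigr => l _.
by rewrite opprD powRD// (gt_eqF (tail_gt0 _)) implybT.
Qed.

Lemma tail_weight_ge_coord B z l : 0 <= B ->
  tail (z l 0) `^ (- B) <= tail_weight B z.
Proof.
move=> B0; rewrite /tail_weight (bigD1 l)//= ler_peMr ?powR_ge0//.
by apply: prodr_ege1 => i _; exact: tail_powRN_ge1.
Qed.

(* Only the derivatives along subsequences of [s], in this order, are controlled:
   one order is enough, and no symmetry of mixed derivatives is needed. *)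
Fixpoint growth s H : Prop :=
  if s is j :: s' then
    [/\ growth s' H, forall z, derivable H z (delta_mx j 0)
      & growth s' (fun z => 'D_(delta_mx j 0) H z)]
  else continuous H /\ forall B, 0 < B -> exists K, forall z,
    `|H z| <= K * tail_weight B z.

Lemma growth_nil s H : growth s H -> growth [::] H.
Proof. by elim: s H => // j s IHs H [gH _ _]; exact: IHs. Qed.

Lemma eq_growth s F H : F =1 H -> growth s F -> growth s H.
Proof. by move=> /funext ->. Qed.

Lemma growthD s F H : growth s F -> growth s H -> growth s (fun z => F z + H z).
Proof.
elim: s F H => /= [|j s IHs] F H.
  move=> [cF bF] [cH bH]; split=> [z|B B0]; first exact: cvgD (cF z) (cH z).
  have [K1 h1] := bF B B0; have [K2 h2] := bH B B0; exists (K1 + K2) => z.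
  by rewrite mulrDl (le_trans (ler_normD _ _))// lerD.
move=> [gF dF gdF] [gH dH gdH]; split; first exact: IHs.
  by move=> z; apply: derivableD.
by apply: eq_growth (IHs _ _ gdF gdH) => z; rewrite deriveD.
Qed.

Lemma growthM s F H : growth s F -> growth s H -> growth s (fun z => F z * H z).
Proof.
elim: s F H => /= [|j s IHs] F H.
  move=> [cF bF] [cH bH]; split=> [z|B B0]; first exact: cvgM (cF z) (cH z).
  (* Exponents of the weights add up in a product, so each factor gets half of B. *)
  have B2 : 0 < B / 2 by rewrite divr_gt0.
  have [K1 h1] := bF _ B2; have [K2 h2] := bH _ B2; exists (K1 * K2) => z.
  have -> : B = B / 2 + B / 2 by lra.
  by rewrite -tail_weightM mulrACA normrM ler_pM.
move=> [gF dF gdF] [gH dH gdH]; split; first exact: IHs.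
  by move=> z; apply: derivableM.
apply: eq_growth (growthD (IHs _ _ gF gdH) (IHs _ _ gH gdF)) => z.
by rewrite deriveM.
Qed.

Lemma growth_cst s (c : R) : growth s (fun=> c).
Proof.
elim: s c => /= [|j s IHs] c; last first.
  split=> [//|z|]; first exact: derivable_cst.
  by apply: eq_growth (IHs 0) => z; rewrite derive_cst.
split=> [|B B0]; first exact: cst_continuous.
by exists `|c| => z; rewrite ler_peMr// tail_weight_ge1// ltW.
Qed.

Lemma growth_big s (I : Type) (r : seq I) (F : I -> 'cV[R]_d -> R) :
  (forall i, growth s (F i)) -> growth s (fun z => \sum_(i <- r) F i z).
Proof.
move=> gF; elim: r => [|i r IHr].
  by apply: eq_growth (growth_cst s 0) => z; rewrite big_nil.
by apply: eq_growth (growthD (gF i) IHr) => z; rewrite big_cons.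
Qed.

Lemma growth_nil_le H F : continuous H -> (forall z, `|H z| <= `|F z|) ->
  growth [::] F -> growth [::] H.
Proof.
move=> cH HF [_ bF]; split=> // B B0.
by have [K h] := bF B B0; exists K => z; apply: le_trans (HF z) (h z).
Qed.

(* [tail x <= C phi x] bounds a Gaussian [exp (B x^2 / 2)] by [tail x ^ -B]. *)
Lemma expR_sqr_le_tail B : 0 <= B -> exists2 K, 0 < K & forall x : R,
  expR (2^-1 * B * x ^+ 2) <= K * tail x `^ (- B).
Proof.
move=> B0; have [C C0 hC] := tail_le R.
pose c := C * (Num.sqrt (2 * pi))^-1.
have c0 : 0 < c by rewrite mulr_gt0// invr_gt0 sqrtr_gt0 mulr_gt0 ?pi_gt0.
exists (c `^ B); first by rewrite powR_gt0.
move=> x; rewrite powRN ler_pdivlMr ?powR_gt0 ?tail_gt0//.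
rewrite -ler_pdivlMl ?expR_gt0// -expRN.
have -> : expR (- (2^-1 * B * x ^+ 2)) * c `^ B = (c * expR (- (2^-1 * x ^+ 2))) `^ B.
  by rewrite [in RHS]powRM ?expR_ge0 ?(ltW c0)// mulrC -expRM; congr (_ * expR _); lra.
apply: ge0_ler_powR; rewrite ?nnegrE ?(ltW (tail_gt0 _))//.
  by rewrite mulr_ge0 ?expR_ge0// ltW.
by apply: le_trans (hC x) _; rewrite normal_pdf01E mulrA.
Qed.

Lemma growth_coord s (l : 'I_d) : growth s (fun z => z l 0).
Proof.
elim: s => /= [|j s IHs]; last first.
  have D z : is_derive z (delta_mx j 0) (fun z => z l 0) ((l == j)%:R).
    have e : (fun h : R => h^-1 *: ((h *: delta_mx j 0 + z) l 0 - z l 0)) @ 0^' -->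
       ((l == j)%:R : R).
      apply: (@cvg_trans _ ((fun=> (l == j)%:R : R) @ 0^')); last exact: cvg_cst.
      apply: near_eq_cvg; near=> h.
      have h0 : h != 0 by near: h; exact: nbhs_dnbhs_neq.
      by rewrite !mxE eqxx andbT addrK /GRing.scale /= mulrA mulVf ?mul1r.
    by apply: DeriveDef; [apply/cvg_ex; exists (l == j)%:R|exact: cvg_lim e].
  split; [exact: IHs|by move=> z; have [] := D z|].
  by apply: eq_growth (growth_cst s (l == j)%:R) => z; have [] := D z.
split; first exact: coord_continuous.
move=> B B0; have [K K0 hK] := expR_sqr_le_tail (ltW B0).
(* From |x| <= 1 + x^2 <= (1 + 2/B) (1 + B x^2 / 2), and the last factor is at most exp (B x^2 /
   2). *)
exists ((1 + 2 / B) * K) => z.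
apply: (@le_trans _ _ ((1 + 2 / B) * expR (2^-1 * B * z l 0 ^+ 2))).
  set x := z l 0.
  apply: (@le_trans _ _ ((1 + 2 / B) * (1 + 2^-1 * B * x ^+ 2))).
    have -> : (1 + 2 / B) * (1 + 2^-1 * B * x ^+ 2) = 1 + x ^+ 2 + 2 / B + 2^-1 * B * x ^+ 2.
      by field; rewrite gt_eqF.
    have : `|x| <= 1 + x ^+ 2.
      rewrite -(real_normK (num_real x)); have := normr_ge0 x; nra.
    have : 0 <= 2 / B by rewrite divr_ge0// ltW.
    have : 0 <= 2^-1 * B * x ^+ 2.
      by apply: mulr_ge0; [rewrite mulr_ge0 ?invr_ge0 ?(ltW B0)|exact: sqr_ge0].
    lra.
  by rewrite ler_wpM2l ?expR_ge1Dx// addr_ge0// divr_ge0// ltW.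
rewrite -[leRHS]mulrA ler_wpM2l ?addr_ge0 ?divr_ge0// ?(ltW B0)//.
apply: le_trans (hK _) _; rewrite ler_wpM2l ?(ltW K0)//.
by apply: tail_weight_ge_coord; exact: ltW.
Unshelve. all: by end_near. Qed.

End growth.

(** * Growth of the importance sampling integrand *)

Section growth_IS.
Variables (R : realType) (d : nat).
Implicit Types (H F q f : 'cV[R]_d -> R) (s : seq 'I_d) (z : 'cV[R]_d).

Lemma continuous_comp_derive f (g dg : R -> R) : continuous f ->
  (forall x : R, is_derive x 1 g (dg x)) -> continuous (fun z => g (f z)).
Proof.
move=> cf g' z.
have : {for z, continuous (g \o f)}; last exact.
apply: continuous_comp; first exact: cf.
by apply: differentiable_continuous; apply/derivable1_diffP; have [] := g' (f z).
Qed.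

(** Differentiation reproduces expR (q z) with the factor D q, so a bound on the exponential itself
    suffices. *)
Lemma growth_expR s q : growth s q -> growth [::] (fun z => expR (q z)) ->
  growth s (fun z => expR (q z)).
Proof.
move=> + g0; elim: s q g0 => // j s IHs q g0 [gq dq gdq].
have D z : is_derive z (delta_mx j 0) (fun z => expR (q z))
    (expR (q z) * 'D_(delta_mx j 0) q z).
  exact: is_derive_comp1 (is_derive_expR _) (dq z).
split; [exact: IHs|by move=> z; have [] := D z|].
apply: eq_growth (growthM (IHs _ g0 gq) gdq) => z.
by have [_ ->] := D z.
Qed.

Lemma growth_expR_affine q (c : R) (r : 'I_d -> R) : continuous q ->
  (forall z, q z <= c + \sum_l r l * z l 0) ->
  growth [::] (fun z => expR (q z)).
Proof.
move=> cq qle; split.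
  by apply: (continuous_comp_derive (dg := expR)) => // x; exact: is_derive_expR.
move=> B B0; have [K K0 hK] := expR_sqr_le_tail (ltW B0).
exists (expR c * \prod_(l < d) (expR (r l ^+ 2 / (2 * B)) * K)) => z.
rewrite ger0_norm ?expR_ge0//; apply: (@le_trans _ _ (expR (c + \sum_l r l * z l 0))).
  by rewrite ler_expR.
rewrite expRD expR_sum -mulrA ler_wpM2l ?expR_ge0// /tail_weight -big_split /=.
apply: ler_prod => l _; rewrite expR_ge0/=.
(* Completing the square gives r z <= r^2 / (2 B) + B z^2 / 2 in each coordinate. *)
apply: (@le_trans _ _ (expR (r l ^+ 2 / (2 * B)) * expR (2^-1 * B * z l 0 ^+ 2))).
  rewrite -expRD ler_expR -subr_ge0.
  have -> : r l ^+ 2 / (2 * B) + 2^-1 * B * z l 0 ^+ 2 - r l * z l 0 =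
      (r l - B * z l 0) ^+ 2 / (2 * B) by field; lra.
  by rewrite divr_ge0 ?sqr_ge0// mulr_ge0// ltW.
by rewrite -[leRHS]mulrA ler_wpM2l ?expR_ge0.
Qed.

Section root.
Variable eta : R.
Hypothesis eta_gt0 : 0 < eta.

Let phi x : R := Num.sqrt (eta + x ^+ 2 / 4).

Let phi2_gt0 x : 0 < eta + x ^+ 2 / 4.
Proof. by rewrite ltr_pwDl// divr_ge0// sqr_ge0. Qed.

Let phi_gt0 x : 0 < phi x. Proof. by rewrite sqrtr_gt0. Qed.

Lemma is_derive_inv_sqrt (x : R) :
  is_derive x 1 (fun x => (phi x)^-1) (- (4^-1 * x * (phi x)^-1 ^+ 3)).
Proof.
have d1 : is_derive x 1 (fun x : R => eta + x ^+ 2 / 4) (x / 2).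
  rewrite (_ : (fun _ => _) = (fun x : R => eta + 4^-1 * x ^+ 2)); last first.
    by apply/funext => y; rewrite [_ / 4]mulrC.
  by apply: is_derive_eq; rewrite /GRing.scale /=; field.
have d2 := @is_derive1_comp R Num.sqrt (fun x => eta + x ^+ 2 / 4) _ _ _
  (is_derive1_sqrt (phi2_gt0 x)) d1.
have := @is_deriveV R phi _ _ _ (lt0r_neq0 (phi_gt0 x)) d2.
rewrite -/(phi x) /GRing.scale /=; congr (is_derive _ _ _ _).
by field; rewrite gt_eqF.
Qed.

(** The inverse of the root comes before the root: it is bounded by eta^(-1/2), and its derivative
    is a polynomial in the argument and in itself, so that the induction on s closes. *)
Lemma growth_inv_sqrt s f : growth s f -> growth s (fun z => (phi (f z))^-1).
Proof.
elim: s f => [|j s IHs] f gf.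
  have [cf _] := gf; apply: growth_nil_le (growth_cst [::] (Num.sqrt eta)^-1).
    exact: continuous_comp_derive is_derive_inv_sqrt.
  move=> z; rewrite !ger0_norm ?invr_ge0 ?sqrtr_ge0//.
  rewrite lef_pV2 ?posrE ?sqrtr_gt0// ler_sqrt ?(ltW eta_gt0)//.
    by rewrite lerDl divr_ge0// sqr_ge0.
  exact/ltW/phi2_gt0.
have [gf' df gdf] := gf.
have D z : is_derive z (delta_mx j 0) (fun z => (phi (f z))^-1)
    (- (4^-1 * f z * (phi (f z))^-1 ^+ 3) * 'D_(delta_mx j 0) f z).
  exact: is_derive_comp1 (is_derive_inv_sqrt _) (df z).
split; [exact: IHs|by move=> z; have [] := D z|].
have g1 := IHs _ gf'.
apply: eq_growth (growthM (growthM (growthM (growth_cst s (- 4^-1)) gf')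
  (growthM g1 (growthM g1 g1))) gdf) => z.
by have [_ ->] := D z; ring.
Qed.

(** The root is eta + f^2 / 4 times its own inverse. *)
Lemma growth_sqrt s f : growth s f -> growth s (fun z => phi (f z)).
Proof.
move=> gf.
apply: eq_growth (growthM (growthD (growth_cst s eta)
  (growthM (growth_cst s 4^-1) (growthM gf gf))) (growth_inv_sqrt gf)) => z.
have p0 := phi_gt0 (f z).
have <- : phi (f z) ^+ 2 = eta + 4^-1 * (f z * f z).
  by rewrite /phi sqr_sqrtr ?ltW// expr2 [_ / 4]mulrC.
by rewrite expr2 mulfK// gt_eqF.
Qed.

Lemma growth_v_plus s f : growth s f -> growth s (fun z => v_plus eta (f z)).
Proof.
move=> gf; apply: eq_growth (growthD (growthM (growth_cst s 2^-1) gf) (growth_sqrt gf)) => z.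
by rewrite /v_plus mulrC.
Qed.

Lemma growth_v_minus s f : growth s f -> growth s (fun z => v_minus eta (f z)).
Proof.
move=> gf; apply: eq_growth (growthD (growthM (growth_cst s (- 2^-1)) gf) (growth_sqrt gf)) => z.
by rewrite /v_minus mulNr mulrC.
Qed.

End root.

Lemma growth_quad s (P : 'M[R]_d) (F : 'cV[R]_d -> 'cV[R]_d) :
  (forall l, growth s (fun z => F z l 0)) ->
  growth s (fun z => ((F z)^T *m P *m F z) 0 0).
Proof.
move=> gF; apply: eq_growth (growth_big (index_enum 'I_d) (fun i =>
  growthM (growth_big (index_enum 'I_d) (fun j =>
    growthM (gF j) (growth_cst s (P j i)))) (gF i))) => z.
rewrite mxE; apply: eq_bigr => i _; congr (_ * _).
by rewrite mxE; apply: eq_bigr => j _; rewrite mxE.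
Qed.

Lemma growth_affine s (c : 'cV[R]_d) (L : 'M[R]_d) l :
  growth s (fun z => (c + L *m z) l 0).
Proof.
apply: eq_growth (growthD (growth_cst s (c l 0)) (growth_big (index_enum 'I_d)
  (fun i => growthM (growth_cst s (L l i)) (growth_coord R s i)))) => z.
by rewrite !mxE.
Qed.

Lemma growth_IS_weight s (mu0 mu : 'cV[R]_d) (S0 S L : 'M[R]_d) :
  (forall z, (z^T *m z) 0 0 <= (z^T *m (L^T *m invmx S0 *m L) *m z) 0 0) ->
  growth s (IS_weight mu0 S0 mu S L).
Proof.
move=> Lge1; set P := invmx S0; set a := mu - mu0.
pose q z := 2^-1 * (z^T *m z) 0 0 -
  2^-1 * ((a + L *m z)^T *m P *m (a + L *m z)) 0 0.
have gq s' : growth s' q.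
  have g1 := growthM (growth_cst s' 2^-1)
    (growth_quad 1%:M (fun l => growth_coord R s' l)).
  have g2 := growthM (growth_cst s' (- 2^-1))
    (growth_quad P (fun l => growth_affine s' a L l)).
  by apply: eq_growth (growthD g1 g2) => z; rewrite /q mulmx1 mulNr.
apply: growthM (growth_cst s _) _; apply: growth_expR (gq s) _.
(* Linear coefficients of the exponent after expansion around a; by [Lge1] the remaining quadratic
   part is nonpositive. *)
pose r l := - 2^-1 * ((a^T *m P *m L) 0 l + (L^T *m P *m a) l 0).
apply: (@growth_expR_affine _ (- 2^-1 * (a^T *m P *m a) 0 0) r) => [|z].
  by have [] := gq [::].
have E : ((a + L *m z)^T *m P *m (a + L *m z)) 0 0 =
    (a^T *m P *m a) 0 0 + (\sum_l ((a^T *m P *m L) 0 l + (L^T *m P *m a) l 0) * z l 0)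
    + (z^T *m (L^T *m P *m L) *m z) 0 0.
  under eq_bigr do rewrite mulrDl.
  rewrite big_split /=.
  have -> : \sum_l (a^T *m P *m L) 0 l * z l 0 = (a^T *m P *m (L *m z)) 0 0.
    by rewrite mulmxA mxE.
  have -> : \sum_l (L^T *m P *m a) l 0 * z l 0 = ((L *m z)^T *m P *m a) 0 0.
    rewrite trmx_mul -!mulmxA mxE; apply: eq_bigr => l _.
    by rewrite [z^T _ _]mxE mulrC.
  have -> : z^T *m (L^T *m P *m L) *m z = (L *m z)^T *m P *m (L *m z).
    by rewrite trmx_mul !mulmxA.
  have addE (A B : 'M[R]_1) : (A + B) 0 0 = A 0 0 + B 0 0 by rewrite mxE.
  have -> : (a + L *m z)^T = a^T + (L *m z)^T by rewrite linearD.
  rewrite !mulmxDl !mulmxDr !addE.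
  by ring.
rewrite /q E /r; under [in leRHS]eq_bigr do rewrite -mulrA.
rewrite -mulr_sumr.
by have := Lge1 z; rewrite -/P; lra.
Qed.

(** [growth] differentiates along the head of s first while [partials] applies the head of its list
    last, hence the reversal. The boundary growth condition bounds only derivatives listed in the
    order of some [enum v]. *)
Lemma growth_partials (G : 'cV[R]_d -> R) s r : qmc_friendly G ->
  (forall s0, subseq s0 s -> exists v : {set 'I_d}, rev s0 ++ r = enum v) ->
  uniq (rev s ++ r) -> growth s (partials r G).
Proof.
move=> [Gs Gb]; elim: s r => [|j s IHs] r sr ur.
  have [cG _] := Gs r ur; split => // B B0.
  have [v rv] := sr [::] (sub0seq _); rewrite /= in rv.
  have [K _ hK] := Gb (fun=> B) (fun=> B0); exists K => z.
  by rewrite rv; exact: hK.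
move: ur; rewrite rev_cons cat_rcons => ur.
have [ur' jr] : uniq r /\ j \notin r.
  by move: ur; rewrite cat_uniq /= => /and4P[_ _ ? ?].
split.
- apply: IHs => [s0 ss0|].
    by apply: sr; apply: subseq_trans ss0 _; exact: subseq_cons.
  move: ur; rewrite !cat_uniq /= => /and4P[-> + _ ->].
  by rewrite negb_or => /andP[_ ->].
- by move=> z; have [_ h] := Gs r ur'; exact: h.
- apply: (IHs (j :: r)) => // s0 ss0; rewrite -cat_rcons -rev_cons.
  by apply: sr; rewrite /= eqxx.
Qed.

Lemma growth_qmc_friendly (G : 'cV[R]_d -> R) :
  qmc_friendly G -> growth (rev (enum 'I_d)) G.
Proof.
move=> /growth_partials h; apply: (h _ [::]) => [s0 ss0|]; last first.
  by rewrite revK cats0 enum_uniq.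
(* A subsequence of the enumeration of all coordinates enumerates the set of its elements. *)
exists [set x in rev s0]; rewrite cats0.
have : subseq (rev s0) (enum 'I_d) by rewrite -[enum _]revK subseq_rev.
move/(subseq_uniqP (enum_uniq _)) => e; rewrite [LHS]e.
rewrite [RHS]/enum_mem -enumT; apply: eq_filter => x.
by rewrite /= inE.
Qed.

End growth_IS.

Lemma is_derive_bigsum (R : realType) (I : Type) (r : seq I) (h : I -> R -> R)
    (dh : I -> R) (x : R) :
  (forall i, is_derive x 1 (h i) (dh i)) ->
  is_derive x 1 (fun y => \sum_(i <- r) h i y) (\sum_(i <- r) dh i).
Proof.
move=> H; elim: r => [|i r IHr].
  rewrite big_nil (_ : (fun _ => _) = cst 0); first exact: is_derive_cst.
  by apply/funext => y; rewrite big_nil.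
rewrite big_cons (_ : (fun _ => _) = h i + (fun y => \sum_(i <- r) h i y)).
  exact: is_deriveD.
by apply/funext => y; rewrite big_cons.
Qed.

(** * Bounding the components of a function of bounded growth *)

Section tensor_bound.
Variables (R : realType) (d : nat) (X : finType) (x0 : X).
Variables (node : X -> R) (kappa : 'I_d -> X -> R) (rho : R -> R) (N : 'I_d -> R).
Implicit Types (H : 'cV[R]_d -> R) (s : seq 'I_d) (z : 'cV[R]_d) (j : 'I_d).

(* Written as an affine line so that the chain rule applies. *)
Definition upd z j (x : R) : 'cV[R]_d := z + (x - z j 0) *: delta_mx j 0.

Lemma updE z j x l : upd z j x l 0 = if l == j then x else z l 0.
Proof.
rewrite !mxE eqxx andbT; case: eqP => [->|_]; last by rewrite mulr0 addr0.
by rewrite mulr1 addrC subrK.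
Qed.

Lemma updC z i j x y : i != j -> upd (upd z j x) i y = upd (upd z i y) j x.
Proof.
move=> ij; apply/colP => l; rewrite !updE.
by case: eqP => // ->; rewrite (negbTE ij).
Qed.

(** Recursive form of the tensor product of one-dimensional functionals, which exposes one
    coordinate at a time to differentiation. *)
Fixpoint tensor s H z : R :=
  if s is j :: s' then \sum_t kappa j t * tensor s' H (upd z j (node t))
  else H z.

Lemma is_derive_tensor s H z j (x : R) : j \notin s ->
  (forall z, derivable H z (delta_mx j 0)) ->
  is_derive x 1 (fun x => tensor s H (upd z j x))
    (tensor s (fun z => 'D_(delta_mx j 0) H z) (upd z j x)).
Proof.
move=> + dH; elim: s z => [|i s IHs] z /=.
  move=> _; set z1 := upd z j x.
  have e : (fun h : R => h^-1 *: (((fun x => H (upd z j x)) \o shift x) (h *: 1) - H z1)) =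
      (fun h : R => h^-1 *: ((H \o shift z1) (h *: delta_mx j 0) - H z1)).
    apply/funext => h /=; congr (_ *: (H _ - _)).
    have hE l : (h *: delta_mx j 0 : 'cV[R]_d) l 0 = if l == j then h else 0.
      by rewrite !mxE eqxx andbT; case: eqP; rewrite ?mulr1 ?mulr0.
    apply/colP => l; rewrite [RHS]mxE hE /z1 !updE.
    by case: eqP => _; rewrite ?add0r// /GRing.scale /= mulr1.
  apply: DeriveDef; first by rewrite /derivable e; exact: dH.
  by rewrite /derive e.
rewrite inE negb_or => /andP[ji js].
have D t := is_deriveZ (kappa i t) (IHs (upd z i (node t)) js).
have := is_derive_bigsum (index_enum X) D.
rewrite /= (_ : (fun y => \sum_(t <- _) _) =
    (fun x => \sum_t kappa i t * tensor s H (upd (upd z j x) i (node t)))).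
  congr (is_derive _ _ _ _); apply: eq_bigr => t _.
  by rewrite updC//.
by apply/funext => y; apply: eq_bigr => t _; rewrite updC//.
Qed.

(** Coordinates outside s carry a point mass at x0, so that every step of the recursion sums over
    the same type of functions. *)
Lemma tensor_sum s H z : uniq s -> tensor s H z =
  \sum_(y : {ffun 'I_d -> X}) (\prod_l if l \in s then kappa l (y l) else (y l == x0)%:R) *
    H (\col_l if l \in s then node (y l) else z l 0).
Proof.
elim: s z => [|j s IHs] z /=.
  move=> _; rewrite (bigD1 [ffun=> x0])//= [X in _ + X]big1 ?addr0; last first.
    move=> y yx; have [l xy] : exists l, y l != x0.
      apply/existsP; rewrite -negb_forall; apply: contra yx => /forallP h.
      by apply/eqP/ffunP => l; rewrite ffunE; apply/eqP.
    by rewrite (bigD1 l)//= (negbTE xy) !mul0r.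
  rewrite big1 ?mul1r => [|l _]; last by rewrite ffunE eqxx.
  by congr H; apply/colP => l; rewrite mxE.
move=> /andP[js us]; rewrite [RHS](partition_big (fun y : {ffun 'I_d -> X} => y j) predT)//=.
apply: eq_bigr => t _; rewrite IHs// mulr_sumr.
pose setj (t : X) (y : {ffun 'I_d -> X}) : {ffun 'I_d -> X} :=
  [ffun l => if l == j then t else y l].
rewrite [LHS](bigID (fun y : {ffun 'I_d -> X} => y j == x0))/= [X in _ + X]big1 ?addr0; last first.
  by move=> y /negbTE yj; rewrite (bigD1 j)//= (negbTE js) yj !mul0r mulr0.
rewrite [RHS](reindex_onto (setj t) (setj x0)) /=; last first.
  by move=> y /eqP yj; apply/ffunP => l; rewrite !ffunE; case: eqP => // ->.
apply: eq_big => [y|y /eqP yj].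
  rewrite ffunE eqxx eqxx /=; apply/eqP/eqP => [yj|<-]; last by rewrite ffunE eqxx.
  by apply/ffunP => l; rewrite !ffunE; case: eqP => // ->.
rewrite mulrA (bigD1 j)//= (negbTE js) yj eqxx mul1r.
rewrite [in RHS](bigD1 j)//= in_cons eqxx /= [setj _ _ _]ffunE eqxx.
congr (_ * _ * H _).
  apply: eq_bigr => l /negbTE lj; rewrite in_cons lj /= [setj _ _ _]ffunE lj.
  by [].
apply/colP => l; rewrite [LHS]mxE [RHS]mxE in_cons [setj _ _ _]ffunE updE.
by case: eqP => //= ->; rewrite (negbTE js).
Qed.

(** Same recursion as [growth], with one weight rho and one constant K common to all the
    derivatives. *)
Fixpoint dbound K s H : Prop :=
  if s is j :: s' then
    [/\ dbound K s' H, forall z, derivable H z (delta_mx j 0)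
      & dbound K s' (fun z => 'D_(delta_mx j 0) H z)]
  else forall z, `|H z| <= K * \prod_(l < d) rho (z l 0).

Hypothesis rho_ge0 : forall x, 0 <= rho x.
Hypothesis N_ge0 : forall l, 0 <= N l.
Hypothesis kappaN : forall l (g dg : R -> R) A, 0 <= A ->
  (forall x, is_derive (x : R) 1 g (dg x)) ->
  (forall x, `|g x| <= A * rho x) -> (forall x, `|dg x| <= A * rho x) ->
  `|\sum_t kappa l t * g (node t)| <= A * N l.

(** The one-dimensional estimate [kappaN] is applied in coordinate j to the function already summed
    over s. The sums commute with the derivative in j, so the induction hypothesis bounds both this
    function and its derivative. *)
Lemma tensor_le K s H z : 0 <= K -> uniq s -> dbound K s H ->
  `|tensor s H z| <= K * \prod_l if l \in s then N l else rho (z l 0).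
Proof.
move=> K0; elim: s H z => [|j s IHs] H z /=; first by move=> _; exact.
move=> /andP[js us] [bH dH bdH].
pose A := K * \prod_(l | l != j) if l \in s then N l else rho (z l 0).
have A0 : 0 <= A.
  by rewrite mulr_ge0// prodr_ge0// => l _; case: ifP.
have -> : K * (\prod_l if l \in j :: s then N l else rho (z l 0)) = A * N j.
  rewrite (bigD1 j)//= in_cons eqxx /= mulrCA mulrC /A; congr (_ * _ * _).
  by apply: eq_bigr => l /negbTE lj; rewrite in_cons lj.
have updA F (x : R) : dbound K s F -> `|tensor s F (upd z j x)| <= A * rho x.
  move=> bF; apply: le_trans (IHs F _ us bF) _.
  rewrite (bigD1 j)//= (negbTE js) updE eqxx mulrCA mulrC /A.
  rewrite (eq_bigr (fun l => if l \in s then N l else rho (z l 0)))//.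
  by move=> l /negbTE lj; rewrite updE lj.
apply: (@kappaN j (fun x => tensor s H (upd z j x)) (fun x =>
  tensor s (fun z => 'D_(delta_mx j 0) H z) (upd z j x)) A A0) => [x||].
- exact: is_derive_tensor.
- by move=> x; exact: updA.
- by move=> x; exact: updA.
Qed.

End tensor_bound.

(** * Hoelder estimates for psi *)

Section holder.
Variable R : realType.
Implicit Types (u v B th : R).

Lemma powRVl u B : 0 < u -> u^-1 `^ B = (u `^ B)^-1.
Proof. by move=> u0; rewrite -(powR_inv1 (ltW u0)) -powRrM mulN1r powRN. Qed.

(** After factoring out u^-B, put w = (v - u) / v: then 1 - (1 - w)^B <= w <= w^th, where B <= 1, th
    <= 1 and 0 <= w <= 1 are used. Finally v^-th <= u^-th. *)
Lemma powRN_holder B th u v : 0 < B <= 1 -> 0 <= th <= 1 -> 0 < u <= v ->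
  0 <= u `^ (- B) - v `^ (- B) <= (v - u) `^ th * u `^ (- (B + th)).
Proof.
move=> /andP[B0 B1] /andP[th0 th1] /andP[u0 uv].
have v0 : 0 < v := lt_le_trans u0 uv.
have uv1 : 0 < u / v <= 1 by rewrite divr_gt0//= ler_pdivrMr// mul1r.
have E : u `^ (- B) - v `^ (- B) = u `^ (- B) * (1 - (u / v) `^ B).
  rewrite mulrBr mulr1 powRM ?invr_ge0 ?(ltW u0) ?(ltW v0)//.
  by rewrite !powRN powRVl// mulrA mulVf ?mul1r// gt_eqF// powR_gt0.
have w0 : 0 <= (v - u) / v by rewrite divr_ge0 ?subr_ge0// ltW.
have le1 : 1 - (u / v) `^ B <= ((v - u) / v) `^ th.
  apply: (@le_trans _ _ ((v - u) / v)).
    rewrite mulrBl divff ?gt_eqF// lerB//.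
    exact: ger1_powR.
  have [->|wn0] := eqVneq ((v - u) / v) 0; first exact: powR_ge0.
  apply: ger1_powR => //; rewrite lt_neqAle eq_sym wn0 w0 /=.
  by rewrite ler_pdivrMr// mul1r gerBl ltW.
have pos : 0 <= 1 - (u / v) `^ B.
  rewrite subr_ge0; have e : 1 = 1 `^ B :> R by rewrite powR1.
  by rewrite [leRHS]e ge0_ler_powR ?nnegrE ?(ltW B0)//; case/andP: uv1 => // /ltW.
rewrite E; apply/andP; split; first by rewrite mulr_ge0// powR_ge0.
rewrite opprD powRD; last by rewrite (gt_eqF u0) implybT.
rewrite mulrCA ler_wpM2l ?powR_ge0//; apply: (le_trans le1).
rewrite powRM ?subr_ge0// ?invr_ge0 ?(ltW v0)//.
rewrite ler_wpM2l ?powR_ge0// powRVl// powRN.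
by rewrite lef_pV2 ?posrE ?powR_gt0// ge0_ler_powR ?nnegrE ?(ltW u0) ?(ltW v0).
Qed.

Definition psi B u := (1 - u) `^ (- B) - u `^ (- B).

Let m u := Num.min u (1 - u).

(** Both terms of psi vary in the same direction, so the absolute value splits into two increments,
    at (u, v) and at (1 - v, 1 - u). *)
Lemma psi_holder B th u v : 0 < B <= 1 -> 0 <= th <= 1 ->
  0 < u < 1 -> 0 < v < 1 ->
  `|psi B u - psi B v| <=
  `|u - v| `^ th * (m u `^ (- (B + th)) + m v `^ (- (B + th))).
Proof.
move=> B01 th01; wlog uv : u v / u <= v => [hw u01 v01|].
  have [uv|/ltW vu] := leP u v; first exact: hw.
  by rewrite distrC [`|u - v|]distrC [X in _ * X]addrC; exact: hw.
move=> /andP[u0 u1] /andP[v0 v1].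
have h1 : 0 < u <= v by rewrite u0.
have h2 : 0 < 1 - v <= 1 - u by rewrite subr_gt0 v1 lerB.
have /andP[p1 q1] := powRN_holder B01 th01 h1.
have /andP[p2 q2] := powRN_holder B01 th01 h2.
have -> : `|psi B u - psi B v| =
    (u `^ (- B) - v `^ (- B)) + ((1 - v) `^ (- B) - (1 - u) `^ (- B)).
  by rewrite distrC ger0_norm /psi; lra.
have -> : `|u - v| = v - u by rewrite distrC ger0_norm// subr_ge0.
have e : 1 - u - (1 - v) = v - u by lra.
rewrite e in q2.
have mle x y : 0 < x -> x <= y -> y `^ (- (B + th)) <= x `^ (- (B + th)).
  move=> x0 xy; rewrite !powRN lef_pV2 ?posrE ?powR_gt0//; last exact: lt_le_trans xy.
  apply: ge0_ler_powR => //; rewrite ?nnegrE ?(ltW x0) ?(le_trans _ xy)//.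
    by case/andP: B01; case/andP: th01; lra.
  by rewrite ltW.
have m0 x : 0 < x < 1 -> 0 < m x by rewrite lt_min subr_gt0.
rewrite mulrDr lerD//.
  apply: (le_trans q1); rewrite ler_wpM2l ?powR_ge0//; apply: mle.
    by apply: m0; rewrite u0.
  by rewrite ge_min lexx.
apply: (le_trans q2); rewrite ler_wpM2l ?powR_ge0//; apply: mle.
  by apply: m0; rewrite v0.
by rewrite ge_min lexx orbT.
Qed.

Lemma is_derive_psi_Phi B (x : R) : is_derive x 1 (fun x : R => psi B (Phi x))
  (B * normal_pdf 0 1 x *
   ((1 - Phi x) `^ (- B - 1) + Phi x `^ (- B - 1))).
Proof.
have d1 := is_derive_Phi x.
have d2 : is_derive x 1 (fun y => 1 - Phi y) (- normal_pdf 0 1 x).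
  by have := is_deriveB (is_derive_cst (1 : R) x 1) d1; rewrite sub0r.
have q0 : 0 < 1 - Phi x by rewrite subr_gt0 Phi_lt1.
have d3 := @is_derive1_comp R (fun y => y `^ (- B)) (fun y => 1 - Phi y) _ _ _
  (is_derive1_powR (- B) q0) d2.
have d4 := @is_derive1_comp R (fun y => y `^ (- B)) (@Phi R) _ _ _
  (is_derive1_powR (- B) (Phi_gt0 x)) d1.
have := is_deriveB d3 d4; congr (is_derive _ _ _ _).
by ring.
Qed.

(* The weight [tail ^ -B] is dominated by the derivative of [psi B \o Phi]: this
   turns bounds on derivatives in [z] into increments of [psi] in [u = Phi z]. *)
Lemma increment_le_psi B : 0 < B -> exists2 C, 0 < C & forall (g dg : R -> R) A,
  0 <= A -> (forall x, is_derive (x : R) 1 g (dg x)) ->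
  (forall x, `|dg x| <= A * tail x `^ (- B)) ->
  forall x y, `|g x - g y| <= A * C * `|psi B (Phi x) - psi B (Phi y)|.
Proof.
move=> B0; have [C C0 hC] := tail_le R.
have C'0 : 0 < C / B by rewrite divr_gt0.
exists (C / B) => // g dg A A0 dgP gle.
pose D (x : R) := B * normal_pdf 0 1 x *
   ((1 - Phi x) `^ (- B - 1) + Phi x `^ (- B - 1)).
have le1 x : tail x `^ (- B) <= C / B * D x.
  have t0 := tail_gt0 x.
  (* The bound tail x <= C phi x trades one power of the tail for the density that the derivative of
     psi (Phi x) contains. *)
  apply: (@le_trans _ _ (C * normal_pdf 0 1 x * tail x `^ (- B - 1))).
    rewrite powRB; last by rewrite (gt_eqF t0) implybT.
    rewrite powRr1 ?(ltW t0)// mulrCA ler_peMr ?powR_ge0//.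
    by rewrite ler_pdivlMr// mul1r.
  have -> : C / B * D x = C * normal_pdf 0 1 x *
      ((1 - Phi x) `^ (- B - 1) + Phi x `^ (- B - 1)).
    by rewrite /D; field; rewrite gt_eqF.
  rewrite ler_wpM2l ?mulr_ge0 ?(ltW C0) ?normal_pdf_ge0// tailE.
  have := powR_ge0 (1 - Phi x) (- B - 1); have := powR_ge0 (Phi x) (- B - 1).
  by rewrite /Num.min; case: ifP => _; lra.
move=> x y; wlog xy : x y / x <= y => [hw|].
  have [xy|/ltW yx] := leP x y; first exact: hw.
  by rewrite distrC [X in _ * X]distrC; exact: hw.
have [S SE] : exists S, S = A * (C / B) by eexists.
(* For e = 1 and e = -1 the function S psi (Phi z) + e g z has a nonnegative derivative, since |dg|
   <= S D. *)
have mono (e : R) : `|e| = 1 -> S * psi B (Phi x) + e * g x <= S * psi B (Phi y) + e * g y.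
  move=> e1; pose h z := S * psi B (Phi z) + e * g z.
  have dh (z : R) : is_derive z 1 h (S * D z + e * dg z).
    exact: is_deriveD (is_deriveZ S (is_derive_psi_Phi B z)) (is_deriveZ e (dgP z)).
  have [|c _ E] := MVT_segment xy (fun z _ => dh z).
    apply: continuous_subspaceT => z; apply: differentiable_continuous.
    by apply/derivable1_diffP; have [] := dh z.
  suff : h x <= h y by [].
  rewrite -subr_ge0 E mulr_ge0 ?subr_ge0//.
  rewrite -lerBlDr sub0r; apply: (le_trans (ler_norm _)).
  rewrite normrN normrM e1 mul1r; apply: (le_trans (gle c)).
  by rewrite SE -mulrA ler_wpM2l.
have h1 := mono 1 (normr1 _); have h2 := mono (-1) (normrN1 _).
rewrite -SE distrC [`|psi _ _ - _|]distrC.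
have S0 : 0 <= S by rewrite SE mulr_ge0// ltW.
move: (psi B (Phi x)) (psi B (Phi y)) (g x) (g y) h1 h2 => p q gx gy h1 h2.
apply: (@le_trans _ _ (S * (q - p))); last by rewrite ler_wpM2l// ler_norm.
by rewrite ler_norml; apply/andP; split; lra.
Qed.

End holder.

Section finite_valued.
Context {R : realType} {disp : measure_display} {T : measurableType disp}.
Variables (mu : {measure set T -> \bar R}) (X : finType) (Y : T -> X).
Hypothesis mY : forall y, measurable [set z | Y z = y].

Lemma measurable_finite_valued (disp' : measure_display)
  (T' : measurableType disp') (g : X -> T') : measurable_fun setT (fun z => g (Y z)).
Proof.
move=> _ A mA; rewrite setTI.
have -> : (fun z => g (Y z)) @^-1` A =
    \bigcup_(y in [set y | A (g y)]) [set z | Y z = y].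
  by apply/seteqP; split=> [z Az|z [y /= Ay Yz]]; [exists (Y z)|rewrite /= Yz].
by apply: fin_bigcup_measurable => // ; exact: finite_finset.
Qed.

Lemma integral_finite_valued (w : T -> R) (g : X -> R) :
  measurable_fun setT w -> (forall z, 0 <= w z) -> (forall y, 0 <= g y) ->
  (\int[mu]_z (g (Y z) * w z)%:E =
   \sum_y (g y)%:E * \int[mu]_(z in [set z | Y z = y]) (w z)%:E)%E.
Proof.
move=> mw w0 g0.
have E z : ((g (Y z) * w z)%:E =
    \sum_(y : X) (g y)%:E * ((EFin \o w) \_ [set z | Y z = y]) z)%E.
  rewrite (bigD1 (Y z))//= big1 ?adde0; last first.
    move=> y yz; rewrite patchE memNset ?mule0//= => Yz; move: yz.
    by rewrite Yz eqxx.
  by rewrite patchE mem_set//= EFinM.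
have mr y : measurable_fun setT ((EFin \o w) \_ [set z | Y z = y]).
  apply/(measurable_restrictT _ _).1 => //; apply: measurable_funTS.
  exact/measurable_EFinP.
have r0 y z : (0 <= ((EFin \o w) \_ [set z | Y z = y]) z)%E.
  by rewrite erestrict_ge0// => t _; rewrite lee_fin.
under eq_integral do rewrite E.
rewrite ge0_integral_sum//; last 2 first.
- by move=> y; apply: measurable_funeM.
- by move=> y z _; rewrite mule_ge0// lee_fin.
apply: eq_bigr => y _.
by rewrite ge0_integralZl_EFin// -integral_mkcond.
Qed.

End finite_valued.

(* The digit vector [y] stands for the cell [low_end y, low_end y + b^-M[; functions
   are sampled at its midpoint, which stays away from 0 and 1. *)
Section cells.
Variables (R : realType) (b : nat).
Hypothesis b_gt1 : (1 < b)%N.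
Let b_gt0 := ltnW b_gt1.
Implicit Types (u v : R) (k M : nat).

Lemma natrX_neq0 k : b%:R ^+ k != 0 :> R.
Proof. by rewrite gt_eqF// natrX_gt0. Qed.

Lemma digits_val_add (s : nat -> nat) k n :
  digits_val b s (k + n) =
  (b ^ n * digits_val b s k + digits_val b (fun i => s (k + i)) n)%N.
Proof.
elim: n => [|n IHn]; first by rewrite addn0 expn0 mul1n addn0.
by rewrite addnS /= IHn expnS mulnDr mulnA addnA.
Qed.

Definition low_end M (y : {ffun 'I_M -> 'I_b}) : R :=
  (digits_val b (digit_at b_gt1 y) M)%:R / b%:R ^+ M.

Definition midpoint M (y : {ffun 'I_M -> 'I_b}) : R :=
  low_end y + (b%:R ^+ M)^-1 / 2.

Lemma low_end_itv M (y : {ffun 'I_M -> 'I_b}) :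
  0 <= low_end y /\ low_end y + (b%:R ^+ M)^-1 <= 1.
Proof.
split; first by rewrite divr_ge0// ltW// natrX_gt0.
rewrite /low_end -[X in _ + X]mul1r -mulrDl ler_pdivrMr ?natrX_gt0// mul1r natr1 -natrX ler_nat.
exact: digits_val_lt.
Qed.

Lemma midpoint_itv M (y : {ffun 'I_M -> 'I_b}) : 0 < midpoint y < 1.
Proof.
have [l0 l1] := low_end_itv y; rewrite /midpoint.
have : 0 < (b%:R ^+ M)^-1 :> R by rewrite invr_gt0 natrX_gt0.
by move: l0 l1; move: (low_end y) (_^-1) => p q *; apply/andP; split; lra.
Qed.

Lemma agree_midpoint M k (y y' : {ffun 'I_M -> 'I_b}) : (k <= M)%N ->
  agree k y y' -> `|midpoint y - midpoint y'| <= (b%:R ^+ k)^-1.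
Proof.
move=> kM /agreeP yy'.
have E : digits_val b (digit_at b_gt1 y) k = digits_val b (digit_at b_gt1 y') k.
  apply: eq_digits_val => i ik; congr (nat_of_ord _).
  have iM : (i < M)%N by exact: leq_trans kM.
  by rewrite /digit_at insubT//=; apply: yy'.
have lowE (z : {ffun 'I_M -> 'I_b}) : exists2 r : R, 0 <= r < 1 &
    low_end z = (b%:R ^+ k)^-1 * ((digits_val b (digit_at b_gt1 z) k)%:R + r).
  exists ((digits_val b (fun i => digit_at b_gt1 z (k + i)) (M - k))%:R / b%:R ^+ (M - k)).
    rewrite divr_ge0 ?(ltW (natrX_gt0 _ _ _))//= ltr_pdivrMr ?natrX_gt0// mul1r.
    by rewrite -natrX ltr_nat; exact: digits_val_lt.
  have -> : low_end z = (b ^ (M - k) * digits_val b (digit_at b_gt1 z) k +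
      digits_val b (fun i => digit_at b_gt1 z (k + i)) (M - k))%:R /
      (b%:R ^+ k * b%:R ^+ (M - k)).
    by rewrite -digits_val_add -exprD subnKC.
  rewrite natrD natrM natrX.
  by field; rewrite !natrX_neq0.
have [r /andP[r0 r1] yE] := lowE y; have [r' /andP[r'0 r'1] y'E] := lowE y'.
rewrite /midpoint yE y'E E.
set c := (b%:R ^+ k)^-1; set e := _ / 2; set v := _%:R.
have -> : c * (v + r) + e - (c * (v + r') + e) = c * (r - r') by ring.
have c0 : 0 < c by rewrite invr_gt0 natrX_gt0.
rewrite normrM gtr0_norm// ler_piMr ?(ltW c0)// ler_norml.
by apply/andP; split; lra.
Qed.

Definition cell M (u : R) : {ffun 'I_M -> 'I_b} :=
  [ffun k : 'I_M => digit b_gt1 u k].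

Lemma cellP M (y : {ffun 'I_M -> 'I_b}) u : 0 <= u < 1 ->
  (cell M u == y) = (low_end y <= u < low_end y + (b%:R ^+ M)^-1).
Proof.
move=> u01; have u0 : 0 <= u by case/andP: u01.
have uM0 : 0 <= u * b%:R ^+ M by rewrite mulr_ge0// ltW// natrX_gt0.
rewrite /low_end -[X in _ + X]mul1r -mulrDl ler_pdivrMr ?natrX_gt0// ltr_pdivlMr ?natrX_gt0//.
rewrite natr1 -truncn_eq// truncn_digits_val//.
apply/eqP/forallP => [<- i|h].
  by rewrite /digit_at valK /= ffunE.
by apply/ffunP => i; rewrite ffunE; have /eqP := h i; rewrite /digit_at valK.
Qed.

Definition cell_point M (y : {ffun 'I_M -> 'I_b}) : R := Phi_inv (midpoint y).

Lemma Phi_cell_point M (y : {ffun 'I_M -> 'I_b}) : Phi (cell_point y) = midpoint y.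
Proof. by rewrite Phi_invK// midpoint_itv. Qed.

Lemma Phi_itv0 (z : R) : 0 <= Phi z < 1.
Proof. by rewrite ltW ?Phi_gt0 ?Phi_lt1. Qed.

(** The midpoint is at least half a cell away from 0 and 1, and Phi z is within half a cell of it:
    moving to the midpoint at most halves the distance to the boundary. *)
Lemma tail_cell_point M (z : R) : tail z <= 2 * tail (cell_point (cell M (Phi z))).
Proof.
have := eqxx (cell M (Phi z)); rewrite cellP ?Phi_itv0// => /andP[h1 h2].
rewrite !tailE Phi_cell_point /midpoint.
have [l0 l1] := low_end_itv (cell M (Phi z)).
have h0 : 0 < (b%:R ^+ M)^-1 :> R by rewrite invr_gt0 natrX_gt0.
move: h1 h2 l0 l1 h0.
move: (low_end (cell M (Phi z))) ((b%:R ^+ M)^-1) (Phi z) => l h u h1 h2 l0 l1 h0.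
by rewrite /Num.min; case: ltP => h3; case: ltP => h4; lra.
Qed.

Lemma measurable_cell M (y : {ffun 'I_M -> 'I_b}) :
  measurable [set z : R | cell M (Phi z) = y].
Proof.
rewrite (_ : mkset _ = [set z | low_end y <= Phi z < low_end y + (b%:R ^+ M)^-1]).
  exact: measurable_Phi_itv.
by apply/seteqP; split=> z /=; rewrite -cellP ?Phi_itv0// => /eqP.
Qed.

Lemma normal_prob_cell M (y : {ffun 'I_M -> 'I_b}) :
  normal_prob (0 : R) 1 [set z : R | cell M (Phi z) = y] = ((b%:R ^+ M)^-1)%:E.
Proof.
rewrite (_ : mkset _ = [set z | low_end y <= Phi z < low_end y + (b%:R ^+ M)^-1]).
  have [l0 l1] := low_end_itv y.
  rewrite normal_prob_Phi_itv//; first by rewrite addrC addKr.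
  by rewrite lerDl invr_ge0 ltW// natrX_gt0.
by apply/seteqP; split=> z /=; rewrite -cellP ?Phi_itv0// => /eqP.
Qed.

(** Cells have equal normal probability, so the average is the integral of a step function,
    dominated by 2^g times the tail power whatever M is. *)
Lemma avg_tail_powR (g : R) : 0 < g < 1 -> exists2 C, 0 <= C & forall M,
  (b%:R ^+ M)^-1 * \sum_(y : {ffun 'I_M -> 'I_b}) tail (cell_point y) `^ (- g) <= C.
Proof.
move=> g01; have := integral_tail_powR g01.
set I := (\int[_]_x _)%E => Ifin.
have I0 : (0 <= I)%E.
  by apply: integral_ge0 => x _; rewrite lee_fin mulr_ge0 ?powR_ge0// normal_pdf_ge0.
exists (2 `^ g * fine I); first by rewrite mulr_ge0 ?powR_ge0// fine_ge0.
move=> M.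
have mtail : measurable_fun setT (fun x : R => tail x `^ (- g) * normal_pdf 0 1 x).
  apply: measurable_funM; last exact: measurable_normal_pdf.
  apply: (@measurableT_comp _ _ _ _ _ _ (fun u : R => u `^ (- g))) => //.
  by apply: continuous_measurable_fun; exact: tail_continuous.
rewrite -lee_fin.
apply: (@le_trans _ _ (\int[lebesgue_measure]_z
   (tail (cell_point (cell M (Phi z))) `^ (- g) * normal_pdf 0 1 z)%:E)%E).
  rewrite (integral_finite_valued lebesgue_measure (@measurable_cell M)
    (g := fun y => tail (cell_point y) `^ (- g))) //; last 3 first.
  - exact: measurable_normal_pdf.
  - by move=> z; exact: normal_pdf_ge0.
  - by move=> y; exact: powR_ge0.
  rewrite (eq_bigr (fun y => (tail (cell_point y) `^ (- g) * (b%:R ^+ M)^-1)%:E)).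
    by rewrite sumEFin -mulr_suml mulrC.
  by move=> y _; rewrite EFinM; congr (_ * _)%E; exact: normal_prob_cell.
rewrite EFinM fineK; last by rewrite ge0_fin_numE.
have If0 (x : R) : setT x -> (0 <= (tail x `^ (- g) * normal_pdf 0 1 x)%:E)%E.
  by move=> _; rewrite lee_fin mulr_ge0 ?powR_ge0// normal_pdf_ge0.
have mEf : measurable_fun setT (fun x : R => (tail x `^ (- g) * normal_pdf 0 1 x)%:E).
  exact/measurable_EFinP.
rewrite /I -(ge0_integralZl_EFin lebesgue_measure measurableT If0 mEf) ?powR_ge0//.
apply: ge0_le_integral.
- exact: measurableT.
- by move=> x _; rewrite lee_fin mulr_ge0 ?powR_ge0// normal_pdf_ge0.
- apply/measurable_EFinP; apply: measurable_funM; last exact: measurable_normal_pdf.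
  exact: (measurable_finite_valued (@measurable_cell M)
    (fun y => tail (cell_point y) `^ (- g))).
- apply: measurable_funeM; exact/measurable_EFinP.
- move=> x _; rewrite -EFinM lee_fin mulrA ler_wpM2r ?normal_pdf_ge0//.
  rewrite !powRN ler_pdivlMr ?powR_gt0 ?tail_gt0// mulrC ler_pdivrMr ?powR_gt0 ?tail_gt0//.
  rewrite -powRM ?(ltW (tail_gt0 _))//.
  apply: ge0_ler_powR; rewrite ?nnegrE ?mulr_ge0 ?(ltW (tail_gt0 _))//.
    by case/andP: g01 => /ltW.
  exact: tail_cell_point.
Qed.

End cells.

(** * One-dimensional bounds for the digit kernels *)

Section kernel_norms.
Variables (R : realType) (b : nat).
Hypothesis b_gt1 : (1 < b)%N.
Let b_gt0 := ltnW b_gt1.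

Lemma jensen_sqr (I : finType) (w f : I -> R) : (forall i, 0 <= w i) ->
  \sum_i w i = 1 -> (\sum_i w i * f i) ^+ 2 <= \sum_i w i * f i ^+ 2.
Proof.
move=> w0 w1; set m := \sum_i w i * f i.
suff : 0 <= \sum_i w i * (f i - m) ^+ 2.
  have -> : \sum_i w i * (f i - m) ^+ 2 = \sum_i w i * f i ^+ 2 - m ^+ 2.
    transitivity (\sum_i (w i * f i ^+ 2 - 2 * m * (w i * f i) + m ^+ 2 * w i)).
      by apply: eq_bigr => i _; ring.
    rewrite big_split /= sumrB -!mulr_sumr w1 -/m; ring.
  by rewrite subr_ge0.
by apply: sumr_ge0 => i _; rewrite mulr_ge0// sqr_ge0.
Qed.

Variable M : nat.
Local Notation X := {ffun 'I_M -> 'I_b}.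
Variables (B th C : R).
Hypotheses (B01 : 0 < B <= 1) (th01 : 0 <= th <= 1).
Hypothesis C_ge0 : 0 <= C.
Hypothesis incr_psi : forall (g dg : R -> R) A,
  0 <= A -> (forall x, is_derive (x : R) 1 g (dg x)) ->
  (forall x, `|dg x| <= A * tail x `^ (- B)) ->
  forall x y, `|g x - g y| <= A * C * `|psi B (Phi x) - psi B (Phi y)|.

Definition cell_weight (y : X) : R := tail (cell_point R b_gt1 y) `^ (- (B + th)).

Definition ker_avg k (x : X) : R := \sum_y ker R k x y * cell_weight y.

(** Pointwise bound for [dker k] on functions of bounded growth. At level k.+1 the points compared
    share k digits, which produces the Hoelder factor b^(-k th). *)
Definition dker_norm k (x : X) : R :=
  if k is k'.+1 then
    C * (b%:R ^+ k')^-1 `^ th * (ker_avg k x + ker_avg k' x)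
  else ker_avg k x.

Let weight_ge0 y : 0 <= cell_weight y. Proof. exact: powR_ge0. Qed.

Lemma ker_avg_ge0 k x : 0 <= ker_avg k x.
Proof. by apply: sumr_ge0 => y _; rewrite mulr_ge0// ker_ge0. Qed.

Lemma dker_norm_ge0 k x : 0 <= dker_norm k x.
Proof.
case: k => [|k] /=; first exact: ker_avg_ge0.
by rewrite !mulr_ge0 ?powR_ge0// addr_ge0// ker_avg_ge0.
Qed.

Lemma psi_cell_point k (y y' : X) : (k <= M)%N -> agree k y y' ->
  `|psi B (Phi (cell_point R b_gt1 y)) - psi B (Phi (cell_point R b_gt1 y'))| <=
  (b%:R ^+ k)^-1 `^ th * (cell_weight y + cell_weight y').
Proof.
move=> kM yy'; rewrite /cell_weight !tailE !Phi_cell_point.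
apply: (le_trans (psi_holder B01 th01 (midpoint_itv _ _ _) (midpoint_itv _ _ _))).
rewrite ler_wpM2r ?addr_ge0 ?powR_ge0//.
apply: ge0_ler_powR; rewrite ?nnegrE//; first by case/andP: th01.
exact: agree_midpoint.
Qed.

(** Both kernels have mass 1, so their difference is a double average of g t - g t' over pairs
    sharing the first k digits of x, and such increments are controlled by psi. At level 0 the bound
    on g itself is used. *)
Lemma dker_le k x (g dg : R -> R) A : (k <= M)%N -> 0 <= A ->
  (forall x, is_derive (x : R) 1 g (dg x)) ->
  (forall x, `|g x| <= A * tail x `^ (- B)) ->
  (forall x, `|dg x| <= A * tail x `^ (- B)) ->
  `|\sum_t dker R k x t * g (cell_point R b_gt1 t)| <= A * dker_norm k x.
Proof.
move=> kM A0 dgP gle dgle; case: k kM => [_|k kM] /=.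
  rewrite /ker_avg mulr_sumr; apply: (le_trans (ler_norm_sum _ _ _)).
  apply: ler_sum => t _; rewrite /dker subr0 normrM ger0_norm ?ker_ge0//.
  rewrite mulrCA ler_wpM2l ?ker_ge0//; apply: (le_trans (gle _)).
  rewrite ler_wpM2l//; apply: tail_powRN_le; rewrite lerDl.
  by case/andP: th01.
pose G (t : X) := g (cell_point R b_gt1 t).
have s1 := sum_ker R b_gt0 x kM; have s2 := sum_ker R b_gt0 x (ltnW kM).
have E : \sum_t dker R k.+1 x t * G t =
    \sum_t \sum_t' ker R k.+1 x t * ker R k x t' * (G t - G t').
  transitivity (\sum_t (ker R k.+1 x t * G t * \sum_t' ker R k x t') -
      (\sum_t ker R k.+1 x t) * \sum_t' ker R k x t' * G t').
    rewrite s1 s2 mul1r -sumrB; apply: eq_bigr => t _.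
    by rewrite /dker mulr1 mulrBl.
  rewrite mulr_suml -sumrB; apply: eq_bigr => t _.
  by rewrite !mulr_sumr -sumrB; apply: eq_bigr => t' _; ring.
rewrite E.
set h := _ `^ th.
have -> : A * (C * h * (ker_avg k.+1 x + ker_avg k x)) =
    \sum_t \sum_t' ker R k.+1 x t * ker R k x t' * (A * C * (h * (cell_weight t + cell_weight t'))).
  transitivity (A * C * h * (\sum_t (ker R k.+1 x t * cell_weight t * \sum_t' ker R k x t') +
      (\sum_t ker R k.+1 x t) * \sum_t' ker R k x t' * cell_weight t')).
    rewrite s1 s2 mul1r /ker_avg; under [X in _ = _ * (X + _)]eq_bigr do rewrite mulr1.
    by ring.
  rewrite mulr_suml -big_split mulr_sumr /=; apply: eq_bigr => t _.
  rewrite !mulr_sumr -big_split /= mulr_sumr; apply: eq_bigr => t' _.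
  move: (ker R k.+1 x t) (ker R k x t') (cell_weight t) (cell_weight t') (h).
  by move=> p q u v h'; ring.
apply: (le_trans (ler_norm_sum _ _ _)); apply: ler_sum => t _.
apply: (le_trans (ler_norm_sum _ _ _)); apply: ler_sum => t' _.
rewrite normrM ger0_norm ?mulr_ge0 ?ker_ge0//.
have [xt|xt] := boolP (agree k.+1 x t); last first.
  by rewrite {1 3}/ker (negbTE xt) !mul0r.
have [xt'|xt'] := boolP (agree k x t'); last first.
  by rewrite {2 4}/ker (negbTE xt') !(mul0r, mulr0).
rewrite ler_wpM2l ?mulr_ge0 ?ker_ge0//.
apply: (le_trans (incr_psi A0 dgP dgle _ _)).
rewrite ler_wpM2l ?mulr_ge0//; apply: psi_cell_point; first exact: ltnW.
by apply: agree_trans xt'; rewrite agree_sym; apply: agree_le xt.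
Qed.

(** Jensen's inequality, then an exchange of the sums: the symmetric kernel has mass 1 in its other
    variable too. *)
Lemma avg_sqr_ker_avg k : (k <= M)%N ->
  \sum_x ker_avg k x ^+ 2 <= \sum_y cell_weight y ^+ 2.
Proof.
move=> kM.
apply: (@le_trans _ _ (\sum_(x : X) \sum_y ker R k x y * cell_weight y ^+ 2)).
  apply: ler_sum => x _; apply: jensen_sqr; first by move=> y; exact: ker_ge0.
  exact: sum_ker.
rewrite exchange_big /=; apply: ler_sum => y _.
rewrite -mulr_suml; under eq_bigr do rewrite ker_sym.
by rewrite sum_ker// mul1r.
Qed.

(** In the constant, 1 serves level 0; 4 C^2 comes from (p + q)^2 <= 2 (p^2 + q^2) with two averages
    bounded by S, and b^(2 th) offsets the Hoelder factor being that of the preceding level. *)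
Lemma avg_sqr_dker_norm k S : (k <= M)%N ->
  (b%:R ^+ M)^-1 * \sum_y tail (cell_point R b_gt1 (y : X)) `^ (- (2 * (B + th))) <= S ->
  (b%:R ^+ M)^-1 * \sum_x dker_norm k x ^+ 2 <=
  (1 + 4 * C ^+ 2 * b%:R `^ (2 * th)) * S * (b%:R `^ (- (2 * th))) ^+ k.
Proof.
move=> kM HS.
have b0 : 0 < b%:R :> R by rewrite ltr0n.
have bM0 : 0 <= (b%:R ^+ M)^-1 :> R by rewrite invr_ge0 ltW// natrX_gt0.
have W : (b%:R ^+ M)^-1 * \sum_y cell_weight y ^+ 2 <= S.
  apply: le_trans HS; rewrite ler_wpM2l// le_eqVlt; apply/predU1l.
  apply: eq_bigr => y _; rewrite /cell_weight -powR_mulrn ?powR_ge0// -powRrM.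
  by congr (_ `^ _); ring.
have S0 : 0 <= S.
  by apply: le_trans W; rewrite mulr_ge0//; apply: sumr_ge0 => y _; exact: sqr_ge0.
set q := b%:R `^ (- (2 * th)).
have q0 : 0 < q by rewrite powR_gt0.
have bq : b%:R `^ (2 * th) * q = 1 by rewrite /q powRN mulfV// gt_eqF// powR_gt0.
have c0 : 0 <= 4 * C ^+ 2 * b%:R `^ (2 * th).
  by rewrite mulr_ge0 ?powR_ge0// mulr_ge0// sqr_ge0.
case: k kM => [_|k kM] /=.
  rewrite expr0 mulr1; apply: (@le_trans _ _ S).
    by apply: le_trans W; rewrite ler_wpM2l//; exact: avg_sqr_ker_avg.
  by rewrite ler_peMl// lerDl.
have E : ((b%:R ^+ k)^-1 `^ th) ^+ 2 = q ^+ k :> R.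
  rewrite -powR_invn ?(ltW b0)// -powRrM -[LHS]powR_mulrn ?powR_ge0// -powRrM.
  rewrite -[RHS]powR_mulrn ?(ltW q0)// /q -powRrM.
  by congr (_ `^ _); ring.
apply: (@le_trans _ _ (4 * C ^+ 2 * q ^+ k * S)); last first.
  rewrite [q ^+ k.+1]exprS.
  have -> (c : R) : (1 + c) * S * (q * q ^+ k) = c * S * (q * q ^+ k) + S * (q * q ^+ k).
    by ring.
  rewrite -[leLHS]addr0 lerD//; last first.
    by rewrite mulr_ge0// mulr_ge0 ?exprn_ge0 ?(ltW q0).
  have -> : 4 * C ^+ 2 * b%:R `^ (2 * th) * S * (q * q ^+ k) =
    4 * C ^+ 2 * S * q ^+ k * (b%:R `^ (2 * th) * q) by ring.
  by rewrite bq mulr1 le_eqVlt; apply/predU1l; ring.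
apply: (@le_trans _ _ ((b%:R ^+ M)^-1 * \sum_x
    (2 * C ^+ 2 * q ^+ k) * (ker_avg k.+1 x ^+ 2 + ker_avg k x ^+ 2))).
  rewrite ler_wpM2l//; apply: ler_sum => x _.
  rewrite !exprMn E.
  have -> : 2 * C ^+ 2 * q ^+ k * (ker_avg k.+1 x ^+ 2 + ker_avg k x ^+ 2) =
    C ^+ 2 * q ^+ k * (2 * (ker_avg k.+1 x ^+ 2 + ker_avg k x ^+ 2)) by ring.
  rewrite ler_wpM2l ?mulr_ge0 ?sqr_ge0 ?exprn_ge0 ?(ltW q0)//.
  rewrite -subr_ge0.
  have -> : 2 * (ker_avg k.+1 x ^+ 2 + ker_avg k x ^+ 2) - (ker_avg k.+1 x + ker_avg k x) ^+ 2
    = (ker_avg k.+1 x - ker_avg k x) ^+ 2 by ring.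
  exact: sqr_ge0.
rewrite -mulr_sumr big_split /=.
have h1 : (b%:R ^+ M)^-1 * \sum_x ker_avg k.+1 x ^+ 2 <= S.
  by apply: le_trans W; rewrite ler_wpM2l//; exact: avg_sqr_ker_avg.
have h2 : (b%:R ^+ M)^-1 * \sum_x ker_avg k x ^+ 2 <= S.
  by apply: le_trans W; rewrite ler_wpM2l//; apply: avg_sqr_ker_avg; exact: ltnW.
rewrite mulrCA mulrDr.
have -> : 4 * C ^+ 2 * q ^+ k * S = 2 * C ^+ 2 * q ^+ k * (S + S) by ring.
by rewrite ler_wpM2l ?lerD// !mulr_ge0 ?sqr_ge0 ?exprn_ge0 ?(ltW q0).
Qed.

End kernel_norms.

(** * The variance bound at resolution b^-M *)

Section discrete_variance.
Variables (R : realType) (d b : nat).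
Hypothesis b_gt1 : (1 < b)%N.
Let b_gt0 := ltnW b_gt1.

Lemma dbound_le (rho : R -> R) K K' s (H : 'cV[R]_d -> R) :
  (forall x, 0 <= rho x) -> K <= K' -> dbound rho K s H -> dbound rho K' s H.
Proof.
move=> rho0 KK'; elim: s H => [|j s IHs] H /=.
  move=> h z; apply: (le_trans (h z)); rewrite ler_wpM2r//.
  by apply: prodr_ge0 => l _.
by move=> [h1 h2 h3]; split; [exact: IHs|exact: h2|exact: IHs].
Qed.

Lemma growth_dbound s (H : 'cV[R]_d -> R) (B : R) : 0 < B -> growth s H ->
  exists2 K, 0 <= K & dbound (fun x => tail x `^ (- B)) K s H.
Proof.
move=> B0; have p0 (x : R) : 0 <= tail x `^ (- B) by exact: powR_ge0.
elim: s H => [|j s IHs] H /=.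
  move=> [_ /(_ B B0)[K hK]]; exists `|K| => // z; apply: (le_trans (hK z)).
  by rewrite ler_wpM2r ?ler_norm//; apply: prodr_ge0 => l _; exact: powR_ge0.
move=> [/IHs[K1 K10 h1] h2 /IHs[K3 K30 h3]]; exists (K1 + K3).
  exact: addr_ge0.
split; [|exact: h2|].
  by apply: dbound_le h1 => //; rewrite lerDl.
by apply: dbound_le h3 => //; rewrite lerDr.
Qed.

Definition cell_vector M (y : {ffun 'I_d -> {ffun 'I_M -> 'I_b}}) : 'cV[R]_d :=
  \col_l cell_point R b_gt1 (y l).

Lemma Delta_growth (H : 'cV[R]_d -> R) (B th : R) :
  0 < B <= 1 -> 0 <= th <= 1 -> B + th < 2^-1 -> growth (rev (enum 'I_d)) H ->
  exists2 A, 0 <= A & forall M (k : {ffun 'I_d -> 'I_M.+1}),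
   (#|{: {ffun 'I_d -> {ffun 'I_M -> 'I_b}}}|%:R)^-1 *
   \sum_y Delta k (fun y => H (cell_vector y)) y ^+ 2 <=
   A * (b%:R `^ (- (2 * th))) ^+ (\sum_l k l).
Proof.
move=> B01 th01 Bth gH.
have B0 : 0 < B by case/andP: B01.
have [KH KH0 dH] := growth_dbound B0 gH.
have [C C0 incr] := increment_le_psi B0.
(* The squared weight tail^(-2 (B + th)) has averages bounded in M because B + th < 1/2. *)
have g01 : 0 < 2 * (B + th) < 1.
  by case/andP: th01 => th0 _; apply/andP; split; lra.
have [S S0 hS] := avg_tail_powR b_gt1 g01.
pose c := (1 + 4 * C ^+ 2 * b%:R `^ (2 * th)) * S.
have c0 : 0 <= c.
  by rewrite mulr_ge0// addr_ge0// mulr_ge0 ?powR_ge0// mulr_ge0// sqr_ge0.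
exists (KH ^+ 2 * c ^+ d); first by rewrite mulr_ge0 ?exprn_ge0// sqr_ge0.
move=> M k; set q := b%:R `^ _.
have kM l : (k l <= M)%N by rewrite -ltnS.
pose x0 : {ffun 'I_M -> 'I_b} := [ffun=> Ordinal b_gt0].
have us : uniq (rev (enum 'I_d)) by rewrite rev_uniq enum_uniq.
have ins l : l \in rev (enum 'I_d) by rewrite mem_rev mem_enum.
have le1 x : `|Delta k (fun y => H (cell_vector y)) x| <=
    KH * \prod_l dker_norm b_gt1 B th C (k l) (x l).
  pose kap l t := dker R (k l) (x l) t.
  (* The base point 0 is arbitrary: all coordinates occur in the list and get replaced. *)
  have E : Delta k (fun y => H (cell_vector y)) x =
      tensor (@cell_point R b b_gt1 M) kap (rev (enum 'I_d)) H 0.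
    rewrite (tensor_sum x0 _ _ _ _ us); apply: eq_bigr => y _; congr (_ * H _).
      by apply: eq_bigr => l _; rewrite ins.
    by apply/colP => l; rewrite !mxE ins.
  rewrite E.
  have := @tensor_le R d _ (@cell_point R b b_gt1 M) kap (fun x => tail x `^ (- B))
    (fun l => dker_norm b_gt1 B th C (k l) (x l)) _ _ _ KH (rev (enum 'I_d)) H 0 KH0 us dH.
  under eq_bigr do rewrite ins.
  apply.
  - by move=> z; exact: powR_ge0.
  - by move=> l; apply: dker_norm_ge0; exact: ltW.
  - move=> l g dg A A0 dgP gle dgle.
    exact: (dker_le b_gt1 B01 th01 (ltW C0) incr (x l) (kM l) A0 dgP gle dgle).
have bM0 : (b%:R ^+ M) ^+ d != 0 :> R by rewrite gt_eqF// exprn_gt0// natrX_gt0.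
have DE : #|{: {ffun 'I_d -> {ffun 'I_M -> 'I_b}}}|%:R = (b%:R ^+ M) ^+ d :> R.
  by rewrite card_digits natrX exprM.
rewrite DE.
apply: (@le_trans _ _ (((b%:R ^+ M) ^+ d)^-1 * \sum_(y : {ffun 'I_d -> {ffun 'I_M -> 'I_b}})
   KH ^+ 2 * \prod_l dker_norm b_gt1 B th C (k l) (y l) ^+ 2)).
  rewrite ler_wpM2l ?invr_ge0 ?exprn_ge0//; apply: ler_sum => y _.
  rewrite -(real_normK (num_real _)) prodrXl -exprMn lerXn2r ?nnegrE//.
  rewrite mulr_ge0//; apply: prodr_ge0 => l _; apply: dker_norm_ge0; exact: ltW.
rewrite -mulr_sumr mulrCA -mulrA ler_wpM2l ?sqr_ge0//.
rewrite -(bigA_distr_bigA (fun l y => dker_norm b_gt1 B th C (k l) y ^+ 2)).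
have -> : ((b%:R ^+ M) ^+ d)^-1 = \prod_(l < d) (b%:R ^+ M)^-1 :> R.
  by rewrite prodr_const card_ord exprVn.
have -> : c ^+ d * q ^+ (\sum_l k l) = \prod_(l < d) (c * q ^+ (k l)).
  by rewrite big_split /= prodr_const card_ord expr_sum.
rewrite -big_split /=; apply: ler_prod => l _.
apply/andP; split.
  by rewrite mulr_ge0 ?invr_ge0 ?exprn_ge0//; apply: sumr_ge0 => y _; exact: sqr_ge0.
exact: (avg_sqr_dker_norm (ltW C0) (kM l) (hS M)).
Qed.

Definition scrambled_net M N (a : 'I_N -> 'cV[R]_d) x i :=
  finite_scramble x (digits b_gt1 M (a i)).

(* The constant does not depend on the resolution [M], which is sent to infinity
   in [scrambled_mse]. *)
Lemma discrete_variance (H : 'cV[R]_d -> R) (t : nat) (eps : R) :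
  0 < eps <= 4^-1 -> growth (rev (enum 'I_d)) H ->
  exists2 K, 0 <= K & forall m M (a : 'I_(b ^ m) -> 'cV[R]_d),
    is_net b t m a -> (m <= M)%N ->
    (#|{: {ffun 'I_d * {bseq M of 'I_b} -> {perm 'I_b}}}|%:R)^-1 *
    \sum_(x : {ffun 'I_d * {bseq M of 'I_b} -> {perm 'I_b}})
      (\sum_i H (cell_vector (scrambled_net a x i)) -
       (b ^ m)%:R / #|{: {ffun 'I_d -> {ffun 'I_M -> 'I_b}}}|%:R *
       \sum_(y : {ffun 'I_d -> {ffun 'I_M -> 'I_b}}) H (cell_vector y)) ^+ 2
    <= K * (b ^ m)%:R `^ (2 * eps).
Proof.
move=> /andP[e0 e1] gH.
(* Here B + th = 1/2 - eps/4 stays below 1/2, and 2 th = 1 - eps. *)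
have [||||A A0 hA] := @Delta_growth H (eps / 4) ((1 - eps) / 2).
- by apply/andP; split; lra.
- by apply/andP; split; lra.
- lra.
- exact: gH.
have b1 : 1 < b%:R :> R by rewrite ltr1n.
have b0 : 0 < b%:R :> R by rewrite ltr0n.
(* The decay b^-(1 - eps) is split as p^2 s: p^2 = b^-eps makes the sums over k converge, and s =
   b^-(1 - 2 eps) gives the rate. *)
pose p : R := b%:R `^ (- (eps / 2)).
pose s : R := b%:R `^ (- (1 - 2 * eps)).
have p0 : 0 < p by rewrite powR_gt0.
have p1 : p < 1.
  rewrite /p powRN invf_lt1 ?powR_gt0//.
  have e : 1 = 1 `^ (eps / 2) :> R by rewrite powR1.
  by rewrite [ltLHS]e gt0_ltr_powR ?nnegrE// divr_gt0.
have s0 : 0 < s by rewrite powR_gt0.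
have s1 : s <= 1.
  rewrite /s powRN invf_le1 ?powR_gt0//.
  have e : 1 = 1 `^ (1 - 2 * eps) :> R by rewrite powR1.
  by rewrite [leLHS]e ge0_ler_powR ?nnegrE ?ltW//; lra.
have q0 : 0 <= (1 - p)^-1 by rewrite invr_ge0 subr_ge0 ltW.
exists (b%:R ^+ (t + d) * A * ((1 - p)^-1 ^+ d) ^+ 2 * b%:R `^ ((1 - 2 * eps) * t%:R)).
  by rewrite !mulr_ge0 ?powR_ge0// ?exprn_ge0.
move=> m M a neta mM; have [tm _ _] := neta.
have aE := net_equidistributed b_gt1 neta mM.
apply: (le_trans (scrambled_variance (p := p) (s := s) b_gt0 (leq_subr t m) mM erefl
  _ _ aE _ A0 _ _ _ _)).
- by move=> i h; exact: finite_scramble_uniform.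
- by move=> l pp i j g h; exact: finite_scramble_orthogonal.
- by move=> x; exact: equidistributed_scramble.
- by rewrite p0 p1.
- by rewrite s0 s1.
- by apply/card_gt0P; exists [ffun=> 1%g].
- move=> k; apply: (le_trans (hA M k)).
  rewrite ler_wpM2l//.
  have -> : b%:R `^ (- (2 * ((1 - eps) / 2))) = p ^+ 2 * s :> R.
    rewrite -powR_mulrn ?powR_ge0// /p /s -powRrM -powRD; last by rewrite (gt_eqF b0) implybT.
    by congr (_ `^ _); field.
  by [].
rewrite subKn//.
(* The factor N is cancelled up to N^(2 eps); the defect t of the net only costs a constant. *)
have E : s ^+ (m - t) * (b ^ m)%:R = b%:R `^ ((1 - 2 * eps) * t%:R) * (b ^ m)%:R `^ (2 * eps).
  rewrite natrX -!powR_mulrn ?powR_ge0 ?ler0n// /s -!powRrM.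
  rewrite -!powRD ?(gt_eqF b0) ?implybT//; congr (_ `^ _).
  by rewrite natrB//; ring.
have -> (N2 B2 A2 Q s2 : R) : N2 * B2 * A2 * Q * s2 = B2 * A2 * Q * (s2 * N2) by ring.
by rewrite E (natrX _ b (t + d)) -[leRHS]mulrA.
Qed.

End discrete_variance.

(** * From finite resolution to the scrambled net *)

Section random_permutations.
Variables (R : realType) (disp : measure_display) (Omega : measurableType disp).
Variables (P : probability Omega R) (d b : nat).
Variable perms : Omega -> 'I_d -> seq 'I_b -> {perm 'I_b}.
Hypothesis permsP : uniform_independent_perms P perms.

Definition finite_perms M (w : Omega) :
    {ffun 'I_d * {bseq M of 'I_b} -> {perm 'I_b}} :=
  [ffun nd : 'I_d * {bseq M of 'I_b} => perms w nd.1 nd.2].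

Lemma finite_permsE M x : [set w | finite_perms M w = x] =
  \bigcap_(nd in [set: 'I_d * {bseq M of 'I_b}])
    [set w | perms w nd.1 nd.2 = x nd].
Proof.
apply/seteqP; split=> w /=; first by move=> <- nd _ /=; rewrite ffunE.
by move=> h; apply/ffunP => nd; rewrite ffunE; exact: h.
Qed.

Lemma measurable_finite_perms M x : measurable [set w | finite_perms M w = x].
Proof.
have [mp _ _] := permsP; rewrite finite_permsE.
by apply: fin_bigcap_measurable => // nd _; exact: finite_finset.
Qed.

Lemma prob_finite_perms M x : P [set w | finite_perms M w = x] =
  ((#|{: {ffun 'I_d * {bseq M of 'I_b} -> {perm 'I_b}}}|%:R)^-1)%:E.
Proof.
have [_ up ip] := permsP.
pose I := [seq (nd.1, val nd.2) | nd <- enum {: 'I_d * {bseq M of 'I_b}}].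
(* Independence is stated for arbitrary sequences; on the nodes listed in I, [insub_bseq] recovers
   the bounded sequence. *)
pose A (i : 'I_d * seq 'I_b) : {set {perm 'I_b}} :=
  [set x (i.1, insub_bseq M i.2)]%SET.
have AE (nd : 'I_d * {bseq M of 'I_b}) : A (nd.1, val nd.2) = [set x nd]%SET.
  rewrite /A /=; congr [set x _]%SET; case: nd => l p /=; congr (_, _).
  by apply: val_inj; rewrite /insub_bseq /= val_insubd size_bseq.
have uI : uniq I.
  by rewrite map_inj_uniq ?enum_uniq// => -[l p] [l' p'] [-> /val_inj ->].
rewrite (_ : mkset _ = [set w | forall i, i \in I -> perms w i.1 i.2 \in A i]); last first.
  rewrite finite_permsE; apply/seteqP; split=> w /= h.
    by move=> _ /mapP[nd _ ->]; rewrite AE inE /=; apply/eqP; exact: (h nd).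
  move=> nd _ /=; have := h (nd.1, val nd.2); rewrite AE inE /= => e.
  by apply/eqP/e; apply/mapP; exists nd => //; rewrite mem_enum.
rewrite ip// /I big_map.
under eq_bigr.
  move=> nd _; rewrite AE.
  rewrite (_ : mkset _ = [set w | perms w nd.1 nd.2 = x nd]); last first.
    by apply/seteqP; split=> w /=; rewrite inE => /eqP.
  rewrite up.
  over.
rewrite prodEFin; congr EFin.
rewrite big_enum /= prodr_const exprVn -natrX; congr (_%:R^-1).
by rewrite card_ffun; congr (_ ^ _)%N; apply: eq_card.
Qed.

Lemma integral_finite_perms M (g : {ffun 'I_d * {bseq M of 'I_b} -> {perm 'I_b}} -> R) :
  (forall x, 0 <= g x) ->
  (\int[P]_w (g (finite_perms M w))%:E)%E =
  ((#|{: {ffun 'I_d * {bseq M of 'I_b} -> {perm 'I_b}}}|%:R)^-1 * \sum_x g x)%:E.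
Proof.
move=> g0; have := integral_finite_valued P (@measurable_finite_perms M) (w := fun=> 1)
  (measurable_cst _) (fun=> ler01) g0.
under eq_integral do rewrite mulr1.
move=> ->; rewrite (eq_bigr (fun x =>
  (g x * (#|{: {ffun 'I_d * {bseq M of 'I_b} -> {perm 'I_b}}}|%:R)^-1)%:E)).
  by rewrite sumEFin -mulr_suml mulrC.
move=> x _; rewrite EFinM; congr (_ * _)%E.
rewrite integral_cst; last exact: measurable_finite_perms.
by rewrite mul1e; exact: prob_finite_perms.
Qed.

End random_permutations.

Section digit_series.
Variables (R : realType) (b : nat).
Hypothesis b_gt1 : (1 < b)%N.
Let b_gt0 := ltnW b_gt1.
Implicit Types (s : nat -> 'I_b) (M n : nat).

Definition digit_sum s : R :=
  limn (series (fun k : nat => (s k)%:R / b%:R ^+ k.+1 : R)).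

Definition first_digits M s : {ffun 'I_M -> 'I_b} := [ffun k : 'I_M => s k].

Lemma series_digits s M :
  series (fun k : nat => (s k)%:R / b%:R ^+ k.+1 : R) M =
  low_end R b_gt1 (first_digits M s).
Proof.
rewrite /low_end (eq_digits_val b (s' := s)); last first.
  by move=> i iM; rewrite /digit_at insubT /= ffunE.
elim: M => [|M IHM]; first by rewrite /series /= big_geq// mul0r.
rewrite /series /= big_nat_recr//= -/(series _ _) [X in X + _]IHM.
rewrite natrD natrM exprS; field.
by rewrite (natrX_neq0 R b_gt1) pnatr_eq0 -lt0n b_gt0.
Qed.

Lemma low_end_first_digits s M n : (M <= n)%N ->
  low_end R b_gt1 (first_digits M s) <= low_end R b_gt1 (first_digits n s) <=
  low_end R b_gt1 (first_digits M s) + (b%:R ^+ M)^-1.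
Proof.
move=> /subnKC <-; move: (n - M)%N => {}n.
have E k : low_end R b_gt1 (first_digits k s) = (digits_val b s k)%:R / b%:R ^+ k.
  rewrite /low_end (eq_digits_val b (s' := s))// => i ik.
  by rewrite /digit_at insubT /= ffunE.
rewrite !E digits_val_add natrD natrM natrX exprD.
set r := (digits_val b (fun i => s (M + i)%N) n)%:R.
have r0 : 0 <= r by exact: ler0n.
have r1 : r <= b%:R ^+ n by rewrite -natrX ler_nat ltnW// digits_val_lt.
have -> : (b%:R ^+ n * (digits_val b s M)%:R + r) / (b%:R ^+ M * b%:R ^+ n) =
    (digits_val b s M)%:R / b%:R ^+ M + r / b%:R ^+ n * (b%:R ^+ M)^-1.
  by field; rewrite !(natrX_neq0 R b_gt1).
have M0 : 0 <= (b%:R ^+ M)^-1 :> R by rewrite invr_ge0 ltW// natrX_gt0.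
rewrite lerDl lerD2l mulr_ge0 ?divr_ge0 ?(ltW (natrX_gt0 _ _ _))//=.
by rewrite ler_piMl// ler_pdivrMr ?natrX_gt0// mul1r.
Qed.

Lemma cvg_digit_series s :
  cvgn (series (fun k : nat => (s k)%:R / b%:R ^+ k.+1 : R)).
Proof.
apply: nondecreasing_is_cvgn.
  move=> m n mn; rewrite !series_digits.
  by have /andP[] := low_end_first_digits s mn.
exists 1 => _ [n _ <-]; rewrite series_digits.
have [_ l1] := low_end_itv R b_gt1 (first_digits n s).
by apply: le_trans l1; rewrite lerDl invr_ge0 ltW// natrX_gt0.
Qed.

(** The upper inequality cannot be strict: a tail of digits all equal to b - 1 carries the sum to
    the right end of the cell. *)
Lemma digit_sum_itv s M :
  low_end R b_gt1 (first_digits M s) <= digit_sum s <=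
  low_end R b_gt1 (first_digits M s) + (b%:R ^+ M)^-1.
Proof.
apply/andP; split.
  apply: limr_ge; first exact: cvg_digit_series.
  near=> n; rewrite series_digits.
  have Mn : (M <= n)%N by near: n; exact: nbhs_infty_ge.
  by have /andP[] := low_end_first_digits s Mn.
apply: limr_le; first exact: cvg_digit_series.
near=> n; rewrite series_digits.
have Mn : (M <= n)%N by near: n; exact: nbhs_infty_ge.
by have /andP[] := low_end_first_digits s Mn.
Unshelve. all: by end_near. Qed.

Lemma cvg_invX : (fun n => (b%:R ^+ n)^-1 : R) @ \oo --> (0 : R).
Proof.
have : `|b%:R^-1| < 1 :> R.
  by rewrite ger0_norm// invf_lt1 ?ltr0n// ltr1n.
move=> /cvg_expr; have -> // : (fun n => (b%:R ^+ n)^-1 : R) = GRing.exp (b%:R^-1).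
by apply/funext => n; rewrite exprVn.
Qed.

Lemma cvg_midpoint s :
  midpoint R b_gt1 (first_digits n s) @[n --> \oo] --> digit_sum s.
Proof.
apply/cvgrPdist_le => e e0.
have : \forall n \near \oo, (b%:R ^+ n)^-1 <= e :> R.
  exact: (cvgr_le 0 cvg_invX).
apply: filterS => n; apply: le_trans.
have /andP[] := digit_sum_itv s n; rewrite /midpoint.
have : 0 < (b%:R ^+ n)^-1 :> R by rewrite invr_gt0 natrX_gt0.
move: (low_end _ _ _) (_^-1) (digit_sum s) => l h u h0 h1 h2.
by rewrite ler_norml; apply/andP; split; lra.
Qed.

Lemma digit_sum01 s : 0 <= digit_sum s <= 1.
Proof.
have /andP[h1 h2] := digit_sum_itv s 0.
have [l0 l1] := low_end_itv R b_gt1 (first_digits 0 s).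
by rewrite (le_trans l0 h1) (le_trans h2 l1).
Qed.

Lemma low_endK M (y : {ffun 'I_M -> 'I_b}) : cell b_gt1 M (low_end R b_gt1 y) = y.
Proof.
have [l0 l1] := low_end_itv R b_gt1 y.
have h0 : 0 < (b%:R ^+ M)^-1 :> R by rewrite invr_gt0 natrX_gt0.
apply/eqP; rewrite cellP ?lexx ?ltrDl//.
by rewrite l0 (lt_le_trans _ l1)// ltrDl.
Qed.

(* The right-hand cells are those adjacent to 0 and 1; their probability tends to 0,
   so that scrambled points avoid the boundary almost surely. *)
Lemma digit_sum_boundary s M : ~~ (0 < digit_sum s < 1) ->
  first_digits M s = cell b_gt1 M (0 : R) \/
  first_digits M s = cell b_gt1 M (1 - (b%:R ^+ M)^-1 : R).
Proof.
have /andP[u0 u1] := digit_sum01 s; have /andP[h1 h2] := digit_sum_itv s M.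
have [l0 l1] := low_end_itv R b_gt1 (first_digits M s).
rewrite negb_and -!leNgt => /orP[h|h].
  left; rewrite -[LHS]low_endK; congr cell; apply/eqP.
  by rewrite eq_le l0 (le_trans h1).
right; rewrite -[LHS]low_endK; congr cell; apply/eqP.
by rewrite eq_le lerBrDr l1 lerBlDr (le_trans h).
Qed.

End digit_series.

Lemma cvg_col (R : realType) d (T : Type) (F : set_system T) {FF : Filter F}
    (f : T -> 'I_d -> R) (z : 'cV[R]_d) :
  (forall l, f n l @[n --> F] --> z l 0) -> (\col_l f n l) @[n --> F] --> z.
Proof.
move=> fz; apply/cvg_ballP => e e0.
have : \forall n \near F, forall l, ball (z l 0) e (f n l).
  apply: filter_forall => l; exact: (cvg_ball (fz l)).
apply: filterS => n h; split => // i j; rewrite !mxE (ord1 j); exact: h.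
Qed.

Lemma limn_einf_le_cst (R : realType) (v : nat -> \bar R) (c : \bar R) :
  (forall n, (v n <= c)%E) -> (limn_einf v <= c)%E.
Proof.
move=> vc; rewrite limn_einf_lim; apply: lime_le; first exact: is_cvg_einfs.
by apply: nearW => n; apply: (le_trans _ (vc n)); apply: ereal_inf_lbound; exists n => /=.
Qed.

Section scrambled_mse.
Variables (R : realType) (disp : measure_display) (Omega : measurableType disp).
Variables (P : probability Omega R) (d b : nat).
Hypothesis b_gt1 : (1 < b)%N.
Let b_gt0 := ltnW b_gt1.
Variable perms : Omega -> 'I_d -> seq 'I_b -> {perm 'I_b}.
Hypothesis permsP : uniform_independent_perms P perms.
Variables (N : nat) (a : 'I_N -> 'cV[R]_d).

Let u w i := scramble b_gt1 (perms w) (a i).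

Definition scrambled_digit w i l (k : nat) : 'I_b :=
  perms w l [seq digit b_gt1 (a i l 0) n | n <- iota 0 k]
    (digit b_gt1 (a i l 0) k).

Lemma scrambleE w i l : u w i l 0 = digit_sum R (scrambled_digit w i l).
Proof. by rewrite mxE. Qed.

Lemma scrambled_net_digits M w i l :
  scrambled_net b_gt1 a (finite_perms perms M w) i l =
  first_digits M (scrambled_digit w i l).
Proof.
apply/ffunP => k; rewrite !ffunE /= /scrambled_digit; congr (perms w l _ _).
have -> : iota 0 k = [seq val j | j <- take k (enum 'I_M)].
  by rewrite map_take val_enum_ord take_iota (minn_idPl (ltnW (ltn_ord k))).
by rewrite val_digit_prefix -map_comp; apply: eq_map => j; rewrite !ffunE.
Qed.

Let measurable_finite_valued_perms M (T' : finType) 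
    (g : {ffun 'I_d * {bseq M of 'I_b} -> {perm 'I_b}} -> T') (y : T') :
  measurable [set w | g (finite_perms perms M w) = y].
Proof.
have -> : [set w | g (finite_perms perms M w) = y] =
    \bigcup_(x in [set x | g x = y]) [set w | finite_perms perms M w = x].
  by apply/seteqP; split=> [w gw|w [x /= gx wx]]; [exists (finite_perms perms M w)|rewrite /= wx].
apply: fin_bigcup_measurable => [|x _]; first exact: finite_finset.
exact: (measurable_finite_perms permsP).
Qed.

Lemma measurable_scramble i l : measurable_fun setT (fun w => u w i l 0).
Proof.
apply: (@measurable_fun_cvg _ _ _ _
  (fun n w => low_end R b_gt1 (first_digits n (scrambled_digit w i l)))).
  move=> n; have := @measurable_finite_valued _ _ _ (finite_perms perms n)
    (measurable_finite_perms permsP (M := n)) _ (measurableTypeR R)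
    (fun x => low_end R b_gt1 (scrambled_net b_gt1 a x i l)).
  by apply: eq_measurable_fun => w _; rewrite scrambled_net_digits.
move=> w _; rewrite scrambleE.
under eq_fun do rewrite -series_digits.
exact: cvg_digit_series.
Qed.

Lemma prob_first_digits M i l (y : {ffun 'I_M -> 'I_b}) :
  P [set w | first_digits M (scrambled_digit w i l) = y] = ((b%:R ^+ M)^-1)%:E.
Proof.
pose g (x : {ffun 'I_d * {bseq M of 'I_b} -> {perm 'I_b}}) :=
  scrambled_net b_gt1 a x i l.
have -> : [set w | first_digits M (scrambled_digit w i l) = y] =
    [set w | g (finite_perms perms M w) = y].
  by apply/seteqP; split => w /=; rewrite /g scrambled_net_digits.
have mA : measurable [set w | g (finite_perms perms M w) = y].
  exact: measurable_finite_valued_perms.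
transitivity (\int[P]_w (\1_[set w | g (finite_perms perms M w) = y] w)%:E)%E.
  by rewrite integral_indic// setIT.
transitivity (\int[P]_w ((g (finite_perms perms M w) == y)%:R%:E : \bar R))%E.
  apply: eq_integral => w _; rewrite indicE.
  by case: eqP => e; [rewrite mem_set|rewrite memNset].
rewrite (integral_finite_perms permsP (g := fun x => (g x == y)%:R))//; congr EFin.
rewrite (finite_scramble_uniform (digits b_gt1 M (a i)) (fun z => (z l == y)%:R : R)).
rewrite mulrA mulKf; last first.
  by rewrite pnatr_eq0 -lt0n; apply/card_gt0P; exists [ffun=> 1%g].
transitivity (\prod_(l' < d) if l' == l then (b%:R ^+ M)^-1 else 1 : R); last first.
  by rewrite -big_mkcond big_pred1_eq.
have -> : (#|{: {ffun 'I_d -> {ffun 'I_M -> 'I_b}}}|%:R)^-1 =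
    \prod_(l' < d) (b%:R ^+ M)^-1 :> R.
  by rewrite prodr_const card_ord card_digits natrX exprM exprVn.
have -> : \sum_(z : {ffun 'I_d -> {ffun 'I_M -> 'I_b}}) (z l == y)%:R =
    \sum_(z : {ffun 'I_d -> {ffun 'I_M -> 'I_b}})
      \prod_l' (if l' == l then (z l' == y)%:R else 1 : R).
  by apply: eq_bigr => z _; rewrite -big_mkcond big_pred1_eq.
rewrite -(bigA_distr_bigA (fun l' (x : {ffun 'I_M -> 'I_b}) => if l' == l then (x == y)%:R else 1)).
rewrite -big_split /=; apply: eq_bigr => l' _; case: eqP => _.
  rewrite (bigD1 y)//= eqxx big1 ?addr0 ?mulr1// => x /negbTE -> //.
rewrite sumr_const card_ffun !card_ord natrX mulVf//.
exact: natrX_neq0.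
Qed.

Lemma boundary_null i l : P [set w | ~~ (0 < u w i l 0 < 1)] = 0%E.
Proof.
have mB : measurable [set w | ~~ (0 < u w i l 0 < 1)].
  rewrite (_ : mkset _ = ~` ((fun w => u w i l 0) @^-1` `]0, 1[)).
    by apply: measurableC; rewrite -[X in measurable X]setTI;
      apply: measurable_scramble => //; exact: measurable_itv.
  by apply/seteqP; split => w /=; rewrite in_itv/= => /negP.
apply/eqP; rewrite eq_le measure_ge0 andbT; apply/lee_addgt0Pr => e e0.
rewrite add0e.
have : \forall n \near \oo, (b%:R ^+ n)^-1 <= e / 2 :> R.
  have e2 : 0 < e / 2 by rewrite divr_gt0.
  exact: (cvgr_le 0 (cvg_invX b_gt1) _ e2).
move/filter_ex => [M hM].
pose S y := [set w | first_digits M (scrambled_digit w i l) = y].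
have mS y : measurable (S y).
  rewrite (_ : S y = [set w | scrambled_net b_gt1 a (finite_perms perms M w) i l = y]).
    exact: (measurable_finite_valued_perms (fun x => scrambled_net b_gt1 a x i l)).
  by apply/seteqP; split => w /=; rewrite scrambled_net_digits.
pose y0 := cell b_gt1 M (0 : R); pose y1 := cell b_gt1 M (1 - (b%:R ^+ M)^-1 : R).
apply: (@le_trans _ _ (P (S y0 `|` S y1))).
  apply: le_measure; rewrite ?inE//; first exact: measurableU.
  by move=> w /=; rewrite scrambleE => /(digit_sum_boundary b_gt1 M).
have h2 : (P (S y0 `|` S y1) <= P (S y0) + P (S y1))%E by exact: measureU2.
apply: (le_trans h2).
rewrite !prob_first_digits -EFinD lee_fin; lra.
Qed.

(* The value 0 on the null boundary event matches the junk value of [Phi_inv], so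
   that convergence holds everywhere. *)
Definition good_cell_vector M w i : 'cV[R]_d :=
  \col_l if 0 < u w i l 0 < 1
         then cell_point R b_gt1 (first_digits M (scrambled_digit w i l)) else 0.

Lemma cvg_good_cell_vector w i :
  good_cell_vector M w i @[M --> \oo] --> map_mx (@Phi_inv R) (u w i).
Proof.
apply: cvg_col => l.
have -> : map_mx (@Phi_inv R) (u w i) l 0 = Phi_inv (u w i l 0) by rewrite [LHS]mxE.
have [u01|u01] := boolP (0 < u w i l 0 < 1); last first.
  by rewrite Phi_inv_out//; exact: cvg_cst.
have h : midpoint R b_gt1 (first_digits n (scrambled_digit w i l)) @[n --> \oo]
    --> digit_sum R (scrambled_digit w i l) by exact: cvg_midpoint.
rewrite -scrambleE in h.
exact: (cvg_comp _ _ h (Phi_inv_continuous u01)).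
Qed.

(** Finitely many values occur, determined by the permutations of bounded depth and by the set of
    coordinates lying in ]0, 1[. *)
Lemma measurable_good_cell_vector (H : 'cV[R]_d -> R) M i :
  measurable_fun setT (fun w => H (good_cell_vector M w i)).
Proof.
pose Y w : {ffun 'I_d * {bseq M of 'I_b} -> {perm 'I_b}} * {ffun 'I_d -> bool} :=
  (finite_perms perms M w, [ffun l => 0 < u w i l 0 < 1]).
have mY y : measurable [set w | Y w = y].
  have -> : [set w | Y w = y] = [set w | finite_perms perms M w = y.1] `&`
      \bigcap_(l in [set: 'I_d]) [set w | (0 < u w i l 0 < 1) = y.2 l].
    apply/seteqP; split=> w /=; first by move=> <-; split=> // l _ /=; rewrite ffunE.
    by case: y => y1 y2 /= [<- h]; congr (_, _); apply/ffunP => l; rewrite ffunE; exact: h.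
  apply: measurableI; first exact: (measurable_finite_perms permsP).
  apply: fin_bigcap_measurable => [|l _]; first exact: finite_finset.
  have m1 : measurable ((fun w => u w i l 0) @^-1` `]0, 1[).
    by rewrite -[X in measurable X]setTI; apply: measurable_scramble => //; exact: measurable_itv.
  case: (y.2 l).
    by rewrite (_ : mkset _ = (fun w => u w i l 0) @^-1` `]0, 1[)//;
      apply/seteqP; split=> w /=; rewrite in_itv/=.
  rewrite (_ : mkset _ = ~` ((fun w => u w i l 0) @^-1` `]0, 1[)).
    exact: measurableC.
  apply/seteqP; split=> w /=; rewrite in_itv/=; first by move=> ->.
  by move=> /negP/negbTE.
have := measurable_finite_valued mY (fun y => H (\col_l if y.2 l
  then cell_point R b_gt1 (scrambled_net b_gt1 a y.1 i l) else 0)).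
apply: eq_measurable_fun => w _; congr H; apply/colP => l.
by rewrite [LHS]mxE [RHS]mxE ffunE scrambled_net_digits.
Qed.

Lemma good_cell_vectorE M w i : (forall l, 0 < u w i l 0 < 1) ->
  good_cell_vector M w i =
  cell_vector R b_gt1 (scrambled_net b_gt1 a (finite_perms perms M w) i).
Proof.
by move=> u01; apply/colP => l; rewrite [LHS]mxE [RHS]mxE u01 scrambled_net_digits.
Qed.

Lemma good_cell_vector_ae M : {ae P, forall w, forall i,
  good_cell_vector M w i =
  cell_vector R b_gt1 (scrambled_net b_gt1 a (finite_perms perms M w) i)}.
Proof.
apply: filter_forall => i.
have : {ae P, forall w, forall l, 0 < u w i l 0 < 1}.
  apply: filter_forall => l.
  exists [set w | ~~ (0 < u w i l 0 < 1)]; split.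
  - rewrite (_ : mkset _ = ~` ((fun w => u w i l 0) @^-1` `]0, 1[)).
      by apply: measurableC; rewrite -[X in measurable X]setTI;
        apply: measurable_scramble => //; exact: measurable_itv.
    by apply/seteqP; split => w /=; rewrite in_itv/= => /negP.
  - exact: boundary_null.
  - by move=> w /= /negP.
by apply: filterS => w; exact: good_cell_vectorE.
Qed.

Lemma scrambled_mse (H : 'cV[R]_d -> R) (avg : nat -> R) (C V : R) (M0 : nat) :
  continuous H -> avg n @[n --> \oo] --> C ->
  (forall M, (M0 <= M)%N ->
    (#|{: {ffun 'I_d * {bseq M of 'I_b} -> {perm 'I_b}}}|%:R)^-1 *
    \sum_(x : {ffun 'I_d * {bseq M of 'I_b} -> {perm 'I_b}})
      (\sum_i H (cell_vector R b_gt1 (scrambled_net b_gt1 a x i)) - N%:R * avg M) ^+ 2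
    <= V) -> (0 < N)%N ->
  (\int[P]_w ((I_hat (u w) H - C) ^+ 2)%:E <= (N%:R ^- 2 * V)%:E)%E.
Proof.
move=> cH avgC hV N0.
pose e M w := N%:R^-1 * \sum_i H (good_cell_vector M w i) - avg M.
pose f n w : \bar R := ((e (M0 + n)%N w) ^+ 2)%:E.
have me M : measurable_fun setT (e M).
  apply: measurable_funB => //; apply: measurable_funM => //.
  apply: measurable_sum => i; exact: measurable_good_cell_vector.
have mf n : measurable_fun setT (f n).
  by apply/measurable_EFinP; apply: measurable_funX.
have f0 n w : setT w -> (0 <= f n w)%E by move=> _; rewrite lee_fin sqr_ge0.
have ecvg w : e M w @[M --> \oo] --> I_hat (u w) H - C.
  apply: cvgB; last exact: avgC.
  apply: cvgM; first exact: cvg_cst.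
  apply: cvg_big => [|i _]; first exact: add_continuous.
  exact: (cvg_comp _ _ (@cvg_good_cell_vector w i) (cH _)).
have fcvg w : f n w @[n --> \oo] --> ((I_hat (u w) H - C) ^+ 2)%:E.
  apply: cvg_EFin; first exact: nearW.
  have := ecvg w; rewrite -(cvg_shiftn M0) => h.
  under eq_fun do rewrite /f /= addnC.
  rewrite expr2; exact: (cvgM h h).
have := fatou P measurableT mf f0.
rewrite (eq_integral (fun w => ((I_hat (u w) H - C) ^+ 2)%:E)); last first.
  move=> w _; have fw := fcvg w.
  by rewrite is_cvg_limn_einfE; [exact: cvg_lim fw|exact: cvgP fw].
move/le_trans; apply; apply: limn_einf_le_cst => n.
set M := (M0 + n)%N.
pose F (x : {ffun 'I_d * {bseq M of 'I_b} -> {perm 'I_b}}) :=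
  (N%:R^-1 * \sum_i H (cell_vector R b_gt1 (scrambled_net b_gt1 a x i)) - avg M) ^+ 2.
(* Almost surely no scrambled coordinate is 0 or 1, and the expectation becomes an average over the
   finite type of permutations. *)
have -> : (\int[P]_w f n w = \int[P]_w (F (finite_perms perms M w))%:E)%E.
  apply: ge0_ae_eq_integral => //.
  - apply/measurable_EFinP.
    exact: (@measurable_finite_valued _ _ _ (finite_perms perms M)
      (measurable_finite_perms permsP (M := M)) _ (measurableTypeR R) F).
  - by move=> w _; rewrite lee_fin sqr_ge0.
  - by move=> w _; rewrite lee_fin sqr_ge0.
  - have [A [mA PA0 sub]] := good_cell_vector_ae M; exists A; split => //.
    move=> w /= nfF; apply: sub => /= h; apply: nfF => _.
    rewrite /f /e /F -/M; congr ((_ * _ - _) ^+ 2)%:E.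
    by apply: eq_bigr => i _; rewrite h.
rewrite (integral_finite_perms permsP) ?lee_fin; last by move=> x; exact: sqr_ge0.
have Nn0 : N%:R != 0 :> R by rewrite pnatr_eq0 -lt0n.
have -> : \sum_x F x = N%:R ^- 2 * \sum_(x : {ffun 'I_d * {bseq M of 'I_b} -> {perm 'I_b}})
      (\sum_i H (cell_vector R b_gt1 (scrambled_net b_gt1 a x i)) - N%:R * avg M) ^+ 2.
  rewrite mulr_sumr; apply: eq_bigr => x _; rewrite /F.
  by move: (\sum_i _) => S; field.
rewrite mulrCA ler_wpM2l ?invr_ge0 ?exprn_ge0//.
by apply: hV; rewrite leq_addr.
Qed.

End scrambled_mse.

(** * Integration over R^d *)

Section tuple_integrals.
Variable R : realType.
Local Notation mR := (measurableTypeR R).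
Local Notation leb := (@lebesgue_measure R).

Definition colt n (x : n.-tuple mR) : 'cV[R]_n := \col_i tnth x i.

Lemma measurable_cons_pair n : measurable_fun setT (@cons_pair R n).
Proof. exact: measurable_cons. Qed.

Lemma integral_lebesgue_cons n (f : n.+1.-tuple mR -> \bar R) :
  measurable_fun setT f -> (forall x, (0 <= f x)%E) ->
  (\int[lebesgue_tuple n.+1]_x f x =
   \int[leb]_x \int[lebesgue_tuple n]_t f (cons_pair (x, t)))%E.
Proof.
move=> mf f0.
transitivity (\int[leb \x lebesgue_tuple n]_p (f \o @cons_pair R n) p)%E.
  rewrite [LHS](ge0_integral_pushforward (@measurable_cons_pair n)
    (leb \x lebesgue_tuple n)%E)//.
have mfc : measurable_fun setT (f \o @cons_pair R n).
  exact: (measurableT_comp mf (@measurable_cons_pair n)).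
have fc0 p : (0 <= (f \o @cons_pair R n) p)%E by exact: f0.
by rewrite (fubini_tonelli1 _ mfc fc0).
Qed.

Lemma integral_lebesgue_consC n (f : n.+1.-tuple mR -> \bar R) :
  measurable_fun setT f -> (forall x, (0 <= f x)%E) ->
  (\int[lebesgue_tuple n.+1]_x f x =
   \int[lebesgue_tuple n]_t \int[leb]_x f (cons_pair (x, t)))%E.
Proof.
move=> mf f0; rewrite integral_lebesgue_cons//.
have mfc : measurable_fun setT (f \o @cons_pair R n).
  exact: (measurableT_comp mf (@measurable_cons_pair n)).
have fc0 p : (0 <= (f \o @cons_pair R n) p)%E by exact: f0.
exact: (fubini_tonelli _ mfc fc0).
Qed.

Lemma tnth_cons_pair n x (t : n.-tuple mR) (i : 'I_n.+1) :
  tnth (cons_pair (x, t)) i = if unlift ord0 i is Some j then tnth t j else x.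
Proof.
by case: unliftP => [j|] ->; rewrite ?tnthS ?tnth0.
Qed.

Lemma integral_prod_tuple n (f : 'I_n -> R -> R) :
  (forall i, measurable_fun setT (f i)) -> (forall i x, 0 <= f i x) ->
  (\int[lebesgue_tuple n]_x (\prod_i f i (tnth x i))%:E =
   \prod_i \int[leb]_x (f i x)%:E)%E.
Proof.
elim: n => [|n IHn] in f * => mf f0.
  rewrite big_ord0; under eq_integral do rewrite big_ord0.
  by rewrite /= integral_dirac//= diracE in_setT mul1e.
have mtn (k : nat) (g : 'I_k -> R -> R) : (forall i, measurable_fun setT (g i)) ->
    measurable_fun setT (fun x : k.-tuple mR => \prod_i g i (tnth x i)).
  move=> mg; apply: measurable_prod => i _.
  exact: (measurableT_comp (mg i) (measurable_tnth i)).
rewrite integral_lebesgue_cons.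
- rewrite big_ord_recl -IHn//.
  under eq_integral.
    move=> x _.
    under eq_integral.
      move=> t _; rewrite big_ord_recl tnth_cons_pair unlift_none EFinM.
      under eq_bigr do rewrite tnth_cons_pair liftK.
      over.
    rewrite ge0_integralZl_EFin//; last 2 first.
    - by move=> t _; rewrite lee_fin prodr_ge0.
    - by apply/measurable_EFinP; apply: (mtn _ (fun i => f (lift ord0 i))).
    over.
  rewrite ge0_integralZr//.
  + by apply/measurable_EFinP; exact: mf.
  + by move=> x _; rewrite lee_fin.
  + by apply: integral_ge0 => t _; rewrite lee_fin prodr_ge0.
- by apply/measurable_EFinP; exact: mtn.
- by move=> x; rewrite lee_fin prodr_ge0.
Qed.

End tuple_integrals.

Section cell_discretization.
Variables (R : realType) (b d : nat).
Hypothesis b_gt1 : (1 < b)%N.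
Let b_gt0 := ltnW b_gt1.
Local Notation mR := (measurableTypeR R).
Local Notation leb := (@lebesgue_measure R).

Definition tuple_cell M (x : d.-tuple mR) : {ffun 'I_d -> {ffun 'I_M -> 'I_b}} :=
  [ffun l => cell b_gt1 M (Phi (tnth x l : R))].

Lemma tuple_cellE M y : [set x | tuple_cell M x = y] =
  [set x | forall l, [set z : R | cell b_gt1 M (Phi z) = y l] (tnth x l)].
Proof.
apply/seteqP; split=> x /=; first by move=> <- l; rewrite ffunE.
by move=> h; apply/ffunP => l; rewrite ffunE; exact: h.
Qed.

Lemma measurable_tuple_cell M y : measurable [set x | tuple_cell M x = y].
Proof.
rewrite tuple_cellE.
rewrite (_ : mkset _ = \bigcap_(l in [set: 'I_d])
    ((@tnth _ mR ^~ l) @^-1` [set z : R | cell b_gt1 M (Phi z) = y l])); last first.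
  by apply/seteqP; split=> [x h l _|x h l]; [exact: h|exact: h].
apply: fin_bigcap_measurable => [|l _]; first exact: finite_finset.
rewrite -[X in measurable X]setTI; apply: measurable_tnth => //.
exact: measurable_cell.
Qed.

Lemma cvg_cell_point (z : R) :
  cell_point R b_gt1 (cell b_gt1 n (Phi z)) @[n --> \oo] --> z.
Proof.
have h : midpoint R b_gt1 (cell b_gt1 n (Phi z)) @[n --> \oo] --> Phi z.
  apply/cvgrPdist_le => e e0.
  have : \forall n \near \oo, (b%:R ^+ n)^-1 <= e :> R.
    exact: (cvgr_le 0 (cvg_invX b_gt1)).
  apply: filterS => n; apply: le_trans.
  have := eqxx (cell b_gt1 n (Phi z)); rewrite cellP ?Phi_itv0//.
  have : 0 < (b%:R ^+ n)^-1 :> R by rewrite invr_gt0 natrX_gt0.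
  rewrite /midpoint; move: (low_end R b_gt1 (cell b_gt1 n (Phi z))) ((b%:R ^+ n)^-1) (Phi z).
  move=> l h u h0 /andP[h1 h2].
  by rewrite ler_norml; apply/andP; split; lra.
rewrite -[X in _ --> X]PhiK.
exact: (cvg_comp _ _ h (Phi_inv_continuous (Phi_itv z))).
Qed.

Lemma cvg_tuple_cell (x : d.-tuple mR) :
  cell_vector R b_gt1 (tuple_cell n x) @[n --> \oo] --> colt x.
Proof.
apply: cvg_col => l; under eq_fun do rewrite ffunE.
by rewrite mxE; exact: cvg_cell_point.
Qed.

(** Measurability lives on tuples and continuity on column vectors; cell discretizations connect
    them, H being a pointwise limit of functions with finitely many values. *)
Lemma measurable_continuous_colt (H : 'cV[R]_d -> R) : continuous H ->
  measurable_fun setT (fun x : d.-tuple mR => H (colt x)).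
Proof.
move=> cH; apply: (@measurable_fun_cvg _ _ _ _
  (fun n x => H (cell_vector R b_gt1 (tuple_cell n x)))).
  move=> n; exact: (@measurable_finite_valued _ _ _ (tuple_cell n)
    (@measurable_tuple_cell n) _ (measurableTypeR R)
    (fun y => H (cell_vector R b_gt1 y))).
by move=> x _; exact: (cvg_comp _ _ (@cvg_tuple_cell x) (cH _)).
Qed.

Definition gauss_weight (x : d.-tuple mR) : R := \prod_(l < d) normal_pdf 0 1 (tnth x l).

Lemma gauss_weight_ge0 x : 0 <= gauss_weight x.
Proof. by apply: prodr_ge0 => l _; exact: normal_pdf_ge0. Qed.

Lemma measurable_gauss_weight : measurable_fun setT gauss_weight.
Proof.
apply: measurable_prod => l _.
exact: (measurableT_comp (measurable_normal_pdf 0 1) (measurable_tnth l)).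
Qed.

Lemma integral_tuple_cell M y :
  (\int[lebesgue_tuple d]_(x in [set x | tuple_cell M x = y]) (gauss_weight x)%:E =
   (((b%:R ^+ M)^-1) ^+ d)%:E)%E.
Proof.
pose A l := [set z : R | cell b_gt1 M (Phi z) = y l].
have mA l : measurable (A l) by exact: measurable_cell.
rewrite integral_mkcond /=.
transitivity (\int[lebesgue_tuple d]_x
    (\prod_l (normal_pdf 0 1 (tnth x l) * \1_(A l) (tnth x l)))%:E)%E.
  apply: eq_integral => x _; rewrite patchE big_split /= EFinM.
  have [/set_mem xy|xy] := boolP (x \in [set x | tuple_cell M x = y]).
    rewrite [X in (_ * X)%E](_ : _ = 1%E) ?mule1//; congr EFin.
    apply: big1 => l _; rewrite indicE mem_set// /A /=.
    by rewrite -xy ffunE.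
  have [l xl] : exists l, cell b_gt1 M (Phi (tnth x l : R)) != y l.
    apply/existsP; rewrite -negb_forall; apply: contra xy => /forallP h.
    by rewrite inE /=; apply/ffunP => l; rewrite ffunE; apply/eqP.
  rewrite [X in (_ * X)%E](_ : _ = 0%E) ?mule0//; congr EFin.
  by rewrite (bigD1 l)//= indicE memNset ?mul0r// /A /=; exact/eqP.
rewrite (integral_prod_tuple (f := fun l z => normal_pdf 0 1 z * \1_(A l) z)).
- transitivity (\prod_(l < d) ((b%:R ^+ M)^-1)%:E : \bar R)%E; last first.
    by rewrite prodEFin prodr_const card_ord.
  apply: eq_bigr => l _; rewrite -(normal_prob_cell R b_gt1 (y l)).
  rewrite /normal_prob [RHS]integral_mkcond; apply: eq_integral => z _.
  rewrite patchE indicE; case: (z \in A l) => /=; by rewrite ?mulr1 ?mulr0.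
- move=> l; apply: measurable_funM; first exact: measurable_normal_pdf.
  exact: measurable_indic.
- by move=> l z; rewrite mulr_ge0 ?normal_pdf_ge0.
Qed.

Lemma integral_tail_weight (B : R) : 0 < B < 1 ->
  (lebesgue_tuple d).-integrable setT
    (fun x => (tail_weight B (colt x) * gauss_weight x)%:E).
Proof.
move=> B01.
have m1 : measurable_fun setT (fun z : R => tail z `^ (- B)).
  apply: (@measurableT_comp _ _ _ _ _ _ (fun u : R => u `^ (- B))) => //.
  by apply: continuous_measurable_fun; exact: tail_continuous.
have m2 : measurable_fun setT (fun z : R => tail z `^ (- B) * normal_pdf 0 1 z).
  by apply: measurable_funM => //; exact: measurable_normal_pdf.
have E x : tail_weight B (colt x) * gauss_weight x =
    \prod_(l < d) (tail (tnth x l : R) `^ (- B) * normal_pdf 0 1 (tnth x l : R)).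
  rewrite /tail_weight /gauss_weight -big_split /=; apply: eq_bigr => l _.
  by rewrite /colt mxE.
under eq_fun do rewrite E.
apply/integrableP; split.
  apply/measurable_EFinP; apply: measurable_prod => l _.
  exact: (measurableT_comp m2 (measurable_tnth l)).
have p0 (z : R) : 0 <= tail z `^ (- B) * normal_pdf 0 1 z.
  by rewrite mulr_ge0 ?powR_ge0 ?normal_pdf_ge0.
rewrite (eq_integral (fun x : d.-tuple mR => (\prod_(l < d)
    (tail (tnth x l : R) `^ (- B) * normal_pdf 0 1 (tnth x l : R)))%:E)); last first.
  move=> x _ /=; rewrite ger0_norm//.
  by apply: prodr_ge0 => l _; exact: p0.
rewrite (integral_prod_tuple (f := fun l z => tail z `^ (- B) * normal_pdf 0 1 z))//.
pose I := (\int[leb]_x (tail x `^ (- B) * normal_pdf 0 1 x)%:E)%E.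
have I0 : (0 <= I)%E by apply: integral_ge0 => x _; rewrite lee_fin.
have If : I \is a fin_num by rewrite ge0_fin_numE// integral_tail_powR.
rewrite (eq_bigr (fun=> (fine I)%:E)); last by move=> l _; rewrite fineK.
by rewrite prodEFin ltry.
Qed.

Lemma tail_weight_tuple_cell (B : R) M x : 0 <= B ->
  tail_weight B (cell_vector R b_gt1 (tuple_cell M x)) <=
  (2 `^ B) ^+ d * tail_weight B (colt x).
Proof.
move=> B0; rewrite /tail_weight.
rewrite -[d in _ ^+ d]card_ord -prodr_const -big_split /=.
apply: ler_prod => l _; rewrite powR_ge0 /= /cell_vector /colt [in leLHS]mxE [in leRHS]mxE ffunE.
set z : R := tnth x l; have h := tail_cell_point b_gt1 M z.
rewrite !powRN ler_pdivlMr ?powR_gt0 ?tail_gt0// mulrC ler_pdivrMr ?powR_gt0 ?tail_gt0//.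
rewrite -powRM ?(ltW (tail_gt0 _))//.
by apply: ge0_ler_powR; rewrite ?nnegrE ?mulr_ge0 ?(ltW (tail_gt0 _)).
Qed.

Lemma cvg_avg_cells (H : 'cV[R]_d -> R) (K B : R) : continuous H ->
  (forall z, 0 <= H z) -> 0 < B < 1 -> (forall z, H z <= K * tail_weight B z) ->
  (lebesgue_tuple d).-integrable setT (fun x => (H (colt x) * gauss_weight x)%:E) /\
  (#|{: {ffun 'I_d -> {ffun 'I_n -> 'I_b}}}|%:R)^-1 *
    \sum_(y : {ffun 'I_d -> {ffun 'I_n -> 'I_b}}) H (cell_vector R b_gt1 y)
  @[n --> \oo] --> \int[lebesgue_tuple d]_x (H (colt x) * gauss_weight x).
Proof.
move=> cH H0 B01 HK; have B0 : 0 <= B by case/andP: B01 => /ltW.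
pose F (n : nat) (x : d.-tuple mR) : \bar R :=
  (H (cell_vector R b_gt1 (tuple_cell n x)) * gauss_weight x)%:E.
have mF n : measurable_fun setT (F n).
  apply/measurable_EFinP; apply: measurable_funM; last exact: measurable_gauss_weight.
  exact: (@measurable_finite_valued _ _ _ (tuple_cell n)
    (@measurable_tuple_cell n) _ (measurableTypeR R)
    (fun y => H (cell_vector R b_gt1 y))).
have mf : measurable_fun setT (fun x => (H (colt x) * gauss_weight x)%:E).
  apply/measurable_EFinP; apply: measurable_funM; last exact: measurable_gauss_weight.
  exact: measurable_continuous_colt.
have Ff x : F n x @[n --> \oo] --> (H (colt x) * gauss_weight x)%:E.
  apply: cvg_EFin; first exact: nearW.
  apply: cvgM; last exact: cvg_cst.
  exact: (cvg_comp _ _ (@cvg_tuple_cell x) (cH _)).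
have K0 : 0 <= K.
  have := HK 0; have := H0 0; have := tail_weight_ge1 (0 : 'cV[R]_d) B0; nra.
(* Dominating function: moving each coordinate to the midpoint of its cell costs a factor at most
   2^B. *)
pose g (x : d.-tuple mR) : \bar R :=
  ((K * (2 `^ B) ^+ d)%:E * (tail_weight B (colt x) * gauss_weight x)%:E)%E.
have ig : (lebesgue_tuple d).-integrable setT g.
  by apply: integrableZl => //; exact: integral_tail_weight.
have Fg n x : (`|F n x| <= g x)%E.
  rewrite /F /g -EFinM lee_fin ger0_norm ?mulr_ge0 ?gauss_weight_ge0//.
  have aux (h t1 t2 c w k : R) : h <= k * t1 -> t1 <= c * t2 -> 0 <= w -> 0 <= k ->
      h * w <= k * c * (t2 * w).
    move=> h1 h2 w0 k0; rewrite mulrA ler_wpM2r// -mulrA (le_trans h1)//.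
    by rewrite ler_wpM2l.
  exact: (aux _ _ _ _ _ _ (HK _) (tail_weight_tuple_cell n x B0) (gauss_weight_ge0 x) K0).
have [] := @dominated_convergence _ _ _ (lebesgue_tuple d) _ measurableT F _ g mF mf.
- by apply: aeW => x _; exact: Ff.
- exact: ig.
- by apply: aeW => x n _; exact: Fg.
move=> intf _ cvgF; split => //.
pose avg (n : nat) := (#|{: {ffun 'I_d -> {ffun 'I_n -> 'I_b}}}|%:R)^-1 *
    \sum_(y : {ffun 'I_d -> {ffun 'I_n -> 'I_b}}) H (cell_vector R b_gt1 y).
have avgE n : (\int[lebesgue_tuple d]_x F n x = (avg n)%:E)%E.
  rewrite (integral_finite_valued (lebesgue_tuple d) (@measurable_tuple_cell n)
    (g := fun y => H (cell_vector R b_gt1 y)) measurable_gauss_weight gauss_weight_ge0)//.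
  rewrite (eq_bigr (fun y => (H (cell_vector R b_gt1 y) * ((b%:R ^+ n)^-1) ^+ d)%:E)).
    rewrite sumEFin -mulr_suml mulrC /avg card_digits natrX exprM exprVn.
    by rewrite [in RHS]mulrC mulrC.
  by move=> y _; rewrite integral_tuple_cell EFinM.
have c2 : (avg n)%:E @[n --> \oo] -->
    (fine (\int[lebesgue_tuple d]_x (H (colt x) * gauss_weight x)%:E))%:E.
  rewrite fineK; last exact: integrable_fin_num.
  by apply: cvg_trans cvgF; apply: near_eq_cvg; apply: nearW => n /=; rewrite avgE.
exact: (fine_cvg c2).
Qed.

End cell_discretization.

(** * Affine changes of variables *)

Section affine_substitution.
Variable R : realType.
Local Notation leb := (@lebesgue_measure R).
Implicit Types f : R -> R.

Lemma integral_reflection f : continuous f -> (forall x, 0 <= f x) ->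
  (\int[leb]_x (f (- x))%:E = \int[leb]_x (f x)%:E)%E.
Proof.
move=> cf f0.
have mf : measurable_fun [set: R] f by exact: continuous_measurable_fun.
have cg : continuous (fun x : R => f (- x)).
  by move=> x; apply: continuous_comp; [exact: opp_continuous|exact: cf].
have split0 (g : R -> R) : continuous g -> (forall x, 0 <= g x) ->
    (\int[leb]_x (g x)%:E = \int[leb]_(x in `[0%R, +oo[) (g x)%:E +
      \int[leb]_(x in `[0%R, +oo[) (g (- x))%:E)%E.
  move=> {}cg g0.
  have mg : measurable_fun [set: R] g by exact: continuous_measurable_fun.
  have mposnums : measurable [set x : R | 0 <= x]%R by rewrite -set_itvcy.
  rewrite -(setUv [set x : R | 0 <= x]%R) ge0_integral_setU//= ; last 4 first.
    exact: measurableC.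
    by apply/measurable_EFinP; rewrite setUv.
    by move=> x _; rewrite lee_fin.
    exact/disj_setPCl.
  rewrite -set_itvcy// setCitvr; congr (_ + _)%E.
  rewrite integral_itv_bndo_bndc; last exact/measurable_EFinP/measurable_funTS.
  by rewrite -{1}oppr0 ge0_integration_by_substitutionNy//; exact: continuous_subspaceT.
rewrite (split0 _ cg)// (split0 _ cf)// addeC; congr (_ + _)%E.
by apply: eq_integral => x _; rewrite opprK.
Qed.

Let integral_affine_pos f (a c : R) : 0 < a -> continuous f -> (forall x, 0 <= f x) ->
  (\int[leb]_x (f (a * x + c))%:E = a^-1%:E * \int[leb]_x (f x)%:E)%E.
Proof.
move=> a0 cf f0.
have d x : is_derive (x : R) 1 (fun x : R => a * x + c) a.
  rewrite -[X in is_derive _ _ _ X](_ : a *: 1 + 0 = a); last first.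
    by rewrite addr0 /GRing.scale/= mulr1.
  exact: is_deriveD.
have dE : (fun x : R => a * x + c)^`()%classic = cst a.
  by apply/funext => x; rewrite derive1E; exact: derive_val.
rewrite (@increasing_ge0_integration_by_substitutionT _ (fun x : R => a * x + c) f)//=.
- under [in RHS]eq_integral => x _ do rewrite /= dE /= [X in X%:E]mulrC EFinM.
  rewrite ge0_integralZl_EFin ?(ltW a0)//.
  + by rewrite muleA -EFinM mulVf ?mul1e// gt_eqF.
  + by move=> x _; rewrite lee_fin; exact: f0.
  + apply/measurable_EFinP; apply: continuous_measurable_fun => x.
    apply: (@continuous_comp _ _ _ (fun x : R => a * x + c) f); last exact: cf.
    by apply: differentiable_continuous; apply/derivable1_diffP; have [] := d x.
- by move=> x y xy; rewrite ltrD2r ltr_pM2l.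
- by rewrite dE => x; exact: cvg_cst.
- by rewrite dE; apply: is_cvg_cst.
- by rewrite dE; apply: is_cvg_cst.
- apply/cvgrNyPle => A; near=> x.
  rewrite -lerBrDr -ler_pdivlMl//; near: x.
- apply/cvgryPge => A; near=> x.
  rewrite -lerBlDr -ler_pdivrMl//; near: x.
Unshelve. all: by end_near. Qed.

Lemma integral_affine f (a c : R) : a != 0 -> continuous f -> (forall x, 0 <= f x) ->
  (\int[leb]_x (f (a * x + c))%:E = \int[leb]_x (`|a|^-1 * f x)%:E)%E.
Proof.
move=> a0 cf f0; under [RHS]eq_integral do rewrite EFinM.
rewrite ge0_integralZl_EFin ?invr_ge0//; last 2 first.
- by move=> x _; rewrite lee_fin.
- by apply/measurable_EFinP; exact: continuous_measurable_fun.
have [a_lt0|a_gt0|/eqP] := ltgtP a 0; last by rewrite (negPf a0).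
- rewrite ltr0_norm// -(@integral_affine_pos f (- a) c) ?oppr_gt0//.
  rewrite -(@integral_reflection (fun x => f (a * x + c)))//; last first.
    move=> x; apply: (@continuous_comp _ _ _ (fun x : R => a * x + c) f); last exact: cf.
    by apply: cvgD; [apply: cvgM; [exact: cvg_cst|exact: cvg_id]|exact: cvg_cst].
  by apply: eq_integral => x _; rewrite mulrN mulNr.
- by rewrite gtr0_norm// integral_affine_pos.
Qed.

End affine_substitution.

Section linear_substitution.
Variable R : realType.
Local Notation mR := (measurableTypeR R).
Local Notation leb := (@lebesgue_measure R).

Definition integral_colt n (h : 'cV[R]_n -> R) : \bar R :=
  \int[lebesgue_tuple n]_x (h (colt x))%:E.

Lemma measurable_colt n (h : 'cV[R]_n -> R) : continuous h ->
  measurable_fun setT (fun x : n.-tuple mR => (h (colt x))%:E).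
Proof.
(* The base of the discretization is free; 2 is one choice. *)
by move=> ch; apply/measurable_EFinP; exact: (@measurable_continuous_colt R 2 n isT h ch).
Qed.

Lemma continuous_affine_mx n p (A : 'M[R]_(n, p)) (c : 'cV[R]_n) :
  continuous (fun z : 'cV[R]_p => A *m z + c).
Proof.
move=> z; rewrite /continuous_at.
rewrite (_ : (fun z => _) = (fun z : 'cV[R]_p => \col_i (\sum_j A i j * z j 0 + c i 0))).
  apply: (@cvg_col _ _ _ (nbhs z)) => i; rewrite !mxE; apply: cvgD; last exact: cvg_cst.
  apply: cvg_big => [|j _]; first exact: add_continuous.
  by apply: cvgM; [exact: cvg_cst|exact: coord_continuous].
by apply/funext => y; apply/matrixP => i j; rewrite !mxE (ord1 j).
Qed.

Lemma continuous_comp_affine_mx n p (A : 'M[R]_(n, p)) (c : 'cV[R]_n)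
    (h : 'cV[R]_n -> R) : continuous h -> continuous (fun z : 'cV[R]_p => h (A *m z + c)).
Proof.
move=> ch z; apply: (@continuous_comp _ _ _ (fun z => A *m z + c) h); last exact: ch.
exact: continuous_affine_mx.
Qed.

Lemma continuous_comp_mulmx n p (A : 'M[R]_(n, p)) (h : 'cV[R]_n -> R) :
  continuous h -> continuous (fun z : 'cV[R]_p => h (A *m z)).
Proof.
move=> ch; have := @continuous_comp_affine_mx _ _ A 0 _ ch.
by under eq_fun do rewrite addr0.
Qed.

Lemma colt_cons n x (t : n.-tuple mR) :
  colt (cons_pair (x, t)) = col_mx (x%:M : 'M[R]_1) (colt t) :> 'cV[R]_(1 + n).
Proof.
apply/matrixP => i j; rewrite (ord1 j) !mxE tnth_cons_pair.
case: splitP => k kE; last first.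
  have -> : i = lift ord0 k by apply: val_inj.
  by rewrite liftK mxE.
have -> : i = ord0 by apply: val_inj; move: kE; rewrite (ord1 k).
by rewrite unlift_none (ord1 k) mxE mulr1n.
Qed.

Lemma integral_colt_cons n (h : 'cV[R]_(1 + n) -> R) :
  continuous h -> (forall z, 0 <= h z) ->
  integral_colt h =
    (\int[leb]_x integral_colt (fun y => h (col_mx (x%:M : 'M[R]_1) y)))%E.
Proof.
move=> ch h0; rewrite /integral_colt (@integral_lebesgue_cons _ n)//.
- by under eq_integral do under eq_integral do rewrite colt_cons.
- exact: measurable_colt.
- by move=> x; rewrite lee_fin.
Qed.

Lemma integral_colt_consC n (h : 'cV[R]_(1 + n) -> R) :
  continuous h -> (forall z, 0 <= h z) ->
  integral_colt h =
    (\int[lebesgue_tuple n]_t \int[leb]_x (h (col_mx (x%:M : 'M[R]_1) (colt t)))%:E)%E.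
Proof.
move=> ch h0; rewrite /integral_colt (@integral_lebesgue_consC _ n)//.
- by under eq_integral do under eq_integral do rewrite colt_cons.
- exact: measurable_colt.
- by move=> x; rewrite lee_fin.
Qed.


Lemma continuous_col_mxl n (y : 'cV[R]_n) (h : 'cV[R]_(1 + n) -> R) :
  continuous h -> continuous (fun x : R => h (col_mx (x%:M : 'M[R]_1) y)).
Proof.
move=> ch x; have := @continuous_comp_affine_mx _ _ (col_mx 1%:M 0) (col_mx 0 y) _ ch.
have e z : col_mx 1%:M 0 *m z + col_mx 0 y = col_mx z y :> 'cV[R]_(1 + n).
  by rewrite mul_col_mx mul1mx mul0mx add_col_mx addr0 add0r.
under eq_fun do rewrite e.
move=> /(_ (x%:M)) c1.
apply: (@continuous_comp _ _ _ (fun x : R => x%:M : 'M[R]_1)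
  (fun z : 'cV[R]_1 => h (col_mx z y))); last exact: c1.
have -> : (fun x : R => x%:M : 'M[R]_1) = (fun x : R => \col_(i < 1) x).
  by apply/funext => z; apply/matrixP => i j; rewrite !mxE !ord1 mulr1n.
by apply: (@cvg_col _ _ _ (nbhs x)) => l; rewrite mxE; exact: cvg_id.
Qed.

Lemma continuous_col_mxr n (x : 'cV[R]_1) (h : 'cV[R]_(1 + n) -> R) :
  continuous h -> continuous (fun y : 'cV[R]_n => h (col_mx x y)).
Proof.
move=> ch; have := @continuous_comp_affine_mx _ _ (col_mx 0 1%:M) (col_mx x 0) _ ch.
have e z : col_mx 0 1%:M *m z + col_mx x 0 = col_mx x z :> 'cV[R]_(1 + n).
  by rewrite mul_col_mx mul1mx mul0mx add_col_mx addr0 add0r.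
by under eq_fun do rewrite e.
Qed.

Lemma continuous_scaled (T : topologicalType) (k : R) (h : T -> R) :
  continuous h -> continuous (fun z => k * h z).
Proof. by move=> ch z; apply: cvgM; [exact: cvg_cst|exact: ch]. Qed.

(** With the first coordinate integrated innermost, the map is affine in it with slope a, its offset
    depending only on the other coordinates. *)
Lemma integral_colt_head n (a : R) (r : 'rV[R]_n) (c : R) (h : 'cV[R]_(1 + n) -> R) :
  a != 0 -> continuous h -> (forall z, 0 <= h z) ->
  integral_colt (fun z => h (block_mx a%:M r 0 1%:M *m z + col_mx (c%:M : 'M[R]_1) 0)) =
  integral_colt (fun z => (`|a|)^-1 * h z).
Proof.
move=> a0 ch h0; rewrite integral_colt_consC//; last exact: continuous_comp_affine_mx.
rewrite integral_colt_consC; [|exact: continuous_scaled|]; last first.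
  by move=> z; rewrite mulr_ge0 ?invr_ge0.
apply: eq_integral => t _.
rewrite -(@integral_affine _ (fun x => h (col_mx (x%:M : 'M[R]_1) (colt t))) a
  ((r *m colt t) 0 0 + c))//; last exact: continuous_col_mxl.
apply: eq_integral => x _; congr (h _)%:E.
rewrite mul_block_col add_col_mx mul0mx add0r mul1mx addr0; congr col_mx.
apply/matrixP => i j; rewrite !ord1 -scalar_mxM.
by rewrite !mxE !mulr1n addrA.
Qed.

Lemma integral_colt_translation n (c : 'cV[R]_n) (h : 'cV[R]_n -> R) :
  continuous h -> (forall z, 0 <= h z) ->
  integral_colt (fun z => h (z + c)) = integral_colt h.
Proof.
elim: n => [|n IHn] in c h * => ch h0.
  by apply: eq_integral => x _; congr (h _)%:E; apply/matrixP => -[].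
rewrite -[c](@vsubmxK _ 1 n 1); move: (usubmx _) (dsubmx _) => c1 c2.
pose g (z : 'cV[R]_(1 + n)) := h (z + col_mx 0 c2).
have cg : continuous g.
  have := @continuous_comp_affine_mx _ _ 1%:M (col_mx 0 c2 : 'cV[R]_(1 + n)) _ ch.
  by under eq_fun do rewrite mul1mx.
transitivity (integral_colt g).
  have := @integral_colt_head n 1 0 (c1 0 0) _ (oner_neq0 _) cg (fun=> h0 _).
  rewrite /integral_colt.
  under [in RHS]eq_integral do rewrite normr1 invr1 mul1r.
  move=> <-; apply: eq_integral => x _; congr (h _)%:E.
  by rewrite -scalar_mx_block mul1mx -addrA add_col_mx addr0 add0r -mx11_scalar.
rewrite (@integral_colt_cons n g)//; last by move=> z; exact: h0.
rewrite (@integral_colt_cons n h)//; apply: eq_integral => x _.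
rewrite -(IHn c2 (fun y => h (col_mx (x%:M : 'M[R]_1) y)))//; last first.
  exact: continuous_col_mxr.
by apply: eq_integral => t _; rewrite /g add_col_mx addr0.
Qed.

(* Gaussian elimination factors an invertible matrix into shears, a scaling of the
   first coordinate and a map of the remaining coordinates. *)
Lemma integral_colt_mulmx n (A : 'M[R]_n) (h : 'cV[R]_n -> R) : \det A != 0 ->
  continuous h -> (forall z, 0 <= h z) ->
  integral_colt (fun z => h (A *m z)) = integral_colt (fun z => `|\det A|^-1 * h z).
Proof.
pose P k (B : 'M[R]_k) := forall g : 'cV[R]_k -> R, continuous g -> (forall z, 0 <= g z) ->
  integral_colt (fun z => g (B *m z)) = integral_colt (fun z => `|\det B|^-1 * g z).
have PM k (B C : 'M[R]_k) : P k B -> P k C -> P k (B *m C).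
  move=> PB PC g cg g0; rewrite det_mulmx normrM invfM.
  transitivity (integral_colt (fun z => (fun y => g (B *m y)) (C *m z))).
    by apply: eq_integral => x _; rewrite mulmxA.
  rewrite (PC (fun y => g (B *m y)))//; last exact: continuous_comp_mulmx.
  rewrite (PB (fun z => `|\det C|^-1 * g z)); [|exact: continuous_scaled|]; last first.
    by move=> z; rewrite mulr_ge0 ?invr_ge0.
  by apply: eq_integral => x _; rewrite mulrA.
have PU k (a : R) (r : 'rV[R]_k) : a != 0 -> P (1 + k)%N (block_mx a%:M r 0 1%:M).
  move=> a0 g cg g0; have := integral_colt_head r 0 a0 cg g0.
  rewrite det_ublock det1 mulr1 det_scalar1 => <-.
  by apply: eq_integral => x _; rewrite raddf0 col_mx0 addr0.
have PL k (c : 'cV[R]_k) (S : 'M[R]_k) : P k S ->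
    P (1 + k)%N (block_mx (1%:M : 'M[R]_1) 0 c S).
  move=> PS g cg g0; rewrite det_lblock det1 mul1r.
  rewrite integral_colt_cons; [|exact: continuous_comp_mulmx|by []].
  rewrite integral_colt_cons; [|exact: continuous_scaled|]; last first.
    by move=> z; rewrite mulr_ge0 ?invr_ge0.
  apply: eq_integral => x _.
  have cx : continuous (fun y : 'cV[R]_k => g (col_mx (x%:M : 'M[R]_1) y)).
    exact: continuous_col_mxr.
  pose f (y : 'cV[R]_k) := g (col_mx (x%:M : 'M[R]_1) (y + c *m (x%:M : 'M[R]_1))).
  have cf : continuous f.
    have := @continuous_comp_affine_mx _ _ 1%:M (c *m (x%:M : 'M[R]_1)) _ cx.
    by under eq_fun do rewrite mul1mx.
  have f0 y : 0 <= f y by exact: g0.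
  transitivity (integral_colt (fun y => f (S *m y))).
    apply: eq_integral => t _; congr (g _)%:E.
    by rewrite mul_block_col mul1mx mul0mx addr0 addrC.
  rewrite (PS f cf f0).
  apply: (@integral_colt_translation _ (c *m (x%:M : 'M[R]_1))
    (fun y => `|\det S|^-1 * g (col_mx (x%:M : 'M[R]_1) y))); first exact: continuous_scaled.
  by move=> z; rewrite mulr_ge0 ?invr_ge0.
suff : forall k (B : 'M[R]_k), \det B != 0 -> P k B by move=> /(_ n A) PA /PA; exact.
elim=> [|k IHk] B detB.
  move=> g _ _; rewrite det_mx00 normr1 invr1; apply: eq_integral => x _.
  by rewrite mul1r; congr (g _)%:E; apply/matrixP => -[].
(* Non-zero pivot: one elimination step leaves the Schur complement D - a^-1 c r, which is
   invertible as well. *)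
have PN (a : R) (r : 'rV[R]_k) (c : 'cV[R]_k) (D : 'M[R]_k) : a != 0 ->
    \det (block_mx a%:M r c D : 'M[R]_(1 + k)) != 0 -> P (1 + k)%N (block_mx a%:M r c D).
  move=> a0.
  have -> : block_mx a%:M r c D =
      block_mx 1%:M 0 (a^-1 *: c) (D - a^-1 *: (c *m r)) *m block_mx a%:M r 0 1%:M.
    rewrite mulmx_block !mul1mx !mul0mx !mulmx0 !addr0 mulmx1.
    rewrite mul_mx_scalar scalerA mulfV// scale1r -scalemxAl.
    by rewrite addrCA subrr addr0.
  rewrite det_mulmx det_lblock det1 mul1r mulf_eq0 negb_or => /andP[dS _].
  by apply: PM; [apply: PL; exact: IHk|exact: PU].
rewrite -[B](@submxK _ 1 k 1 k) in detB *.
move: (ulsubmx _) (ursubmx _) (dlsubmx _) (drsubmx _) detB => a r c D.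
rewrite [a]mx11_scalar; move: (a 0 0) => {}a detB.
have [a0|a0] := eqVneq a 0; last exact: PN.
(* Zero pivot: the first column has another non-zero entry, and adding its row to the first row
   makes this entry the pivot. *)
have [i ci] : exists i, c i 0 != 0.
  apply/existsP; move: detB; apply: contraNT => /existsPn c0.
  have -> : c = 0.
    by apply/matrixP => i j; rewrite ord1 mxE; apply/eqP; move: (c0 i); rewrite negbK.
  by rewrite (@det_ublock _ 1 k) a0 det_scalar1 mul0r.
have := detB; pose s := delta_mx 0 i : 'rV[R]_k.
have -> : block_mx a%:M r c D = block_mx 1%:M (- s) 0 1%:M *m
    block_mx (c i 0)%:M (r + s *m D) c D.
  rewrite mulmx_block !mul1mx !mul0mx !add0r mulNmx -rowE a0 raddf0; congr block_mx.
    by rewrite (_ : row i c = (c i 0)%:M) ?subrr// [LHS]mx11_scalar mxE.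
  by rewrite mulNmx addrK.
rewrite det_mulmx (@det_ublock _ 1 k) !det1 !mul1r => d'.
by apply: PM; [apply: (@PU _ 1)|exact: PN]; rewrite ?oner_neq0.
Qed.

Lemma integral_colt_affine n (A : 'M[R]_n) (c : 'cV[R]_n) (h : 'cV[R]_n -> R) :
  \det A != 0 -> continuous h -> (forall z, 0 <= h z) ->
  integral_colt (fun z => `|\det A| * h (c + A *m z)) = integral_colt h.
Proof.
move=> A0 ch h0.
rewrite -(@integral_colt_translation _ c h)//.
have cc : continuous (fun z : 'cV[R]_n => `|\det A| * h (z + c)).
  apply: continuous_scaled; have := @continuous_comp_affine_mx _ _ 1%:M c _ ch.
  by under eq_fun do rewrite mul1mx.
transitivity (integral_colt (fun z => `|\det A| * h (A *m z + c))).
  by apply: eq_integral => x _; rewrite addrC.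
rewrite (@integral_colt_mulmx _ A (fun z => `|\det A| * h (z + c)))//; last first.
  by move=> z; rewrite mulr_ge0.
by apply: eq_integral => x _; rewrite mulKf// normr_eq0.
Qed.

End linear_substitution.

(** * Rayleigh quotients and the eigenvalue condition *)

Section rayleigh.
Variables (R : realType) (n : nat) (A : 'M[R]_n).
Hypothesis symA : A^T = A.

Let form (B : 'M[R]_n) (v : 'rV[R]_n) : R := (v *m B *m v^T) 0 0.

Let continuous_form B : continuous (form B).
Proof.
rewrite (_ : form B = fun v => \sum_j (\sum_i v 0 i * B i j) * v 0 j); last first.
  by apply/funext => v; rewrite /form mxE; apply: eq_bigr => j _; rewrite !mxE.
move=> v; apply: (@cvg_big _ _ _ _ _ _ _ (nbhs v)) => [|j _]; first exact: add_continuous.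
apply: cvgM; last exact: coord_continuous.
apply: (@cvg_big _ _ _ _ _ _ _ (nbhs v)) => [|i _]; first exact: add_continuous.
by apply: cvgM; [exact: coord_continuous|exact: cvg_cst].
Qed.

Let formZ B (c : R) v : form B (c *: v) = c ^+ 2 * form B v.
Proof.
by rewrite /form linearZ/= -!scalemxAl -scalemxAr !mxE mulrA.
Qed.

Let form1E v : form 1%:M v = \sum_j v 0 j ^+ 2.
Proof.
by rewrite /form mulmx1 mxE; apply: eq_bigr => j _; rewrite mxE expr2.
Qed.

Let form1_gt0 v : v != 0 -> 0 < form 1%:M v.
Proof.
move=> v0; rewrite form1E lt_def sumr_ge0 ?andbT => [|j _]; last exact: sqr_ge0.
apply: contra v0; rewrite psumr_eq0 => [/allP h|j _]; last exact: sqr_ge0.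
apply/eqP/rowP => j; rewrite mxE; apply/eqP.
by rewrite -sqrf_eq0; apply: h; rewrite mem_index_enum.
Qed.

Let compact_sphere : compact [set v | form 1%:M v = 1].
Proof.
apply: (@subclosed_compact _ _ [set v : 'rV[R]_n | forall i, `[-1, 1]%classic (v ord0 i)]).
- rewrite (_ : mkset _ = form 1%:M @^-1` [set 1])//.
  by apply: preimage_closed; [move=> x _; exact: continuous_form|exact: closed_eq].
- exact: (@rV_compact R n (fun=> `[-1, 1]%classic) (fun=> @segment_compact R (-1) 1)).
- move=> v /= h i; rewrite in_itv/= -ler_norml -(@ler_pXn2r _ 2)// ?nnegrE//.
  rewrite expr1n real_normK ?num_real// -h form1E (bigD1 i)//= lerDl.
  by apply: sumr_ge0 => j _; exact: sqr_ge0.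
Qed.

(* A minimiser of the Rayleigh quotient is an eigenvector. *)
Lemma eigenvalue_ge1_form : (forall lambda, eigenvalue A lambda -> 1 <= lambda) ->
  forall z : 'cV[R]_n, (z^T *m z) 0 0 <= (z^T *m A *m z) 0 0.
Proof.
move=> eigA.
suff h v : form 1%:M v <= form A v.
  by move=> z; have := h z^T; rewrite /form mulmx1 trmxK.
have [->|v0] := eqVneq v 0; first by rewrite /form !mul0mx.
pose S := [set v | form 1%:M v = 1].
have S0 (w : 'rV[R]_n) : w != 0 -> S ((Num.sqrt (form 1%:M w))^-1 *: w).
  move=> w0; rewrite /S/= formZ exprVn sqr_sqrtr ?(ltW (form1_gt0 w0))//.
  by rewrite mulVf// gt_eqF// form1_gt0.
have [u /set_mem uS umin] : exists2 c, c \in S & forall t, t \in S -> form A c <= form A t.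
  apply: EVT_min_rV; [by exists ((Num.sqrt (form 1%:M v))^-1 *: v); exact: S0| |].
    exact: compact_sphere.
  by apply: continuous_subspaceT; exact: continuous_form.
set l := form A u in umin.
have lv w : l * form 1%:M w <= form A w.
  have [->|w0] := eqVneq w 0; first by rewrite /form !mul0mx !mxE mulr0.
  have := umin _ (mem_set (S0 _ w0)); rewrite formZ exprVn sqr_sqrtr ?(ltW (form1_gt0 w0))//.
  by rewrite ler_pdivlMl ?form1_gt0// mulrC.
have l1 : 1 <= l; last first.
  by apply: le_trans (lv v); rewrite ler_peMl// ltW// form1_gt0.
apply: eigA; apply/eigenvalueP; exists u; last first.
  apply: contraPneq uS => -> ; rewrite /S/= /form !mul0mx mxE => /eqP.
  by rewrite eq_sym oner_eq0.
pose B := A - l%:M.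
have BT : B^T = B by rewrite /B linearB/= tr_scalar_mx symA.
have formB w : form B w = form A w - l * form 1%:M w.
  by rewrite /form /B mulmxBr mulmxBl mulmx1 mul_mx_scalar -scalemxAl !mxE.
have B0 w : 0 <= form B w by rewrite formB subr_ge0.
have Bu : form B u = 0 by rewrite formB uS mulr1 subrr.
suff : u *m B = 0.
  by rewrite /B mulmxBr mul_mx_scalar => /eqP; rewrite subr_eq0 => /eqP.
clearbody B; set w := u *m B.
have Bt t : form B (u + t *: w) = 2 * t * form 1%:M w + t ^+ 2 * form B w.
  have e : (w *m B *m u^T) 0 0 = form 1%:M w.
    by rewrite /form mulmx1 -mulmxA; congr ((_ *m _) 0 0); rewrite /w trmx_mul BT.
  have e' : (u *m B *m w^T) 0 0 = form 1%:M w by rewrite /form mulmx1.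
  have -> : form B (u + t *: w) = ((u + t *: w) *m B *m (u^T + t *: w^T)) 0 0.
    by rewrite /form [(u + _)^T]linearD/= [(t *: _)^T]linearZ.
  rewrite !mulmxDl !mulmxDr -!scalemxAl -!scalemxAr.
  have D (M N : 'M[R]_1) : (M + N) 0 0 = M 0 0 + N 0 0 by rewrite mxE.
  have Z (c : R) (M : 'M[R]_1) : (c *: M) 0 0 = c * M 0 0 by rewrite mxE.
  have e0 : (u *m B *m u^T) 0 0 = 0 := Bu.
  rewrite !(D, Z) e e' e0 -/(form B w).
  by move: (form 1%:M w) (form B w) => p q; ring.
have [//|w0] := eqVneq w 0.
have p0 := form1_gt0 w0.
have q0 := B0 w.
(* A small step from u against w = u B would make the nonnegative form negative. With p = |w|^2 and
   q = form B w, the step p / (1 + q) is defined even for q = 0 and gives the value - (p / (1 +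
   q))^2 (2 + q). *)
have := B0 (u - (form 1%:M w / (1 + form B w)) *: w).
rewrite -scaleNr Bt.
move: (form 1%:M w) (form B w) p0 q0 => p q p0 q0.
have q1 : 0 < 1 + q by lra.
rewrite (_ : 2 * - (p / (1 + q)) * p + (- (p / (1 + q))) ^+ 2 * q =
  - (p / (1 + q)) ^+ 2 * (2 + q)); last by field; rewrite gt_eqF.
have : 0 < (p / (1 + q)) ^+ 2 * (2 + q).
  by rewrite mulr_gt0// ?exprn_gt0 ?divr_gt0//; lra.
by rewrite mulNr oppr_ge0 => h1 h2; move: (lt_le_trans h1 h2); rewrite ltxx.
Qed.

End rayleigh.

(** * Importance sampling *)

Section importance_sampling.
Variables (R : realType) (d : nat).
Local Notation mR := (measurableTypeR R).

Lemma posdef_factor (S L : 'M[R]_d) : posdef S -> L *m L^T = S ->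
  \det L != 0 /\ Num.sqrt (\det S) = `|\det L|.
Proof.
move=> [_ Sp] LS; split; last by rewrite -LS det_mulmx det_tr -expr2 sqrtr_sqr.
apply/eqP => /eqP/det0P[x x0 xL].
have /Sp : x^T != 0 by rewrite -trmx0 (inj_eq trmx_inj).
by rewrite trmxK -LS mulmxA xL !mul0mx mxE ltxx.
Qed.

Lemma v_plus_ge0 (eta x : R) : 0 < eta -> 0 <= v_plus eta x.
Proof.
move=> e0; rewrite /v_plus -lerBlDl sub0r.
apply: (le_trans (ler_norm _)); rewrite normrN -sqrtr_sqr ler_wsqrtr// expr_div_n.
by have : 0 < eta := e0; move: (x ^+ 2) => y e; lra.
Qed.

Lemma v_minusE (eta x : R) : v_minus eta x = v_plus eta (- x).
Proof. by rewrite /v_minus /v_plus sqrrN mulNr. Qed.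

Lemma v_plus_minus (eta x : R) : v_plus eta x - v_minus eta x = x.
Proof. by rewrite /v_plus /v_minus; move: (Num.sqrt _) => y; lra. Qed.

Definition gauss (z : 'cV[R]_d) : R :=
  (Num.sqrt ((2 * pi) ^+ d))^-1 * expR (- (2^-1 * (z^T *m z) 0 0)).

Lemma gauss_weightE (x : d.-tuple mR) : gauss_weight x = gauss (colt x).
Proof.
rewrite /gauss_weight /gauss; under eq_bigr do rewrite normal_pdf01E.
rewrite big_split/= prodr_const card_ord -expR_sum exprVn; congr (_^-1 * expR _).
  elim: d => [|n IHn]; first by rewrite !expr0 sqrtr1.
  by rewrite !exprS [RHS]sqrtrM ?mulr_ge0 ?pi_ge0// IHn.
rewrite sumrN -mulr_sumr mxE; congr (- (_ * _)).
by apply: eq_bigr => l _; rewrite !mxE expr2.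
Qed.

Lemma continuous_gauss : continuous gauss.
Proof.
apply: (@continuous_scaled R 'cV[R]_d).
apply: (@continuous_comp_derive _ _ (fun z : 'cV[R]_d => - (2^-1 * (z^T *m z) 0 0)) expR expR).
rewrite (_ : (fun z : 'cV[R]_d => _) = fun z : 'cV[R]_d => - 2^-1 * \sum_l z l 0 * z l 0).
  apply: (@continuous_scaled R 'cV[R]_d) => z.
  apply: (@cvg_big _ _ _ _ _ _ _ (nbhs z)) => [|l _]; first exact: add_continuous.
  by apply: cvgM; exact: coord_continuous.
by apply/funext => y; rewrite mxE mulNr; under eq_bigr do rewrite mxE.
Qed.

Variables (v : R -> R) (G : 'cV[R]_d -> R) (mu0 mu : 'cV[R]_d) (S0 S L : 'M[R]_d).
Hypotheses (Sp : posdef S) (LS : L *m L^T = S) (v_ge0 : forall x, 0 <= v x).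
Let GIS := G_IS v G mu0 S0 mu S L.
Hypothesis gGIS : growth [::] GIS.
Let F z := v (G z) * normal_density mu0 S0 z.

(** The weight is the ratio of the target density at mu + L z to the standard Gaussian density at z,
    times the Jacobian |det L| = sqrt (det S). *)
Lemma G_IS_gauss z : GIS z * gauss z = `|\det L| * F (mu + L *m z).
Proof.
rewrite /gauss /GIS /G_IS /IS_weight /F /normal_density.
have [_ ->] := posdef_factor Sp LS; rewrite sqrtrM; last first.
  by rewrite exprn_ge0// mulr_ge0// pi_ge0.
have -> : mu + L *m z - mu0 = mu - mu0 + L *m z by rewrite addrAC.
rewrite invfM.
set q := ((_ + _)^T *m _ *m _) 0 0; set p := (_^T *m _) 0 0.
have -> : expR (- (2^-1 * q)) = expR (2^-1 * p - 2^-1 * q) * expR (- (2^-1 * p)).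
  by rewrite -expRD; congr expR; move: p q => p q; ring.
move: (expR _) (expR _) (v _) => e1 e2 w.
move: (Num.sqrt (\det S0))^-1 (Num.sqrt _)^-1 `|_| => r s l; ring.
Qed.

Lemma G_IS_ge0 z : 0 <= GIS z.
Proof. by rewrite mulr_ge0 ?mulr_ge0 ?divr_ge0 ?sqrtr_ge0 ?expR_ge0. Qed.

Let L0 : \det L != 0. Proof. by have [] := posdef_factor Sp LS. Qed.

Let continuous_F : continuous F.
Proof.
have Lu : L \in unitmx by rewrite unitmxE unitfE.
(* Continuity is known for GIS, so that of F is recovered through the inverse affine map. *)
have cg : continuous (fun z => `|\det L|^-1 * (GIS z * gauss z)).
  have [cG _] := gGIS.
  by apply: (@continuous_scaled R _) => z; exact: cvgM (cG z) (@continuous_gauss z).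
have := @continuous_comp_affine_mx _ _ _ (invmx L) (- (invmx L *m mu)) _ cg.
rewrite (_ : (fun=> _) = F)//; apply/funext => y.
rewrite G_IS_gauss mulKf ?normr_eq0//; congr F.
by rewrite mulmxDr mulmxN !mulKVmx// addrC subrK.
Qed.

Let F_ge0 z : 0 <= F z.
Proof. by rewrite mulr_ge0// mulr_ge0 ?invr_ge0 ?sqrtr_ge0 ?expR_ge0. Qed.

Lemma integral_G_IS :
  (\int[lebesgue_tuple d]_x (GIS (colt x) * gauss_weight x)%:E =
   \int[lebesgue_tuple d]_x (F (colt x))%:E)%E.
Proof.
rewrite -[RHS](@integral_colt_affine _ _ L mu F L0 continuous_F F_ge0).
by apply: eq_integral => x _; rewrite gauss_weightE G_IS_gauss.
Qed.

Lemma cvg_avg_G_IS (b : nat) (b_gt1 : (1 < b)%N) :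
  (lebesgue_tuple d).-integrable setT (fun x => (F (colt x))%:E) /\
  (#|{: {ffun 'I_d -> {ffun 'I_n -> 'I_b}}}|%:R)^-1 *
    \sum_(y : {ffun 'I_d -> {ffun 'I_n -> 'I_b}}) GIS (cell_vector R b_gt1 y)
  @[n --> \oo] --> integral_Rd F.
Proof.
have [cG bG] := gGIS.
(* Any exponent in ]0, 1[ gives an integrable weight. *)
have [K hK] := bG 2^-1 ltac:(by rewrite invr_gt0).
have [||iG cvgG] := @cvg_avg_cells R b d b_gt1 GIS K 2^-1 cG G_IS_ge0.
- by apply/andP; split; lra.
- by move=> z; apply: le_trans (hK z); exact: ler_norm.
rewrite /integral_Rd (_ : \int[_]_x F (colt x) =
  \int[lebesgue_tuple d]_x (GIS (colt x) * gauss_weight x)); last first.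
  by rewrite /Rintegral integral_G_IS.
split=> //; move/integrableP: iG => [_ ioo]; apply/integrableP; split.
  exact: measurable_colt.
under eq_integral do rewrite abse_EFin ger0_norm//.
rewrite -integral_G_IS; apply: le_lt_trans ioo.
by under [leRHS]eq_integral do rewrite abse_EFin ger0_norm ?mulr_ge0 ?G_IS_ge0 ?gauss_weight_ge0//.
Qed.

End importance_sampling.

Lemma growth_G_IS (R : realType) (d : nat) (v : R -> R) (G : 'cV[R]_d -> R)
    (mu0 mu : 'cV[R]_d) (S0 S L : 'M[R]_d) s : posdef S0 ->
  (forall lambda, eigenvalue (L^T *m invmx S0 *m L) lambda -> 1 <= lambda) ->
  growth s (fun z => v (G (mu + L *m z))) -> growth s (G_IS v G mu0 S0 mu S L).
Proof.
move=> [S0T _] eigL gv; apply: (growthM gv); apply: growth_IS_weight.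
apply: eigenvalue_ge1_form => //.
by rewrite !trmx_mul trmxK trmx_inv S0T mulmxA.
Qed.

Theorem theorem3p9 (R : realType) (d : nat) (G : 'cV[R]_d -> R)
    (mu0 : 'cV[R]_d) (Sigma0 : 'M[R]_d)
    (mup mum : 'cV[R]_d) (Sigmap Sigmam Lp Lm : 'M[R]_d)
    (eta : R) (t b : nat) (b_gt1 : (1 < b)%N) :
  posdef Sigma0 -> posdef Sigmap -> posdef Sigmam ->
  Lp *m Lp^T = Sigmap -> Lm *m Lm^T = Sigmam ->
  0 < eta ->
  (forall lambda, eigenvalue (Lp^T *m invmx Sigma0 *m Lp) lambda ->
     1 <= lambda) ->
  (forall lambda, eigenvalue (Lm^T *m invmx Sigma0 *m Lm) lambda ->
     1 <= lambda) ->
  qmc_friendly (fun z => G (mup + Lp *m z)) ->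
  qmc_friendly (fun z => G (mum + Lm *m z)) ->
  let C := integral_Rd (fun z => G z * normal_density mu0 Sigma0 z) in
  let Gp := G_IS (v_plus eta) G mu0 Sigma0 mup Sigmap Lp in
  let Gm := G_IS (v_minus eta) G mu0 Sigma0 mum Sigmam Lm in
  forall eps : R, 0 < eps ->
  exists (K : R) (m0 : nat), forall m : nat, (m0 <= m)%N ->
  forall a : 'I_(b ^ m) -> 'cV[R]_d, is_net b t m a ->
  forall (disp : measure_display) (Omega : measurableType disp)
    (P : probability Omega R)
    (perms : Omega -> 'I_d -> seq 'I_b -> {perm 'I_b}),
  uniform_independent_perms P perms ->
  let u w i := scramble b_gt1 (perms w) (a i) in
  let err w := I_hat (u w) (fun z => Gp z - Gm z) - C in
  (sqrte 'E_P[(fun w => err w ^+ 2)%R] <=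
   (K * (b ^ m)%N%:R `^ (- 1 + eps))%R%:E)%E.
Proof.
move=> pS0 pSp pSm LSp LSm eta_gt0 eigp eigm qmcp qmcm C Gp Gm eps eps_gt0.
pose vp : R -> R := v_plus eta; pose vm : R -> R := v_minus eta.
have vp0 x : 0 <= vp x by exact: v_plus_ge0.
have vm0 x : 0 <= vm x by rewrite /vm v_minusE; exact: v_plus_ge0.
have gGp : growth (rev (enum 'I_d)) Gp.
  by apply: growth_G_IS => //; apply: growth_v_plus => //; exact: growth_qmc_friendly.
have gGm : growth (rev (enum 'I_d)) Gm.
  by apply: growth_G_IS => //; apply: growth_v_minus => //; exact: growth_qmc_friendly.
pose H z := Gp z - Gm z.
have gH : growth (rev (enum 'I_d)) H.
  apply: eq_growth (growthD gGp (growthM (growth_cst _ (- 1)) gGm)) => z.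
  by rewrite mulN1r.
have [cH _] := growth_nil gH.
pose av (F : 'cV[R]_d -> R) n : R := (#|{: {ffun 'I_d -> {ffun 'I_n -> 'I_b}}}|%:R)^-1 *
  \sum_(y : {ffun 'I_d -> {ffun 'I_n -> 'I_b}}) F (cell_vector R b_gt1 y).
have avgC : av H n @[n --> \oo] --> C.
  have [ip cp] := cvg_avg_G_IS pSp LSp vp0 (growth_nil gGp) b_gt1.
  have [im cm] := cvg_avg_G_IS pSm LSm vm0 (growth_nil gGm) b_gt1.
  have -> : C = integral_Rd (fun z => vp (G z) * normal_density mu0 Sigma0 z) -
                integral_Rd (fun z => vm (G z) * normal_density mu0 Sigma0 z).
    rewrite /integral_Rd -RintegralB//; apply: eq_Rintegral => x _.
    by rewrite -mulrBl v_plus_minus.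
  have -> : av H = (fun n => av Gp n - av Gm n).
    by apply/funext => n; rewrite /av sumrB mulrBr.
  exact: cvgB cp cm.
(* The variance bound is available for exponents up to 1/4; a larger eps only weakens the claim,
   since N >= 1. *)
pose e := Num.min eps 4^-1.
have e_gt0 : 0 < e by rewrite /e lt_min eps_gt0 invr_gt0 ltr0n.
have e_le : 0 < e <= 4^-1 by rewrite e_gt0/= /e ge_min lexx orbT.
have [K K0 hK] := discrete_variance b_gt1 t e_le gH.
exists (Num.sqrt K), 0%N => m _ a neta disp Omega P perms permsP.
pose err w := I_hat (fun i => scramble b_gt1 (perms w) (a i)) H - C.
change (sqrte 'E_P[(fun w => err w ^+ 2)%R] <=
  (Num.sqrt K * (b ^ m)%N%:R `^ (- 1 + eps))%R%:E)%E.
have N0 : (0 < b ^ m)%N by rewrite expn_gt0 ltnW.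
set N := (b ^ m)%N in N0 *.
have N1 : 1 <= N%:R :> R by rewrite ler1n.
have Ngt0 : 0 < N%:R :> R by rewrite ltr0n.
have mse : ('E_P[(fun w => err w ^+ 2)%R] <= (N%:R ^- 2 * (K * N%:R `^ (2 * e)))%:E)%E.
  rewrite unlock; apply: (@scrambled_mse _ _ _ P d b b_gt1 perms permsP N a H (av H) C _ m) => //.
  by move=> M mM; rewrite /av mulrA; exact: hK.
have Ne : N%:R `^ (2 * e) = (N%:R `^ e) ^+ 2 by rewrite mulrC powRrM powR_mulrn ?powR_ge0.
apply: (@le_trans _ _ (Num.sqrt K * N%:R `^ (- 1 + e))%:E); last first.
  by rewrite lee_fin ler_wpM2l ?sqrtr_ge0// ler_powR// lerD2l /e ge_min lexx.
have -> : Num.sqrt K * N%:R `^ (- 1 + e) = Num.sqrt (N%:R ^- 2 * (K * N%:R `^ (2 * e))).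
  rewrite powRD; last by rewrite (gt_eqF Ngt0) implybT.
  rewrite Ne powRN powRr1 ?(ltW Ngt0)// [_ ^- 2 * _]mulrCA -exprVn -exprMn sqrtrM// sqrtr_sqr.
  by rewrite ger0_norm// mulr_ge0 ?powR_ge0// invr_ge0 ltW.
rewrite -[leRHS]/(sqrte (_%:E)) lee_sqrt// lee_fin.
by rewrite mulr_ge0 ?invr_ge0 ?exprn_ge0 ?(ltW Ngt0)// mulr_ge0// powR_ge0.
Qed.
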